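(* Let $(X(t))_{t\in\mathbb{R}}$ be a centered real-valued Gaussian process with stationary increments and semi-variogram $V$, and let $\delta_n=n^{-\alpha}$ with $0<\alpha\le 1$ fixed. Assume: (i) $V$ is $C^\infty$ on $(0,+\infty)$; (ii) $V$ is $2D$ times differentiable on $\mathbb{R}$ for some integer $D\ge 0$, and there exist $C>0$ and $0<s<2$ such that for all $h\in\mathbb{R}$, $V^{(2D)}(h)=V^{(2D)}(0)+C(-1)^D|h|^s+r(h)$, with $r(h)=o(|h|^s)$ as $h\to 0$; if $\alpha<1$, assume in addition that there is a constant $K$ with $|r(h)|\le K|h|^s$ for all $|h|>1$; (iii) with $d=2$ if $s<3/2$ and $d=3$ if $s\ge 3/2$, there exist $\beta$ with $s-d<\beta<-1/2$ and a constant $K'$ such that $|r^{(d)}(h)|\le K'|h|^\beta$ for all $0<|h|<1$ if $\alpha=1$, and for all $h\ne 0$ if $\alpha<1$. Let $a$ be a non-zero finitely supported real sequence with zero sum whose order $M$ satisfies $M>D+s/2+1/4$. Then, as $n\to\infty$, $$\frac{V_{a,n}-\mathbb{E}[V_{a,n}]}{\sqrt{\mathrm{Var}(V_{a,n})}}\longrightarrow\mathcal{N}(0,1)\quad\text{in distribution}.$$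
   Context: The semi-variogram is $V(h)=\frac12\mathbb{E}[(X(t+h)-X(t))^2]$, which does not depend on $t$ by stationarity of increments. A sequence $a$ is written $(a_0,\dots,a_{L-1})$ with $a_0\ne0$, $a_{L-1}\neq 0$; $L=L(a)$ is its length. Its order $M=M(a)$ is the integer such that $\sum_j a_j j^k=0$ for $0\le k<M$ and $\sum_j a_j j^{M}\ne 0$. The discrete $a$-differences of $X$ are $\Delta_{a,i}(X)=\sum_{j=0}^{L-1}a_jX((i+j)\delta_n)$, $i=1,\dots,n'$, with $n'=n-L+1$, and the quadratic $a$-variation is $V_{a,n}=\sum_{i=1}^{n'}(\Delta_{a,i}(X))^2$. *)

(* Defs.v *)
From HB Require Import structures.
From mathcomp Require Import all_boot all_order all_algebra.
From mathcomp Require Import all_classical all_reals all_analysis.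
From mathcomp Require Import measurable_realfun.

Set Implicit Arguments.
Unset Strict Implicit.
Unset Printing Implicit Defensive.

Import Order.TTheory GRing.Theory Num.Theory.
Import numFieldNormedType.Exports.

Local Open Scope classical_set_scope.
Local Open Scope ring_scope.

Section process.
Context (disp : measure_display) (T : measurableType disp) (R : realType).
Variable P : probability T R.
Implicit Types (X : R -> {RV P >-> R}) (Y : T -> R) (Z : nat -> T -> R).

(* Degenerate laws count as Gaussian (e.g. X 0 = 0 for a fractional Brownian
   motion). They need a separate disjunct because [normal_prob m 0] is the
   uniform law on [0, 1], not the Dirac mass at m. *)
Definition gaussian_rv Y : Prop :=
  (exists m s : R, s != 0 /\
     forall A : set R, measurable A -> P (Y @^-1` A) = normal_prob m s A) \/
  (exists m : R,
     forall A : set R, measurable A -> P (Y @^-1` A) = \d_m A).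

Definition gaussian_process X : Prop :=
  forall (n : nat) (t c : 'I_n -> R),
    gaussian_rv (fun w => \sum_(i < n) c i * X (t i) w).

Definition centered_process X : Prop := forall t : R, ('E_P[X t] = 0)%E.

(* All finite-dimensional laws of the process (X (t + h) - X t)_h are the same
   for every t. *)
Definition stationary_increments X : Prop :=
  forall (n : nat) (h : 'I_n -> R) (t : R) (A : set (n.-tuple R)),
    measurable A ->
    P ((fun w => [tuple X (t + h i) w - X t w | i < n]) @^-1` A) =
    P ((fun w => [tuple X (h i) w - X 0 w | i < n]) @^-1` A).

(* The semi-variogram is taken at base point t = 0; [semi_variogramE] shows
   that the base point is irrelevant. *)
Definition semi_variogram X (h : R) : R :=
  2^-1 * fine 'E_P[fun w => ((X h w - X 0 w) ^+ 2)%R]%E.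

Lemma semi_variogramE X (t h : R) : stationary_increments X ->
  semi_variogram X h = 2^-1 * fine 'E_P[fun w => ((X (t + h) w - X t w) ^+ 2)%R]%E.
Proof.
move=> statX; congr (_ * fine _); rewrite unlock.
have mD u : measurable_fun [set: T] (fun w => X (u + h) w - X u w).
  exact: measurable_funB.
pose D u : {RV P >-> R} := mfun_Sub (mem_set (mD u)).
have intD u : (\int[P]_w ((X (u + h) w - X u w) ^+ 2)%:E =
    \int[distribution P (D u)]_y (y ^+ 2)%:E)%E.
  rewrite ge0_integral_distribution//=; last first.
    by move=> y; rewrite lee_fin sqr_ge0.
  apply/measurable_EFinP; exact: exprn_measurable.
have intD0 : (\int[P]_w ((X h w - X 0%R w) ^+ 2)%:E =
    \int[distribution P (D 0%R)]_y (y ^+ 2)%:E)%E.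
  by rewrite -intD add0r.
rewrite intD0 intD.
apply: eq_measure_integral => A mA _.
have mB : measurable ((@tnth 1 R ^~ ord0) @^-1` A).
  by rewrite -[X in measurable X]setTI; exact: measurable_tnth.
have PB u : P ((fun w => [tuple X (u + h) w - X u w | i < 1]) @^-1`
    ((@tnth 1 R ^~ ord0) @^-1` A)) = distribution P (D u) A.
  congr (P _); apply/funext => w /=; by rewrite tnth_mktuple.
rewrite /= -[LHS]PB -[RHS]PB add0r; exact/esym/(statX 1 (fun=> h)).
Qed.

(* Convergence of the cumulative distribution functions at every continuity
   point of the limiting one. *)
Definition cvg_in_distribution Z (mu : probability (measurableTypeR R) R) : Prop :=
  forall x : R, {for x, continuous (fun y : R => fine (mu `]-oo, y]%classic))} ->
    P [set w | Z n w <= x] @[n --> \oo] --> mu `]-oo, x]%classic.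

End process.

Section variation.
Context (R : realType).
Implicit Types (a : seq R) (f : R -> R).

Definition proper_sequence a : Prop :=
  [/\ a != [::], a`_0 != 0 & last 0 a != 0].

Definition has_order a (M : nat) : Prop :=
  (forall k, (k < M)%N -> \sum_(j < size a) a`_j * j%:R ^+ k = 0) /\
  \sum_(j < size a) a`_j * j%:R ^+ M != 0.

Definition mesh (alpha : R) (n : nat) : R := n%:R `^ (- alpha).

(* [f] plays the role of a sample path of the process. *)
Definition a_difference a (delta : R) f (i : nat) : R :=
  \sum_(j < size a) a`_j * f ((i + j)%:R * delta).

(* n' = n - L + 1 is written n.+1 - L, and is 0 when n < L. *)
Definition quadratic_a_variation a (alpha : R) (n : nat) f : R :=
  \sum_(1 <= i < (n.+1 - size a).+1) a_difference a (mesh alpha n) f i ^+ 2.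

Definition smooth_on (A : set R) f : Prop :=
  forall k x, A x -> derivable (f^`(k)%classic) x 1.

Definition times_differentiable (m : nat) f : Prop :=
  forall k x, (k < m)%N -> derivable (f^`(k)%classic) x 1.

Definition remainder_order (s : R) : nat := if s < 3 / 2 then 2 else 3.

End variation.

Section normalized_variation.
Context (disp : measure_display) (T : measurableType disp) (R : realType).
Variables (P : probability T R) (X : R -> {RV P >-> R}) (a : seq R) (alpha : R).

Definition Van (n : nat) (w : T) : R :=
  quadratic_a_variation a alpha n (fun t => X t w).

(* If the variance vanished, the quotient would be 0 by the convention
   0^-1 = 0. *)
Definition normalized_Van (n : nat) (w : T) : R :=
  (Van n w - fine 'E_P[Van n]%E) / Num.sqrt (fine 'V_P[Van n]%E).

End normalized_variation.

(* Main.v *)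
Require Import Defs.
From HB Require Import structures.
From mathcomp Require Import all_boot all_order all_algebra.
From mathcomp Require Import all_classical all_reals all_analysis.
From mathcomp Require Import measurable_realfun ring lra.
Set Implicit Arguments.
Unset Strict Implicit.
Unset Printing Implicit Defensive.
Import Order.TTheory GRing.Theory Num.Theory.
Import numFieldNormedType.Exports.
Local Open Scope classical_set_scope.
Local Open Scope ring_scope.

(* The a-differences Y_i form a Gaussian vector with covariance matrix S, and V_{a,n}
   is Q = |Y|^2.  Gaussian integration by parts, extended from trigonometric functions
   to exp (- l Q) and then to C^1 functions f by Bernstein approximation in the variable
   exp (- e Q), gives E[(Q - tr S) f(Q)] = 2 E[(Y^T S Y) f'(Q)].  Since
   Var Q = 2 tr S^2 and Var (Y^T S Y) = 2 tr S^4, Stein's equation bounds the distance of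
   the normalized Q to the normal law by (tr S^4)^(1/2) / tr S^2, hence by rho / (tr S^2)^(1/2)
   where rho is the largest absolute row sum of S.

   S has entries - sum_{j,j'} a_j a_j' V((k + j' - j) delta_n), k being the lag.  The
   weights kill polynomials of degree < 2 M, so that a Taylor expansion of V of order
   2 D + d <= 2 M bounds the entry at lag k by delta_n^(2 D + s) (k + 1)^th, with
   -1 < th < -1/2, while the expansion of V at 0 shows that some fixed lag k0 has
   an entry of exact order delta_n^(2 D + s).  Therefore rho^2 / tr S^2 = O(n^(1 + 2 th)). *)

(** * Integrable real functions *)

(** The covariance matrix S may be singular, so no joint density is used: all Gaussian input is the
    fourth moment and E cos (Z + th) for single linear combinations Z of values of the process
    ([gaussian_facts]). Differentiating the cosine identity along a second variable gives
    integration by parts; polarizing the fourth moment gives Wick's formula. Trigonometric functions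
    reach exp (- l Q) because exp (- l z^2) is a limit of powers of cosines, and they reach
    unbounded factors because z is the limit of (n + 1) sin (z / (n + 1)).

    Stein's method fits because the identity for E[(Q - tr S) f(Q)] leaves only the ratio Y^T S Y /
    tr S^2, of mean 1, to be compared with its mean.

    In the quotient of rho^2 by tr S^2 the powers of delta_n cancel: rho is at most of order
    delta_n^(2 D + s) n^(1 + th), while the n - O(1) entries at lag k0 make tr S^2 at least of order
    n delta_n^(2 (2 D + s)). Hence th < - 1/2 decides, whatever the value of alpha. *)

Section L1.
Context d (T : measurableType d) (R : realType) (mu : {measure set T -> \bar R}).
Implicit Types f g : T -> R.

Definition L1 f := mu.-integrable [set: T] (EFin \o f).

Lemma L1_measurable f : L1 f -> measurable_fun setT f.
Proof. by move=> /integrableP[/measurable_EFinP]. Qed.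

Lemma L1_le g f : L1 g -> measurable_fun setT f -> (forall x, `|f x| <= g x) -> L1 f.
Proof.
move=> ig mf fg; apply: (le_integrable measurableT _ _ ig); first exact/measurable_EFinP.
move=> x _ /=; rewrite lee_fin.
exact: le_trans (fg x) (ler_norm _).
Qed.

Lemma L1D f g : L1 f -> L1 g -> L1 (fun x => f x + g x).
Proof. by move=> fi gi; exact: (integrableD measurableT fi gi). Qed.

Lemma L1B f g : L1 f -> L1 g -> L1 (fun x => f x - g x).
Proof. by move=> fi gi; exact: (integrableB measurableT fi gi). Qed.

Lemma L1Z k f : L1 f -> L1 (fun x => k * f x).
Proof. by move=> fi; exact: (integrableZl measurableT k fi). Qed.

Lemma L1N f : L1 f -> L1 (fun x => - f x).
Proof.
by move=> /(L1Z (-1)); congr L1; apply/funext => x; rewrite mulN1r.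
Qed.

Lemma L1_norm f : L1 f -> L1 (fun x => `|f x|).
Proof. by move=> fi; exact: (integrable_abse fi). Qed.

Lemma L1_0 : L1 (fun=> 0).
Proof. exact: integrable0. Qed.

Lemma L1_sum (I : Type) (s : seq I) (p : pred I) (F : I -> T -> R) :
  (forall i, p i -> L1 (F i)) -> L1 (fun x => \sum_(i <- s | p i) F i x).
Proof.
move=> iF; elim: s => [|i s IH].
  rewrite (_ : (fun _ => _) = fun=> 0); first exact: L1_0.
  by apply/funext => x; rewrite big_nil.
case pi : (p i); last first.
  rewrite (_ : (fun _ => _) = fun x => \sum_(i <- s | p i) F i x)//.
  by apply/funext => x; rewrite big_cons pi.
rewrite (_ : (fun _ => _) = fun x => F i x + \sum_(i <- s | p i) F i x).
  by apply: L1D => //; exact: iF.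
by apply/funext => x; rewrite big_cons pi.
Qed.

Lemma IntD f g : L1 f -> L1 g ->
  \int[mu]_x (f x + g x) = \int[mu]_x f x + \int[mu]_x g x.
Proof. by move=> ? ?; rewrite RintegralD. Qed.

Lemma IntB f g : L1 f -> L1 g ->
  \int[mu]_x (f x - g x) = \int[mu]_x f x - \int[mu]_x g x.
Proof. by move=> ? ?; rewrite RintegralB. Qed.

Lemma IntZ k f : L1 f -> \int[mu]_x (k * f x) = k * \int[mu]_x f x.
Proof. by move=> ?; rewrite RintegralZl. Qed.

Lemma IntN f : L1 f -> \int[mu]_x (- f x) = - \int[mu]_x f x.
Proof.
by move=> fi; rewrite -mulN1r -IntZ//; apply: eq_Rintegral => x _; rewrite mulN1r.
Qed.

Lemma Int_sum (I : Type) (s : seq I) (p : pred I) (F : I -> T -> R) :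
  (forall i, p i -> L1 (F i)) ->
  \int[mu]_x (\sum_(i <- s | p i) F i x) = \sum_(i <- s | p i) \int[mu]_x F i x.
Proof.
move=> iF; elim: s => [|i s IH].
  rewrite big_nil (eq_Rintegral mu (g := cst 0)); last first.
    by move=> x _; rewrite big_nil.
  by rewrite /Rintegral (integral0 mu).
rewrite big_cons; case: ifP => pi.
  rewrite -IH -IntD; [|exact: iF|exact: L1_sum].
  by apply: eq_Rintegral => x _; rewrite big_cons pi.
by rewrite -IH; apply: eq_Rintegral => x _; rewrite big_cons pi.
Qed.

Lemma Int_le f g : L1 f -> L1 g -> (forall x, f x <= g x) ->
  \int[mu]_x f x <= \int[mu]_x g x.
Proof. by move=> ? ? fg; apply: le_Rintegral. Qed.

Lemma Int_norm f : L1 f -> `|\int[mu]_x f x| <= \int[mu]_x `|f x|.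
Proof. by move=> ?; apply: le_normr_Rintegral. Qed.

Lemma L1_dct g (f_ : nat -> T -> R) f : L1 g ->
  (forall n, measurable_fun setT (f_ n)) -> (forall n x, `|f_ n x| <= g x) ->
  (forall x, f_ n x @[n --> \oo] --> f x) ->
  L1 f /\ \int[mu]_x f_ n x @[n --> \oo] --> \int[mu]_x f x.
Proof.
move=> ig mf_ fg ff.
have mf : measurable_fun setT f by apply: (measurable_fun_cvg mf_).
have [||||| ? _ cvg] := @dominated_convergence _ _ _ mu _ measurableT
  (fun n => EFin \o f_ n) (EFin \o f) (EFin \o g).
- by move=> n; apply/measurable_EFinP.
- exact/measurable_EFinP.
- by apply: aeW => x _ /=; apply/cvg_EFin; [exact: nearW|exact: ff].
- exact: ig.
- by apply: aeW => x n _ /=; rewrite lee_fin.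
split=> //; rewrite /Rintegral.
apply: fine_cvg => //=; rewrite fineK//; exact: integrable_fin_num.
Qed.

End L1.

Lemma is_derive_half_line (R : realType) (f : R -> R) (z : R) : continuous f ->
  L1 (@lebesgue_measure R) f ->
  is_derive z 1 (fun x => \int[lebesgue_measure]_(t in `]-oo, x]) f t) (f z).
Proof.
move=> cf fi; have zz1 : z < z + 1 by rewrite ltrDl.
have fiz : lebesgue_measure.-integrable [set` `]-oo, (z + 1)]] (EFin \o f).
  exact: integrableS fi.
have [dHz <-] := continuous_FTC1 zz1 fiz (ltNyr _) (@cf z).
by rewrite derive1E; exact: derivableP.
Qed.

Section half_line_FTC.
Context (R : realType).
Notation mu := (@lebesgue_measure R).
Variables (f F : R -> R) (a b : R).
Hypotheses (cf : continuous f) (fi : L1 mu f).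
Hypothesis dF : forall x : R, is_derive x 1 F (f x).
Hypothesis Fa : F (- n%:R) @[n --> \oo] --> a.

Let H x := \int[mu]_(t in `]-oo, x]) f t.

Let H_indic x : H x = \int[mu]_t (f t * \1_`]-oo, x] t).
Proof.
rewrite /H Rintegral_mkcond; apply: eq_Rintegral => t _.
by rewrite patchE indicE; case: ifP => _; rewrite ?mulr1 ?mulr0.
Qed.

Let H_cvg (u : nat -> R) (g : R -> R) :
  (forall x, f x * \1_`]-oo, u n] x @[n --> \oo] --> g x) ->
  H (u n) @[n --> \oo] --> \int[mu]_t g t.
Proof.
move=> ug; under eq_fun do rewrite H_indic.
apply: (proj2 (@L1_dct _ _ _ mu (fun x => `|f x|)
  (fun n x => f x * \1_`]-oo, u n] x) g (L1_norm fi) _ _ _)).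
- move=> n; apply: measurable_funM; first exact: L1_measurable fi.
  by apply: measurable_indic.
- by move=> n x; rewrite normrM ler_piMr// indicE; case: (_ \in _); rewrite ?normr1 ?normr0.
- exact: ug.
Qed.

(** [H] and [F] have the same derivative, so they differ by a constant, which dominated convergence
    of [H] along - n identifies as - a. *)
Lemma half_line_FTC x : \int[mu]_(t in `]-oo, x]) f t = F x - a.
Proof.
have dH (z : R) : is_derive z 1 H (f z) by exact: is_derive_half_line.
have HF z : H z - F z = H 0 - F 0.
  apply: (is_derive_0_is_cst (f := H - F)) => {}z.
  by apply: is_derive_eq; rewrite subrr.
have H0 : H (- n%:R) @[n --> \oo] --> 0.
  rewrite (_ : 0 = \int[mu]_t (cst 0 t)); last by rewrite /Rintegral (integral0 mu).
  apply: H_cvg => y; apply: cvg_near_cst.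
  near=> n; rewrite indicE memNset ?mulr0//= in_itv/= => yn.
  have : - y < n%:R by near: n; exact: nbhs_infty_gtr.
  by rewrite ltrNl ltNge yn.
have lim1 : H (- n%:R) - F (- n%:R) @[n --> \oo] --> 0 - a by exact: cvgB.
have lim2 : H (- n%:R) - F (- n%:R) @[n --> \oo] --> H 0 - F 0.
  by under eq_fun do rewrite HF; exact: cvg_cst.
have e : 0 - a = H 0 - F 0 by exact: (cvg_unique _ lim1 lim2).
rewrite -/(H x); have := HF x; lra.
Unshelve. all: by end_near. Qed.

Lemma whole_line_FTC : F n%:R @[n --> \oo] --> b -> \int[mu]_t f t = b - a.
Proof.
move=> Fb; have : H n%:R @[n --> \oo] --> \int[mu]_t f t.
  apply: H_cvg => y; apply: cvg_near_cst.
  near=> n; rewrite indicE mem_set ?mulr1//= in_itv/=.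
  by near: n; exact: nbhs_infty_ger.
under eq_fun do rewrite /H half_line_FTC.
move=> lim1; have lim2 : F n%:R - a @[n --> \oo] --> b - a.
  by apply: cvgB => //; exact: cvg_cst.
exact: (cvg_unique _ lim1 lim2).
Unshelve. all: by end_near. Qed.

End half_line_FTC.

(** * The normal density *)

Lemma is_derive_continuous (R : realType) (f f' : R -> R) :
  (forall x : R, is_derive x 1 f (f' x)) -> continuous f.
Proof.
by move=> df x; apply/differentiable_continuous/derivable1_diffP; case: (df x).
Qed.

Section normal_density.
Context (R : realType).
Notation mu := (@lebesgue_measure R).
Implicit Types m s x : R.

Global Instance is_derive_normal_pdf m s x : s != 0 ->
  is_derive x 1 (normal_pdf m s) (- ((x - m) / s ^+ 2 * normal_pdf m s x)).
Proof.
move=> s0; rewrite normal_pdfE//.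
have -> : (fun x : R => normal_peak s * normal_fun m s x) =
    normal_peak s \*: (expR \o (fun x => - (s ^+ 2 *+ 2)^-1 * (x - m) ^+ 2)).
  by apply/funext => z; rewrite /normal_fun/= -[RHS]/(_ * _); congr (_ * expR _); ring.
apply: is_derive_eq; rewrite /normal_fun -![_ *: _]/(_ * _)/=.
have -> : - (x - m) ^+ 2 / (s ^+ 2 *+ 2) = - (s ^+ 2 *+ 2)^-1 * (x - m) ^+ 2 by ring.
field; by rewrite s0.
Qed.

(** With u = (x - m)^2 / (8 s^2) the density is proportional to exp (- 4 u) and the one of deviation
    2 s to exp (- u); the spare factor exp (- 3 u) absorbs the polynomial. The wider density then
    serves as integrable majorant. *)
Lemma normal_pdf_growth m s : s != 0 -> exists2 C, 0 <= C & forall x,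
  (1 + (x - m) ^+ 2) ^+ 2 * normal_pdf m s x <= C * normal_pdf m (2 * s) x.
Proof.
move=> s0; have s20 : 2 * s != 0 by rewrite mulf_neq0.
(* (1 + 8 s^2 u)^2 <= 2 + 128 s^4 u^2 <= K (1 + u^2 / 2), and 1 + u^2 / 2 <= exp u. *)
pose K := 2 + 256 * s ^+ 4.
have pk := normal_peak_gt0 s20.
have K0 : 0 <= K by rewrite /K; have := exprn_even_ge0 s (n := 4) isT; lra.
exists (K * normal_peak s / normal_peak (2 * s)).
  by rewrite divr_ge0 ?mulr_ge0 ?normal_peak_ge0.
move=> x; rewrite !normal_pdfE//.
rewrite [leRHS](_ : _ = normal_peak s * (K * normal_fun m (2 * s) x)); last first.
  by field; rewrite gt_eqF.
rewrite mulrCA; apply: ler_wpM2l; first exact: normal_peak_ge0.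
pose u := (x - m) ^+ 2 / (8 * s ^+ 2).
have u0 : 0 <= u by rewrite mulr_ge0 ?sqr_ge0// invr_ge0 mulr_ge0 ?sqr_ge0.
have -> : normal_fun m (2 * s) x = expR (- u).
  by congr expR; rewrite /u; field; rewrite s0.
have -> : normal_fun m s x = expR (- u) * expR (- (3 * u)).
  by rewrite -expRD; congr expR; rewrite /u; field; rewrite s0.
rewrite mulrCA mulrC; apply: ler_wpM2r; first exact: expR_ge0.
rewrite expRN -ler_pdivlMr ?invr_gt0 ?expR_gt0// invrK.
have -> : (x - m) ^+ 2 = 8 * s ^+ 2 * u by rewrite /u; field; rewrite s0.
apply: (@le_trans _ _ (K * (1 + u ^+ 2 / 2))).
  have : 0 <= s ^+ 4 by exact: exprn_even_ge0.
  have := sqr_ge0 u; have := sqr_ge0 (1 - 8 * s ^+ 2 * u).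
  rewrite /K; nra.
apply: ler_wpM2l => //; apply: (@le_trans _ _ (expR u)).
  by have := expR_ge1Dxn 1 u0.
by rewrite ler_expR; lra.
Qed.

Lemma normal_pdf_cvg0 m s : s != 0 ->
  normal_pdf m s n%:R @[n --> \oo] --> 0 /\ normal_pdf m s (- n%:R) @[n --> \oo] --> 0.
Proof.
move=> s0.
have [C C0 CP] : exists2 C, 0 <= C & forall x, normal_pdf m s x <= C / (1 + (x - m) ^+ 2).
  have [C C0 CP] := normal_pdf_growth m s0.
  exists (C * normal_peak (2 * s)); first by rewrite mulr_ge0// normal_peak_ge0.
  move=> x; have p0 : 0 < 1 + (x - m) ^+ 2 by have := sqr_ge0 (x - m); lra.
  rewrite ler_pdivlMr// mulrC.
  apply: (@le_trans _ _ ((1 + (x - m) ^+ 2) ^+ 2 * normal_pdf m s x)).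
    apply: ler_wpM2r; first exact: normal_pdf_ge0.
    rewrite expr2; apply: ler_peMl; first exact: ltW.
    by have := sqr_ge0 (x - m); lra.
  apply: le_trans (CP x) _; apply: ler_wpM2l => //.
  by apply: normal_pdf_ub; rewrite mulf_neq0.
have lim (u : nat -> R) : (forall n, u n ^+ 2 = n%:R ^+ 2) ->
    normal_pdf m s (u n) @[n --> \oo] --> 0.
  move=> un.
  apply: (@squeeze_cvgr _ _ _ _ (fun=> 0) (fun n => C * (2 + 2 * m ^+ 2) * n.+1%:R^-1)).
  - near=> n; rewrite normal_pdf_ge0/=; apply: le_trans (CP _) _.
    rewrite -mulrA; apply: ler_wpM2l => //.
    have p0 : 0 < 1 + (u n - m) ^+ 2 by have := sqr_ge0 (u n - m); lra.
    rewrite -[leLHS]div1r ler_pdivrMr// -[leRHS]mulrA [_^-1 * _]mulrC mulrA ler_pdivlMr//.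
    rewrite mul1r (@le_trans _ _ (1 + n%:R ^+ 2))//.
      rewrite -natr1 addrC lerD2l; case: (n) => [|k]; first by rewrite expr0n.
      by rewrite expr2 ler_peMl// ler1n.
    rewrite -un; have := sqr_ge0 (u n - 2 * m); have := sqr_ge0 (m * (u n - m)).
    have := sqr_ge0 m; have := sqr_ge0 (u n - m); nra.
  - exact: cvg_cst.
  - rewrite -(mulr0 (C * (2 + 2 * m ^+ 2))); apply: cvgMr; exact: cvg_harmonic.
by split; apply: lim => n; rewrite ?sqrrN.
Unshelve. all: by end_near. Qed.

(** The growth that [normal_pdf_growth] absorbs, and enough for fourth moments. *)
Definition quartic_growth m (h : R -> R) :=
  exists C, forall x, `|h x| <= C * (1 + (x - m) ^+ 2) ^+ 2.

Lemma quartic_growth_L1 m s h : s != 0 -> measurable_fun setT h ->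
  quartic_growth m h -> L1 mu (fun x => h x * normal_pdf m s x).
Proof.
move=> s0 mh [C CP]; have [K K0 KP] := normal_pdf_growth m s0.
have C0 : 0 <= C.
  by have := le_trans (normr_ge0 _) (CP m); rewrite subrr expr0n addr0 expr1n mulr1.
apply: (@L1_le _ _ _ mu (fun x => C * K * normal_pdf m (2 * s) x)).
- by apply: L1Z; exact: integrable_normal_pdf.
- by apply: measurable_funM => //; exact: measurable_normal_pdf.
- move=> x; rewrite normrM (ger0_norm (normal_pdf_ge0 _ _ _)).
  apply: (@le_trans _ _ (C * (1 + (x - m) ^+ 2) ^+ 2 * normal_pdf m s x)).
    by apply: ler_wpM2r => //; exact: normal_pdf_ge0.
  by rewrite -2!mulrA; apply: ler_wpM2l => //; exact: KP.
Qed.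

Lemma quartic_growth_cvg0 m s h : s != 0 -> quartic_growth m h ->
  h n%:R * normal_pdf m s n%:R @[n --> \oo] --> 0 /\
  h (- n%:R) * normal_pdf m s (- n%:R) @[n --> \oo] --> 0.
Proof.
move=> s0 [C CP]; have [K K0 KP] := normal_pdf_growth m s0.
have C0 : 0 <= C.
  by have := le_trans (normr_ge0 _) (CP m); rewrite subrr expr0n addr0 expr1n mulr1.
have s20 : 2 * s != 0 by rewrite mulf_neq0.
have [l1 l2] := normal_pdf_cvg0 m s20.
have lim (u : nat -> R) : normal_pdf m (2 * s) (u n) @[n --> \oo] --> 0 ->
    h (u n) * normal_pdf m s (u n) @[n --> \oo] --> 0.
  move=> ul; apply/norm_cvg0P.
  apply: (@squeeze_cvgr _ _ _ _ (fun=> 0) (fun n => C * K * normal_pdf m (2 * s) (u n))).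
  - near=> n; rewrite normr_ge0/= normrM (ger0_norm (normal_pdf_ge0 _ _ _)).
    apply: (@le_trans _ _ (C * (1 + (u n - m) ^+ 2) ^+ 2 * normal_pdf m s (u n))).
      by apply: ler_wpM2r => //; exact: normal_pdf_ge0.
    by rewrite -2!mulrA; apply: ler_wpM2l => //; exact: KP.
  - exact: cvg_cst.
  - by rewrite -(mulr0 (C * K)); apply: cvgMr.
by split; apply: lim.
Unshelve. all: by end_near. Qed.

(** The derivative of h times the density is integrated over the line; the growth condition on h
    makes the boundary terms vanish. *)
Lemma normal_ibp m s (h h' : R -> R) : s != 0 ->
  (forall x : R, is_derive x 1 h (h' x)) -> continuous h' ->
  quartic_growth m h -> quartic_growth m h' -> quartic_growth m (fun x => (x - m) * h x) ->
  \int[mu]_x ((x - m) * h x * normal_pdf m s x) =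
  s ^+ 2 * \int[mu]_x (h' x * normal_pdf m s x).
Proof.
move=> s0 dh ch' gh gh' gxh.
have ch := is_derive_continuous dh.
have cx : continuous (fun x : R => x - m).
  by move=> x; apply: cvgB; [exact: cvg_id|exact: cvg_cst].
have cxh : continuous (fun x : R => (x - m) * h x).
  by move=> x; apply: cvgM; [exact: cx|exact: ch].
have cpdf := @continuous_normal_pdf R m s s0.
have i1 : L1 mu (fun x => h' x * normal_pdf m s x).
  by apply: quartic_growth_L1 => //; exact: continuous_measurable_fun.
have i2 : L1 mu (fun x => (x - m) * h x * normal_pdf m s x).
  by apply: quartic_growth_L1 => //; exact: continuous_measurable_fun.
have [l1 l2] := quartic_growth_cvg0 s0 gh.
have := @whole_line_FTC R
  (fun x => h' x * normal_pdf m s x - (s ^+ 2)^-1 * ((x - m) * h x * normal_pdf m s x))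
  (fun x => h x * normal_pdf m s x) 0 0 _ _ _ l2 l1.
rewrite IntB//; last exact: L1Z.
rewrite IntZ// subrr => H.
have {H} : \int[mu]_x (h' x * normal_pdf m s x) -
    s ^-2 * \int[mu]_x ((x - m) * h x * normal_pdf m s x) = 0.
  apply: H.
  - move=> x; apply: cvgB.
      by apply: cvgM; [exact: ch'|exact: cpdf].
    apply: cvgMr; apply: cvgM; [exact: cxh|exact: cpdf].
  - by apply: L1B => //; exact: L1Z.
  - move=> x; have := @is_derive_normal_pdf m s x s0 => dp.
    apply: is_derive_eq.
    rewrite -![_ *: _]/(_ * _); ring.
move/eqP; rewrite subr_eq0 => /eqP ->; rewrite mulrA mulfV ?mul1r//.
by rewrite expf_neq0.
Qed.

End normal_density.

(** * Integration against a normal law *)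

Section integral_normal_prob.
Context (R : realType) (m s : R).
Notation mu := (@lebesgue_measure R).
Local Notation nu := (normal_prob m s).

Lemma integral_normal_prob (f : measurableTypeR R -> \bar R) :
  nu.-integrable setT f ->
  (\int[nu]_x f x = \int[mu]_x (f x * (normal_pdf m s x)%:E))%E.
Proof.
move=> fi; have mf := measurable_int _ fi.
rewrite -(Radon_Nikodym_change_of_variables (normal_prob_dominates m s))//=.
apply: ae_eq_integral => //.
- apply: emeasurable_funM => //; apply: (measurable_int mu).
  by apply: Radon_Nikodym_integrable; exact: normal_prob_dominates.
- apply: emeasurable_funM => //=; apply/measurable_EFinP.
  exact: measurable_normal_pdf.
- apply: ae_eqe_mul2l => /=.
  rewrite Radon_NikodymE//=; first exact: normal_prob_dominates.
  move=> abmu.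
  case: cid => /= h [h1 h2 h3].
  apply: integral_ae_eq => //=.
  + by apply/measurable_EFinP; exact: measurable_normal_pdf.
  + by move=> E E01 mE; rewrite -h3.
Qed.

Import HBNNSimple.

(** Monotone approximation by simple functions removes the integrability hypothesis; this version is
    what proves integrability for [nu] in the first place. *)
Lemma ge0_integral_normal_prob (f : measurableTypeR R -> \bar R) :
  measurable_fun setT f -> (forall x, 0 <= f x)%E ->
  (\int[nu]_x f x = \int[mu]_x (f x * (normal_pdf m s x)%:E))%E.
Proof.
move=> mf f0.
pose f_ := nnsfun_approx measurableT mf.
have fi n : nu.-integrable setT (EFin \o f_ n).
  apply: measurable_bounded_integrable => //.
    by rewrite (le_lt_trans (probability_le1 _ _))// ltry.
  exact: simple_bounded.
have mp : measurable_fun setT (normal_pdf m s) := measurable_normal_pdf m s.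
transitivity (lim (\int[nu]_x (f_ n x)%:E @[n --> \oo])%E).
  rewrite -monotone_convergence//=.
  - apply: eq_integral => ? /[!inE] xD; apply/esym/cvg_lim => //=.
    exact: cvg_nnsfun_approx.
  - by move=> n; exact/measurable_EFinP/measurable_funTS.
  - by move=> n ? _; rewrite lee_fin.
  - by move=> ? _ ? ? mn; rewrite lee_fin; exact/lefP/nd_nnsfun_approx.
under eq_fun do rewrite (integral_normal_prob (fi _)).
rewrite -monotone_convergence//=.
- apply: eq_integral => x _; apply/cvg_lim => //=.
  apply: cvgeZr => //; exact: cvg_nnsfun_approx.
- move=> n; apply: emeasurable_funM; first exact/measurable_EFinP/measurable_funTS.
  exact/measurable_EFinP.
- by move=> n x _; rewrite -EFinM lee_fin mulr_ge0 ?normal_pdf_ge0.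
- move=> x _ a b ab; rewrite -!EFinM lee_fin ler_wpM2r ?normal_pdf_ge0//.
  exact/lefP/nd_nnsfun_approx.
Qed.

Lemma L1_normal_prob (f : measurableTypeR R -> R) : measurable_fun setT f ->
  L1 mu (fun x => f x * normal_pdf m s x) -> L1 nu f.
Proof.
move=> mf /integrableP[_ fi]; apply/integrableP; split; first exact/measurable_EFinP.
rewrite ge0_integral_normal_prob//.
- apply: le_lt_trans fi; rewrite le_eqVlt; apply/orP; left; apply/eqP.
  apply: eq_integral => x _ /=.
  by rewrite normrM (ger0_norm (normal_pdf_ge0 _ _ _)) EFinM.
- by apply: measurableT_comp => //; exact/measurable_EFinP.
Qed.

End integral_normal_prob.

Section law.
Context d (T : measurableType d) (R : realType) (P : probability T R).
Variables (nu : probability (measurableTypeR R) R) (Y : T -> measurableTypeR R).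
Hypotheses (mY : measurable_fun setT Y).
Hypothesis (lawY : forall A : set (measurableTypeR R), measurable A -> P (Y @^-1` A) = nu A).

Lemma L1_law (f : measurableTypeR R -> R) : measurable_fun setT f -> L1 nu f ->
  L1 P (f \o Y) /\ \int[P]_w f (Y w) = \int[nu]_x f x.
Proof.
move=> mf fi.
pose Y' : {RV P >-> measurableTypeR R} := mfun_Sub (mem_set mY).
have mYf : measurable_fun setT (f \o Y) by exact: measurableT_comp.
have i1 : L1 P (f \o Y).
  apply/integrableP; split; first exact/measurable_EFinP.
  move/integrableP : fi => [_]; apply: le_lt_trans.
  rewrite (_ : (\int[P]_x _ = \int[P]_x ((fun y => `|(f y)%:E|%E) \o Y') x)%E)//.
  rewrite -(@ge0_integral_distribution _ _ _ _ _ P Y' (fun y => `|(f y)%:E|%E))//.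
    rewrite le_eqVlt; apply/orP; left; apply/eqP.
    by apply: eq_measure_integral => A mA _; exact: lawY.
  by apply: measurableT_comp => //; exact/measurable_EFinP.
split=> //; rewrite /Rintegral; congr fine.
rewrite -[LHS](@integral_distribution _ _ _ _ _ P Y' (EFin \o f))//; last exact/measurable_EFinP.
by apply: eq_measure_integral => A mA _; exact: lawY.
Qed.

End law.

(** * Mean value and Taylor estimates *)

Section mean_value.
Context (R : realType).
Implicit Types f : R -> R.

Lemma MVT_le f f' (x y B : R) :
  (forall z : R, Num.min x y <= z <= Num.max x y ->
     is_derive z 1 f (f' z) /\ `|f' z| <= B) ->
  `|f y - f x| <= B * `|y - x|.
Proof.
wlog xy : x y / x <= y => [H|].
  case/orP: (le_total x y) => xy fB; first exact: (H x y).
  rewrite distrC [`|y - x|]distrC; apply: (H y x) => //.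
  by rewrite minC maxC; exact: fB.
rewrite min_l// max_r// => fB.
have [||c] := @MVT_segment _ f f' x y xy.
- move=> z /[!in_itv]/= /andP[/ltW xz /ltW zy].
  by have /fB[] : x <= z <= y by rewrite xz.
- apply: derivable_within_continuous => z /[!in_itv]/= zxy.
  by have [[]] := fB z zxy.
rewrite in_itv/= => cxy ->; rewrite normrM; apply: ler_wpM2r => //.
by have [] := fB c cxy.
Qed.

(** Integrals depending on a parameter are differentiated through this criterion: a pointwise
    quadratic Taylor bound is integrated, and a second moment becomes the constant K. *)
Lemma is_derive_quadratic f (u L K : R) :
  (forall h, `|f (u + h) - f u - h * L| <= K * h ^+ 2) -> is_derive u 1 f L.
Proof.
move=> fK.
have cv : h^-1 *: ((f \o shift u) (h *: (1 : R)) - f u) @[h --> (0:R)^'] --> L.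
  apply/cvgrPdist_le => e e0; near=> h.
  have h0 : h != 0 by near: h; exact: nbhs_dnbhs_neq.
  have -> : h^-1 *: ((f \o shift u) (h *: (1 : R)) - f u) = (f (u + h) - f u) / h.
    by rewrite /= -![_ *: _]/(_ * _) mulr1 [h + u]addrC mulrC.
  have -> : L - (f (u + h) - f u) / h = - ((f (u + h) - f u - h * L) / h) by field.
  rewrite normrN normrM normfV ler_pdivrMr ?normr_gt0//.
  apply: le_trans (fK h) _; rewrite -real_normK ?num_real// expr2 mulrA.
  apply: ler_wpM2r => //.
  have : `|h| <= e / (1 + `|K|).
    near: h; apply: dnbhs0_le; rewrite divr_gt0// ltr_pwDl//.
  rewrite ler_pdivlMr ?ltr_pwDl// => he.
  have := ler_norm K; have := normr_ge0 h; nra.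
apply: DeriveDef; last exact: (cvg_lim _ cv).
by apply/cvg_ex; exists L.
Unshelve. all: by end_near. Qed.

Lemma sin_lipschitz (a b : R) : `|sin (a + b) - sin a| <= `|b|.
Proof.
rewrite -[leRHS]mul1r {2}(_ : b = a + b - a); last ring.
apply: (@MVT_le sin cos) => z _; split; first exact: is_derive_sin.
exact: cos_max.
Qed.

Lemma between_le (a z : R) : Num.min 0 a <= z <= Num.max 0 a -> `|z| <= `|a|.
Proof.
case: (leP 0 a) => a0 /andP[z1 z2].
  by rewrite !ger0_norm.
by rewrite !ler0_norm ?lerN2// ltW.
Qed.

Lemma cos_taylor1 (a b : R) : `|cos (a + b) - cos a + b * sin a| <= b ^+ 2.
Proof.
have := @MVT_le (fun t => cos (a + t) - cos a + t * sin a)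
   (fun t => - sin (a + t) + sin a) 0 b `|b|.
rewrite subr0 addr0 mul0r addr0 subrr subr0 -expr2 real_normK ?num_real//; apply.
move=> z /between_le zb; split.
  by apply: is_derive_eq; rewrite -![_ *: _]/(_ * _); ring.
by rewrite addrC distrC; apply: le_trans zb; exact: sin_lipschitz.
Qed.

End mean_value.

(** * Moments and cosine transform of the normal law *)

Section normal_moments.
Context (R : realType).
Notation mu := (@lebesgue_measure R).

Lemma quartic_growth_exp (m : R) k : (k <= 4)%N -> quartic_growth m (fun x => (x - m) ^+ k).
Proof.
move=> k4; exists 1 => x; rewrite mul1r normrX.
have xm : `|x - m| <= 1 + (x - m) ^+ 2.
  by have := sqr_ge0 (`|x - m| - 1); rewrite sqrrB1 real_normK ?num_real//; have := sqr_ge0 (x - m); lra.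
have p1 : 1 <= 1 + (x - m) ^+ 2 by rewrite lerDl sqr_ge0.
case: k k4 => [|[|[|[|[|//]]]]] _.
- by rewrite expr0 exprn_ege1.
- rewrite expr1; apply: le_trans xm _; rewrite expr2; apply: ler_peMl => //; lra.
- by rewrite ler_sqr// nnegrE; lra.
- apply: (@le_trans _ _ ((1 + (x - m) ^+ 2) * (x - m) ^+ 2)).
    by rewrite exprS real_normK ?num_real//; apply: ler_wpM2r => //; exact: sqr_ge0.
  by have := sqr_ge0 (x - m); nra.
- rewrite (exprM _ 2 2) real_normK ?num_real//.
  have := sqr_ge0 (x - m); rewrite ler_sqr ?nnegrE; lra.
Qed.

Lemma quartic_growth_le (m K : R) (h g : R -> R) : quartic_growth m g ->
  (forall x, `|h x| <= K * `|g x|) -> quartic_growth m h.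
Proof.
move=> [C gC] hg; exists (`|K| * C) => x; apply: le_trans (hg x) _.
rewrite -mulrA; apply: le_trans (_ : `|K| * `|g x| <= _).
  by apply: ler_wpM2r => //; exact: ler_norm.
exact: ler_wpM2l.
Qed.

Lemma normal_mean (m s : R) : s != 0 -> \int[mu]_x (x * normal_pdf m s x) = m.
Proof.
move=> s0; have i0 : L1 mu (normal_pdf m s) := integrable_normal_pdf m s.
have i1 : L1 mu (fun x => (x - m) * normal_pdf m s x).
  apply: (@quartic_growth_L1 R m s (fun x => x - m)) => //.
    exact: measurable_funB.
  exact: (@quartic_growth_exp m 1).
have := @normal_ibp R m s (fun=> 1) (fun=> 0) s0.
under eq_Rintegral do rewrite mulr1.
under [X in _ * X]eq_Rintegral do rewrite mul0r.
rewrite /(Rintegral _ _ (fun=> 0)) (integral0 mu) mulr0 => H.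
transitivity (\int[mu]_x ((x - m) * normal_pdf m s x + m * normal_pdf m s x)).
  by apply: eq_Rintegral => x _; ring.
rewrite IntD//; last exact: L1Z.
rewrite H.
- by rewrite add0r IntZ// /Rintegral integral_normal_pdf mulr1.
- by move=> x; exact: cvg_cst.
- exact: (@quartic_growth_exp m 0).
- by apply: (@quartic_growth_le m 1 _ _ (@quartic_growth_exp m 0 isT)) => x; rewrite normr0 expr0 normr1 mulr1.
- by apply: (@quartic_growth_le m 1 _ _ (@quartic_growth_exp m 1 isT)) => x; rewrite mulr1 mul1r.
Qed.

End normal_moments.

Section centered_normal.
Context (R : realType) (s : R).
Hypothesis s0 : s != 0.
Notation mu := (@lebesgue_measure R).
Let pdf := normal_pdf 0 s.

Let L1pdf (h : R -> R) k : (k <= 4)%N -> measurable_fun setT h ->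
  (forall x, `|h x| <= `|x ^+ k|) -> L1 mu (fun x => h x * pdf x).
Proof.
move=> k4 mh hk; apply: quartic_growth_L1 => //.
apply: (@quartic_growth_le _ _ 1 _ _ (quartic_growth_exp 0 k4)) => x.
by rewrite mul1r subr0.
Qed.

Let growthX (h : R -> R) k : (k <= 4)%N ->
  (forall x, `|h x| <= 3 * `|x ^+ k|) -> quartic_growth 0 h.
Proof.
move=> k4 hk; apply: (@quartic_growth_le _ _ 3 _ _ (quartic_growth_exp 0 k4)) => x.
by rewrite subr0.
Qed.

Let mX k : measurable_fun setT (fun x : R => x ^+ k).
Proof. exact: exprn_measurable. Qed.

Let int_pdf : \int[mu]_x pdf x = 1.
Proof. by rewrite /Rintegral integral_normal_pdf. Qed.

Lemma normal_moment2 : \int[mu]_x (x ^+ 2 * pdf x) = s ^+ 2.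
Proof.
have := @normal_ibp R 0 s id (fun=> 1) s0.
under [X in _ = _ * X]eq_Rintegral do rewrite mul1r.
under eq_Rintegral do rewrite subr0 -expr2.
rewrite int_pdf mulr1; apply.
- by move=> x; exact: cvg_cst.
- by apply: (@growthX _ 1) => // x; rewrite expr1; have := normr_ge0 x; lra.
- by apply: (@growthX _ 0) => // x; rewrite expr0 normr1; lra.
- by apply: (@growthX _ 2) => // x; rewrite subr0 -expr2; have := normr_ge0 (x ^+ 2); lra.
Qed.

Lemma normal_moment4 : \int[mu]_x (x ^+ 4 * pdf x) = 3 * (s ^+ 2) ^+ 2.
Proof.
have := @normal_ibp R 0 s (fun x => x ^+ 3) (fun x => 3 * x ^+ 2) s0.
under [X in _ = _ * X]eq_Rintegral do rewrite -mulrA.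
under eq_Rintegral do rewrite subr0 -exprS.
rewrite IntZ; last by apply: (@L1pdf _ 2).
rewrite normal_moment2 => H; etransitivity; first apply: H.
- by move=> x; apply: is_derive_eq; rewrite -![_ *: _]/(_ * _); ring.
- by move=> x; apply: cvgMr; exact: exprn_continuous.
- by apply: (@growthX _ 3) => // x; have := normr_ge0 (x ^+ 3); lra.
- by apply: (@growthX _ 2) => // x; rewrite normrM ger0_norm.
- by apply: (@growthX _ 4) => // x; rewrite subr0 -exprS; have := normr_ge0 (x ^+ 4); lra.
- by ring.
Qed.

(** psi u = E cos (u x + th) satisfies psi' = - u s^2 psi, by differentiation under the integral and
    integration by parts; so psi u exp (s^2 u^2 / 2) is constant, and u = 1 is compared with u =
    0. *)
Lemma normal_cos (th : R) :
  \int[mu]_x (cos (x + th) * pdf x) = cos th * expR (- (s ^+ 2 / 2)).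
Proof.
have mcos u : measurable_fun setT (fun x : R => cos (u * x + th)).
  apply: continuous_measurable_fun => x; apply: continuous_comp; last exact: continuous_cos.
  by apply: cvgD; [apply: cvgMr; exact: cvg_id|exact: cvg_cst].
have msin u : measurable_fun setT (fun x : R => sin (u * x + th)).
  apply: continuous_measurable_fun => x; apply: continuous_comp; last exact: continuous_sin.
  by apply: cvgD; [apply: cvgMr; exact: cvg_id|exact: cvg_cst].
have icos u : L1 mu (fun x => cos (u * x + th) * pdf x).
  by apply: (@L1pdf _ 0) => // x; rewrite expr0 normr1 cos_max.
have ixsin u : L1 mu (fun x => x * sin (u * x + th) * pdf x).
  apply: (@L1pdf _ 1) => //; first exact: measurable_funM.
  by move=> x; rewrite expr1 normrM ler_piMr// sin_max.
pose psi u := \int[mu]_x (cos (u * x + th) * pdf x).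
have dpsi (u : R) : is_derive u 1 psi (- (u * s ^+ 2 * psi u)).
  have -> : - (u * s ^+ 2 * psi u) = - (\int[mu]_x (x * sin (u * x + th) * pdf x)).
    have := @normal_ibp R 0 s (fun x => sin (u * x + th)) (fun x => u * cos (u * x + th)) s0.
    under [X in _ = _ * X]eq_Rintegral do rewrite -mulrA.
    rewrite IntZ//.
    under eq_Rintegral do rewrite subr0.
    move=> H; rewrite -[RHS]/(- _); congr (- _).
    rewrite (_ : u * s ^+ 2 * psi u = s ^+ 2 * (u * psi u)); last by ring.
    apply/esym; apply: H.
    - by move=> x; apply: is_derive_eq; rewrite -![_ *: _]/(_ * _); ring.
    - move=> x; apply: cvgMr; apply: continuous_comp; last exact: continuous_cos.
      by apply: cvgD; [apply: cvgMr; exact: cvg_id|exact: cvg_cst].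
    - by apply: (@growthX _ 0) => // x; rewrite expr0 normr1 (le_trans (sin_max _))//; lra.
    - apply: (@quartic_growth_le _ _ `|u| _ _ (@quartic_growth_exp R 0 0 isT)) => x.
      by rewrite expr0 normr1 normrM ler_wpM2l// cos_max.
    - apply: (@growthX _ 1) => // x; rewrite subr0 expr1 normrM.
      by have := sin_max (u * x + th); have := normr_ge0 x; nra.
  apply: (@is_derive_quadratic _ _ _ _ (s ^+ 2)) => h.
  have irem : L1 mu (fun x => (cos (u * x + th + h * x) - cos (u * x + th)
        + h * x * sin (u * x + th)) * pdf x).
    apply: quartic_growth_L1 => //.
      apply: measurable_funD.
        apply: measurable_funB => //.
        under eq_fun do rewrite addrAC -mulrDl.
        exact: mcos.
      by apply: measurable_funM => //; apply: measurable_funM.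
    apply: (@quartic_growth_le _ _ (h ^+ 2) _ _ (@quartic_growth_exp R 0 2 isT)) => x.
    rewrite subr0 (ger0_norm (sqr_ge0 x)) -exprMn.
    exact: cos_taylor1.
  have -> : psi (u + h) - psi u - h * - (\int[mu]_x (x * sin (u * x + th) * pdf x)) =
     \int[mu]_x ((cos (u * x + th + h * x) - cos (u * x + th)
        + h * x * sin (u * x + th)) * pdf x).
    rewrite mulrN opprK /psi -IntZ// -IntB// -IntD//; last exact: L1Z.
    - apply: eq_Rintegral => x _; rewrite [(u + h) * x]mulrDl [u * x + h * x + th]addrAC; ring.
    - exact: L1B.
  apply: le_trans (Int_norm _) _; last first.
  - rewrite mulrC -normal_moment2 -IntZ; last by apply: (@L1pdf _ 2).
    apply: Int_le.
    + exact: L1_norm.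
    + by apply: L1Z; apply: (@L1pdf _ 2).
    + move=> x; rewrite normrM (ger0_norm (normal_pdf_ge0 _ _ _)) mulrA.
      apply: ler_wpM2r; first exact: normal_pdf_ge0.
      by rewrite -exprMn; exact: cos_taylor1.
  - exact: irem.
have hpsi u : psi u * expR (s ^+ 2 / 2 * u ^+ 2) = psi 0 * expR (s ^+ 2 / 2 * 0 ^+ 2).
  apply: (is_derive_0_is_cst (f := fun u => psi u * expR (s ^+ 2 / 2 * u ^+ 2))) => {}u.
  apply: is_derive_eq; rewrite -![_ *: _]/(_ * _)/=. by field.
have p0 : psi 0 = cos th.
  rewrite /psi; under eq_Rintegral do rewrite mul0r add0r.
  rewrite IntZ; last exact: (integrable_normal_pdf 0 s).
  by rewrite int_pdf mulr1.
have := hpsi 1; rewrite p0 expr0n/= mulr0 expR0 mulr1 expr1n mulr1 => <-.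
rewrite -mulrA -expRD subrr expR0 mulr1 /psi.
by apply: eq_Rintegral => x _; rewrite mul1r.
Qed.

End centered_normal.

Section gaussian_facts.
Context d (T : measurableType d) (R : realType) (P : probability T R).

(** The form in which normality is used from here on. It also covers the point mass at 0, and the
    free phase th covers the sine transform as well. *)
Definition gaussian_facts (Z : T -> R) : Prop :=
  [/\ measurable_fun setT Z, L1 P (fun w => Z w ^+ 4),
      \int[P]_w Z w ^+ 4 = 3 * (\int[P]_w Z w ^+ 2) ^+ 2 &
      forall th, \int[P]_w cos (Z w + th) =
        cos th * expR (- (\int[P]_w Z w ^+ 2 / 2))].

Lemma gaussian_rv_facts (Z : T -> R) : measurable_fun setT Z ->
  gaussian_rv P Z -> ('E_P[Z] = 0)%E -> gaussian_facts Z.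
Proof.
move=> mZ gZ EZ.
have mX k : measurable_fun setT (fun x : measurableTypeR R => x ^+ k).
  exact: exprn_measurable.
have mcos th : measurable_fun setT (fun x : measurableTypeR R => cos (x + th)).
  apply: continuous_measurable_fun => x; apply: continuous_comp; last exact: continuous_cos.
  by apply: cvgD; [exact: cvg_id|exact: cvg_cst].
have EZ0 : \int[P]_w Z w = 0 by move: EZ; rewrite unlock /Rintegral => ->.
case: gZ => [[m [s [s0 law]]]|[m law]].
- have iX k (k4 : (k <= 4)%N) m' : L1 lebesgue_measure (fun x => (x - m') ^+ k * normal_pdf m' s x).
    apply: quartic_growth_L1 => //; last exact: quartic_growth_exp.
    by apply: measurable_funX; exact: measurable_funB.
  have int_nu (f : measurableTypeR R -> R) : measurable_fun setT f -> L1 lebesgue_measure (fun x => f x * normal_pdf m s x) ->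
      L1 P (f \o Z) /\ \int[P]_w f (Z w) = \int[lebesgue_measure]_x (f x * normal_pdf m s x).
    move=> mf fi; have fnu := L1_normal_prob mf fi.
    have [? ->] := L1_law mZ law mf fnu; split=> //.
    by rewrite /Rintegral (integral_normal_prob fnu).
  have m0 : m = 0.
    rewrite -EZ0 -{1}(normal_mean m s0); apply/esym; apply: (int_nu id _ _).2 => //.
    rewrite (_ : (fun x => _) = fun x => (x - m) ^+ 1 * normal_pdf m s x + m * ((x - m) ^+ 0 * normal_pdf m s x)).
      by apply: L1D; [exact: iX|apply: L1Z; exact: iX].
    by apply/funext => x; rewrite expr0 expr1 /=; ring.
  subst m.
  have iX' k : (k <= 4)%N -> L1 lebesgue_measure (fun x => x ^+ k * normal_pdf 0 s x).
    move=> k4; have := iX k k4 0; congr L1; apply/funext => x; by rewrite subr0.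
  have [i2 e2] := int_nu _ (mX 2) (iX' 2 isT).
  have [i4 e4] := int_nu _ (mX 4) (iX' 4 isT).
  split => //.
  + by rewrite e2 e4 normal_moment2// normal_moment4.
  + move=> th.
    rewrite e2 normal_moment2// -normal_cos//; apply: (int_nu _ (mcos th) _).2.
    apply: (@L1_le _ _ _ lebesgue_measure (fun x => x ^+ 0 * normal_pdf 0 s x)); first exact: iX'.
      by apply: measurable_funM => //; exact: measurable_normal_pdf.
    move=> x; rewrite normrM (ger0_norm (normal_pdf_ge0 _ _ _)) expr0.
    by apply: ler_wpM2r; [exact: normal_pdf_ge0|exact: cos_max].
- pose dm : probability (measurableTypeR R) R := \d_(m : measurableTypeR R).
  have int_nu (f : measurableTypeR R -> R) : measurable_fun setT f ->
      L1 P (f \o Z) /\ \int[P]_w f (Z w) = f m.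
    move=> mf; have fnu : L1 dm f.
      apply/integrableP; split; first exact/measurable_EFinP.
      rewrite integral_dirac ?diracT ?mul1e ?ltry//.
      by apply: measurableT_comp => //; exact/measurable_EFinP.
    have [? ->] := L1_law mZ (nu := dm) law mf fnu; split=> //.
    rewrite /Rintegral integral_dirac ?diracT ?mul1e//; exact/measurable_EFinP.
  have m0 : m = 0 by rewrite -EZ0 (int_nu id _).2.
  subst m; have [i2 e2] := int_nu _ (mX 2); have [i4 e4] := int_nu _ (mX 4).
  split => //; first by rewrite e2 e4; ring.
  by move=> th; rewrite e2 expr0n/= mul0r oppr0 expR0 mulr1 (int_nu _ (mcos th)).2 add0r.
Qed.

End gaussian_facts.

(** * Trigonometric approximations of exp (- l z^2) and of z *)

Section cos_power_limit.
Context (R : realType).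
Implicit Types t z v l : R.

Lemma sin_taylor2 t : `|t - sin t| <= `|t| ^+ 3.
Proof.
have := @MVT_le R (fun x => x - sin x) (fun x => 1 - cos x) 0 t (t ^+ 2).
rewrite sin0 !subr0 (_ : t ^+ 2 * `|t| = `|t| ^+ 3); last first.
  by rewrite -real_normK ?num_real// -exprSr.
apply.
move=> z /between_le zt; split.
  exact: is_derive_eq.
have := cos_taylor1 0 z; rewrite sin0 mulr0 add0r addr0 cos0 distrC => /le_trans; apply.
by rewrite -real_normK ?num_real// -[leRHS]real_normK ?num_real// ler_sqr// nnegrE.
Qed.

Lemma cos_taylor3 t : `|cos t - 1 + t ^+ 2 / 2| <= t ^+ 4.
Proof.
have := @MVT_le R (fun x => cos x - 1 + x ^+ 2 / 2) (fun x => x - sin x) 0 t (`|t| ^+ 3).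
rewrite cos0 expr0n/= mul0r addr0 subrr !subr0 -exprSr.
rewrite (_ : `|t| ^+ 4 = t ^+ 4); last by rewrite -normrX ger0_norm// exprn_even_ge0.
apply.
move=> z /between_le zt; split.
  by apply: is_derive_eq; rewrite -![_ *: _]/(_ * _)/=; field.
apply: le_trans (sin_taylor2 z) _.
by rewrite lerXn2r// nnegrE.
Qed.

Lemma expRN_taylor1 v : 0 <= v -> `|expR (- v) - 1 + v| <= v ^+ 2.
Proof.
move=> v0; rewrite ger0_norm; last by have := expR_ge1Dx (- v); lra.
have e1 : expR (- v) * (1 + v) <= 1.
  rewrite -[leRHS](expRxMexpNx_1 v) mulrC; apply: ler_wpM2r; first exact: expR_ge0.
  exact: expR_ge1Dx.
have : 0 <= v ^+ 3 by exact: exprn_ge0.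
by have := expR_gt0 (- v); nra.
Qed.

Lemma normr_subX (a b : R) n : `|a| <= 1 -> `|b| <= 1 ->
  `|a ^+ n - b ^+ n| <= n%:R * `|a - b|.
Proof.
move=> a1 b1; elim: n => [|n IH]; first by rewrite !expr0 subrr normr0 mul0r.
have -> : a ^+ n.+1 - b ^+ n.+1 = a * (a ^+ n - b ^+ n) + (a - b) * b ^+ n.
  by rewrite !exprS; ring.
apply: le_trans (ler_normD _ _) _; rewrite !normrM -natr1 mulrDl mul1r.
apply: lerD; last by rewrite ler_piMr// normrX exprn_ile1.
by apply: le_trans IH; rewrite ler_piMl.
Qed.

(** The scale t at which cos (t z)^n, the characteristic function of a sum of n random signs, tends
    to exp (- l z^2). *)
Definition clt_scale l n : R := Num.sqrt (2 * l / n.+1%:R).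

Lemma sqr_clt_scale l n : 0 <= l -> clt_scale l n ^+ 2 = 2 * l / n.+1%:R.
Proof. by move=> l0; rewrite sqr_sqrtr// divr_ge0// mulr_ge0. Qed.

Let cos_exp l z n : 0 <= l ->
  `|cos (clt_scale l n * z) - expR (- (l * z ^+ 2 / n.+1%:R))| <=
  5 * (l * z ^+ 2) ^+ 2 / n.+1%:R ^+ 2.
Proof.
move=> l0; set t := clt_scale l n * z; set v := l * z ^+ 2 / n.+1%:R.
have t2 : t ^+ 2 = 2 * v.
  by rewrite /t exprMn sqr_clt_scale// /v; ring.
have v0 : 0 <= v by rewrite divr_ge0// mulr_ge0// sqr_ge0.
have -> : cos t - expR (- v) = (cos t - 1 + t ^+ 2 / 2) - (expR (- v) - 1 + v).
  by rewrite t2; field.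
apply: le_trans (ler_normB _ _) _.
(* The constant 5 is 4 + 1: t^4 = 4 v^2 from the cosine, v^2 from the exponential. *)
have := cos_taylor3 t; rewrite (exprM t 2 2) t2 => ct.
have := expRN_taylor1 v0.
have -> : 5 * (l * z ^+ 2) ^+ 2 / n.+1%:R ^+ 2 = 5 * v ^+ 2.
  by rewrite /v; field; rewrite nat1r pnatr_eq0.
lra.
Qed.

Let cvg_harm (C : R) : C / n.+1%:R @[n --> \oo] --> 0.
Proof. by rewrite -(mulr0 C); apply: cvgMr; exact: cvg_harmonic. Qed.

(** The base is within O(1 / n^2) of exp (- l z^2 / (n + 1)), and raising numbers of modulus at most
    1 to the power n + p multiplies the error by at most n + p. The flag p gives the exponent n + 1
    of the function and the exponent n of its derivative. *)
Lemma cvg_cos_pow l z (p : bool) : 0 <= l ->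
  cos (clt_scale l n * z) ^+ (n + p) @[n --> \oo] --> expR (- (l * z ^+ 2)).
Proof.
move=> l0; pose b n := expR (- (l * z ^+ 2 / n.+1%:R)).
have lz0 : 0 <= l * z ^+ 2 by rewrite mulr_ge0// sqr_ge0.
have cb : b n ^+ (n + p) @[n --> \oo] --> expR (- (l * z ^+ 2)).
  pose c n : R := (l * z ^+ 2) * ((~~ p)%:R / n.+1%:R) - l * z ^+ 2.
  have -> : (fun n => b n ^+ (n + p)) = (fun n => expR (c n)).
    apply/funext => n; rewrite /b -expRM_natr; congr expR; rewrite /c natrD {c}.
    by case: p; rewrite /=; field; rewrite nat1r pnatr_eq0.
  apply: continuous_cvg; first exact: continuous_expR.
  rewrite -[X in _ --> X]add0r; apply: cvgB; last exact: cvg_cst.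
  by rewrite -(mulr0 (l * z ^+ 2)); apply: cvgMr; exact: cvg_harm.
rewrite -[X in _ --> X]add0r.
have -> : (fun n => cos (clt_scale l n * z) ^+ (n + p)) =
    (fun n => (cos (clt_scale l n * z) ^+ (n + p) - b n ^+ (n + p)) + b n ^+ (n + p)).
  by apply/funext => n; ring.
apply: cvgD => //; apply/norm_cvg0P.
apply: (@squeeze_cvgr _ _ _ _ (fun=> 0) (fun n => 5 * (l * z ^+ 2) ^+ 2 / n.+1%:R)).
- near=> n; rewrite normr_ge0/=.
  apply: le_trans (normr_subX _ _ _) _.
  + exact: cos_max.
  + by rewrite ger0_norm ?expR_ge0// expR_le1 oppr_le0 divr_ge0.
  + apply: (@le_trans _ _ (n.+1%:R * (5 * (l * z ^+ 2) ^+ 2 / n.+1%:R ^+ 2))).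
      apply: ler_pM => //; last exact: cos_exp.
      by rewrite ler_nat -addn1 leq_add2l leq_b1.
    rewrite le_eqVlt; apply/orP; left; apply/eqP; field.
    by rewrite nat1r pnatr_eq0.
- exact: cvg_cst.
- exact: cvg_harm.
Unshelve. all: by end_near. Qed.

(** This factor appears when cos (t z)^(n + 1) is differentiated; since (n + 1) t^2 = 2 l it is
    dominated by a multiple of |z|, uniformly in n. *)
Lemma clt_scale_sin_le l z n : 0 <= l ->
  `|n.+1%:R * clt_scale l n * sin (clt_scale l n * z)| <= 2 * l * `|z|.
Proof.
move=> l0; have := sin_lipschitz 0 (clt_scale l n * z).
rewrite add0r sin0 subr0 => h; rewrite normrM.
apply: (@le_trans _ _ (`|n.+1%:R * clt_scale l n| * `|clt_scale l n * z|)).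
  exact: ler_wpM2l.
rewrite -normrM mulrA -(mulrA n.+1%:R) -expr2 sqr_clt_scale//.
have -> : n.+1%:R * (2 * l / n.+1%:R) = 2 * l by field; rewrite nat1r pnatr_eq0.
by rewrite normrM (ger0_norm (x := 2 * l)) ?mulr_ge0.
Qed.

Lemma cvg_clt_scale_sin l z : 0 <= l ->
  n.+1%:R * clt_scale l n * sin (clt_scale l n * z) @[n --> \oo] --> 2 * l * z.
Proof.
move=> l0.
have -> : (fun n => n.+1%:R * clt_scale l n * sin (clt_scale l n * z)) =
  (fun n => 2 * l * z - n.+1%:R * clt_scale l n * (clt_scale l n * z - sin (clt_scale l n * z))).
  apply/funext => n; have -> : 2 * l = clt_scale l n ^+ 2 * n.+1%:R.
    by rewrite sqr_clt_scale// divfK// pnatr_eq0.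
  by ring.
rewrite -[X in _ --> X]subr0; apply: cvgB; first exact: cvg_cst.
apply/norm_cvg0P.
apply: (@squeeze_cvgr _ _ _ _ (fun=> 0) (fun n => (2 * l) ^+ 2 * `|z| ^+ 3 / n.+1%:R)).
- near=> n; rewrite normr_ge0/= normrM.
  apply: le_trans (ler_wpM2l _ (sin_taylor2 _)) _ => //.
  rewrite normrM (ger0_norm (sqrtr_ge0 _)) normrM (ger0_norm (sqrtr_ge0 _)) normr_nat.
  rewrite -/(clt_scale l n).
  have -> : n.+1%:R * clt_scale l n * (clt_scale l n * `|z|) ^+ 3 =
    n.+1%:R * (clt_scale l n ^+ 2) ^+ 2 * `|z| ^+ 3 by ring.
  rewrite sqr_clt_scale// le_eqVlt; apply/orP; left; apply/eqP; field.
  by rewrite nat1r pnatr_eq0.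
- exact: cvg_cst.
- exact: cvg_harm.
Unshelve. all: by end_near. Qed.

(** A trigonometric substitute for z: bounded for fixed n, dominated by |z| for all n, and with
    limit z. *)
Lemma sin_div_le z n : `|n.+1%:R * sin (n.+1%:R^-1 * z)| <= `|z|.
Proof.
have := sin_lipschitz 0 (n.+1%:R^-1 * z); rewrite add0r sin0 subr0 normrM => h.
rewrite normrM; apply: le_trans (ler_wpM2l _ h) _ => //.
by rewrite mulrA -normrM mulfV ?normr1 ?mul1r// pnatr_eq0.
Qed.

Lemma cvg_sin_div z : n.+1%:R * sin (n.+1%:R^-1 * z) @[n --> \oo] --> z.
Proof.
have -> : (fun n => n.+1%:R * sin (n.+1%:R^-1 * z)) =
  (fun n => z - n.+1%:R * (n.+1%:R^-1 * z - sin (n.+1%:R^-1 * z))).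
  by apply/funext => n; field; rewrite nat1r pnatr_eq0.
rewrite -[X in _ --> X]subr0; apply: cvgB; first exact: cvg_cst.
apply/norm_cvg0P.
apply: (@squeeze_cvgr _ _ _ _ (fun=> 0) (fun n => `|z| ^+ 3 / n.+1%:R)).
- near=> n; rewrite normr_ge0/= normrM.
  apply: le_trans (ler_wpM2l _ (sin_taylor2 _)) _ => //.
  rewrite normrM normfV !normr_nat.
  have -> : n.+1%:R * (n.+1%:R^-1 * `|z|) ^+ 3 = `|z| ^+ 3 / n.+1%:R * n.+1%:R^-1.
    by field; rewrite nat1r pnatr_eq0.
  apply: ler_piMr; first by rewrite divr_ge0// exprn_ge0.
  by rewrite invf_le1// ler1n.
- exact: cvg_cst.
- exact: cvg_harm.
Unshelve. all: by end_near. Qed.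

Lemma cvg_cos_div z : cos (n.+1%:R^-1 * z) @[n --> \oo] --> (1 : R).
Proof.
rewrite -[X in _ --> X]cos0; apply: continuous_cvg; first exact: continuous_cos.
by under eq_fun do rewrite mulrC; exact: cvg_harm.
Qed.

End cos_power_limit.

(** * Gaussian integration by parts *)

Section gaussian_space.
Context d (T : measurableType d) (R : realType) (P : probability T R).
Variable H : (T -> R) -> Prop.
Hypothesis Hfacts : forall Z, H Z -> gaussian_facts P Z.
Hypothesis Hlin : forall (a b : R) Y Z, H Y -> H Z -> H (fun w => a * Y w + b * Z w).
Implicit Types Y Z U : T -> R.

(** The plain second moment is the covariance, since members of [H] are centred. *)
Definition cov Y Z : R := \int[P]_w (Y w * Z w).

Lemma L1_bounded (f : T -> R) (C : R) :
  measurable_fun setT f -> (forall w, `|f w| <= C) -> L1 P f.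
Proof.
move=> mf fC; apply: (@L1_le _ _ _ P (fun=> C)) => //.
exact: finite_measure_integrable_cst.
Qed.

Lemma H_scale k Z : H Z -> H (fun w => k * Z w).
Proof.
move=> HZ; have := Hlin k 0 HZ HZ; congr H; apply/funext => w.
by rewrite mul0r addr0.
Qed.

Lemma H_measurable Z : H Z -> measurable_fun setT Z.
Proof. by move=> /Hfacts[]. Qed.

Lemma H_L1_4 Y1 Y2 Y3 Y4 : H Y1 -> H Y2 -> H Y3 -> H Y4 ->
  L1 P (fun w => Y1 w * Y2 w * Y3 w * Y4 w).
Proof.
move=> H1 H2 H3 H4.
apply: (@L1_le _ _ _ P (fun w => (Y1 w ^+ 4 + Y2 w ^+ 4) + (Y3 w ^+ 4 + Y4 w ^+ 4))).
- by apply: L1D; apply: L1D; [have [] := Hfacts H1|have [] := Hfacts H2|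
    have [] := Hfacts H3|have [] := Hfacts H4].
- by repeat apply: measurable_funM; exact: H_measurable.
- move=> w; have p4 (x : R) : x ^+ 4 = (`|x| ^+ 2) ^+ 2.
    by rewrite real_normK ?num_real// -exprM.
  rewrite !normrM !p4.
  move: (normr_ge0 (Y1 w)) (normr_ge0 (Y2 w)) (normr_ge0 (Y3 w)) (normr_ge0 (Y4 w)).
  move: `|Y1 w| `|Y2 w| `|Y3 w| `|Y4 w| => a b c e a0 b0 c0 e0.
  have h1 := sqr_ge0 (a * b - c * e); have h2 := sqr_ge0 (a ^+ 2 - b ^+ 2).
  have h3 := sqr_ge0 (c ^+ 2 - e ^+ 2).
  have h4 := sqr_ge0 (a ^+ 2); have h5 := sqr_ge0 (b ^+ 2).
  have h6 := sqr_ge0 (c ^+ 2); have h7 := sqr_ge0 (e ^+ 2).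
  nra.
Qed.

Lemma H_L1_2 Y1 Y2 : H Y1 -> H Y2 -> L1 P (fun w => Y1 w * Y2 w).
Proof.
move=> H1 H2.
apply: (@L1_le _ _ _ P (fun w => 1 + Y1 w * Y2 w * Y1 w * Y2 w)).
- apply: L1D; first exact: finite_measure_integrable_cst.
  exact: H_L1_4.
- by apply: measurable_funM; exact: H_measurable.
- move=> w; rewrite (_ : _ * Y1 w * Y2 w = (Y1 w * Y2 w) ^+ 2); last by ring.
  rewrite -[in leRHS]real_normK ?num_real//.
  by have := sqr_ge0 (`|Y1 w * Y2 w| - 1); have := normr_ge0 (Y1 w * Y2 w); nra.
Qed.

Lemma H_L1 Y : H Y -> L1 P Y.
Proof.
move=> HY; apply: (@L1_le _ _ _ P (fun w => 1 + Y w * Y w)).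
- apply: L1D; first exact: finite_measure_integrable_cst.
  exact: H_L1_2.
- exact: H_measurable.
- move=> w; rewrite -expr2 -real_normK ?num_real//.
  by have := sqr_ge0 (`|Y w| - 1); have := normr_ge0 (Y w); nra.
Qed.

Lemma covC Y Z : cov Y Z = cov Z Y.
Proof. by apply: eq_Rintegral => w _; rewrite mulrC. Qed.

Lemma cov_lin a b Y Z U : H Y -> H Z -> H U ->
  cov U (fun w => a * Y w + b * Z w) = a * cov U Y + b * cov U Z.
Proof.
move=> HY HZ HU; transitivity (\int[P]_w (a * (U w * Y w) + b * (U w * Z w))).
  by apply: eq_Rintegral => w _; ring.
by rewrite IntD ?IntZ//; do ?[exact: H_L1_2 | apply: L1Z].
Qed.

Let measurable_cosH Z th : H Z -> measurable_fun setT (fun w => cos (Z w + th)).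
Proof.
move=> HZ; apply: (measurableT_comp (f := fun x : R => cos x)).
  by apply: continuous_measurable_fun; exact: continuous_cos.
by apply: measurable_funD => //; exact: H_measurable.
Qed.

Let measurable_sinH Z th : H Z -> measurable_fun setT (fun w => sin (Z w + th)).
Proof.
move=> HZ; apply: (measurableT_comp (f := fun x : R => sin x)).
  by apply: continuous_measurable_fun; exact: continuous_sin.
by apply: measurable_funD => //; exact: H_measurable.
Qed.

Let L1M U (g : T -> R) C : H U -> measurable_fun setT g -> (forall w, `|g w| <= C) ->
  L1 P (fun w => U w * g w).
Proof.
move=> HU mg gC; apply: (@L1_le _ _ _ P (fun w => C * `|U w|)).
- by apply: L1Z; apply: L1_norm; exact: H_L1.
- by apply: measurable_funM => //; exact: H_measurable.
- by move=> w; rewrite normrM mulrC ler_wpM2r.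
Qed.

Let is_derive_unique (f : R -> R) (x a b : R) :
  is_derive x 1 f a -> is_derive x 1 f b -> a = b.
Proof. by move=> [_ <-] [_ <-]. Qed.

(* Differentiate E cos (Z + t U + th) = cos th exp (- Var (Z + t U) / 2) at t = 0. *)
Lemma ibp_cos U Z th : H U -> H Z ->
  \int[P]_w (U w * cos (Z w + th)) = \int[P]_w (- cov U Z * sin (Z w + th)).
Proof.
move=> HU HZ.
have ibp_sin th' : \int[P]_w (U w * sin (Z w + th')) = cov U Z * \int[P]_w cos (Z w + th').
  pose f t := \int[P]_w cos (Z w + t * U w + th').
  have HZU t : H (fun w => Z w + t * U w).
    have := Hlin 1 t HZ HU; congr H; apply/funext => w; by rewrite mul1r.
  have iU2 := H_L1_2 HU HU.
  have isin : L1 P (fun w => U w * sin (Z w + th')).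
    by apply: (@L1M _ _ 1) => //; [exact: measurable_sinH|move=> w; exact: sin_max].
  have icos t : L1 P (fun w => cos (Z w + t * U w + th')).
    by apply: (@L1_bounded _ 1); [exact: (measurable_cosH th' (HZU t))|move=> w; exact: cos_max].
  (* The derivative of f at 0 is computed twice: here under the integral, and in [d2] from the
     closed form that [Hfacts] gives for Z + t U. *)
  have d1 : is_derive (0 : R) 1 f (- (\int[P]_w (U w * sin (Z w + th')))).
    apply: (@is_derive_quadratic R _ _ _ (cov U U)) => h.
    have -> : f (0 + h) - f 0 - h * - (\int[P]_w (U w * sin (Z w + th'))) =
        \int[P]_w (cos (Z w + th' + h * U w) - cos (Z w + th') + h * U w * sin (Z w + th')).
      rewrite mulrN opprK /f -IntZ// -IntB// -IntD//; [|exact: L1B|exact: L1Z].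
      apply: eq_Rintegral => w _; rewrite add0r mul0r addr0 [Z w + h * U w + th']addrAC; ring.
    have irem : L1 P (fun w => cos (Z w + th' + h * U w) - cos (Z w + th') + h * U w * sin (Z w + th')).
      have -> : (fun w => cos (Z w + th' + h * U w) - cos (Z w + th') + h * U w * sin (Z w + th')) =
        (fun w => (cos (Z w + h * U w + th') - cos (Z w + 0 * U w + th')) + h * (U w * sin (Z w + th'))).
        by apply/funext => w; rewrite mul0r addr0 mulrA [Z w + h * U w + th']addrAC.
      by apply: L1D; [exact: L1B|exact: L1Z].
    apply: le_trans (Int_norm irem) _; rewrite mulrC -IntZ//.
    apply: Int_le; [exact: L1_norm|exact: L1Z|move=> w].
    by rewrite -expr2 -exprMn; exact: cos_taylor1.
  have fE t : f t = cos th' * expR (- ((cov Z Z + 2 * t * cov U Z + t ^+ 2 * cov U U) / 2)).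
    rewrite /f; have [_ _ _ /(_ th') ->] := Hfacts (HZU t).
    congr (_ * expR (- (_ / 2))).
    transitivity (\int[P]_w (Z w * Z w + 2 * t * (U w * Z w) + t ^+ 2 * (U w * U w))).
      by apply: eq_Rintegral => w _; ring.
    rewrite IntD ?IntD ?IntZ//.
    all: do ?[exact: H_L1_2 | apply: L1Z | apply: L1D].
  have d2 : is_derive (0 : R) 1 f (- (cov U Z * f 0)).
    rewrite fE (_ : f = fun t => cos th' * expR (- ((cov Z Z + 2 * t * cov U Z + t ^+ 2 * cov U U) / 2))); last exact/funext.
    apply: is_derive_eq; rewrite -![_ *: _]/(_ * _)/=; by field.
  have e := is_derive_unique d1 d2; move/oppr_inj : e => ->; congr (_ * _).
  by apply: eq_Rintegral => w _; rewrite mul0r addr0.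
(* A quarter turn of th exchanges the sine version just proved and the cosine version. *)
have cosE (x : R) : cos x = sin (x + pi / 2) by rewrite sinDpihalf.
have sinE (x : R) : sin x = - cos (x + pi / 2) by rewrite cosDpihalf opprK.
under eq_Rintegral do rewrite cosE -addrA.
rewrite ibp_sin IntZ; last first.
  by apply: (@L1_bounded _ 1); [exact: measurable_sinH|move=> w; exact: sin_max].
under [in RHS]eq_Rintegral do rewrite sinE -addrA.
rewrite IntN; first by rewrite mulrNN.
by apply: (@L1_bounded _ 1); [exact: measurable_cosH|move=> w; exact: cos_max].
Qed.

End gaussian_space.

(** * Integration by parts for exp (- l Q) *)

Section quadratic_form.
Context d (T : measurableType d) (R : realType) (P : probability T R).
Variable H : (T -> R) -> Prop.
Hypothesis Hfacts : forall Z, H Z -> gaussian_facts P Z.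
Hypothesis Hlin : forall (a b : R) Y Z, H Y -> H Z -> H (fun w => a * Y w + b * Z w).
Implicit Types Y Z U V g h : T -> R.

Local Notation cov := (cov P).

Let L12 := H_L1_2 Hfacts.

(* g' is the derivative of g in the direction of U, so that E[U g] = E[g'] by
   Gaussian integration by parts; trigonometric functions generate enough g. *)
Inductive ibp_pair U : (T -> R) -> (T -> R) -> Prop :=
| ibp_cos_pair Z th : H Z ->
    ibp_pair U (fun w => cos (Z w + th)) (fun w => - cov U Z * sin (Z w + th))
| ibp_lin_pair a g g' h h' : ibp_pair U g g' -> ibp_pair U h h' ->
    ibp_pair U (fun w => a * g w + h w) (fun w => a * g' w + h' w).

Lemma ibp_pair_ext U g g' h h' : ibp_pair U g g' -> g =1 h -> g' =1 h' -> ibp_pair U h h'.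
Proof. by move=> ? /funext <- /funext <-. Qed.

Lemma ibp_pair_scale U a g g' : ibp_pair U g g' ->
  ibp_pair U (fun w => a * g w) (fun w => a * g' w).
Proof.
move=> gg; apply: ibp_pair_ext (ibp_lin_pair (a - 1) gg gg) _ _ => w; ring.
Qed.

Lemma ibp_pair_bounded U g g' : ibp_pair U g g' ->
  [/\ measurable_fun setT g, measurable_fun setT g' &
      exists C, forall w, `|g w| <= C /\ `|g' w| <= C].
Proof.
have mcos : measurable_fun setT (fun x : R => cos x).
  by apply: continuous_measurable_fun; exact: continuous_cos.
have msin : measurable_fun setT (fun x : R => sin x).
  by apply: continuous_measurable_fun; exact: continuous_sin.
elim=> [Z th HZ|a {}g {}g' h h' _ [mg mg' [C gC]] _ [mh mh' [D hD]]].
  have mZ := H_measurable Hfacts HZ.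
  have mZt : measurable_fun setT (fun w => Z w + th) by exact: measurable_funD.
  split; first exact: (measurableT_comp mcos mZt).
    by apply: measurable_funM => //; exact: (measurableT_comp msin mZt).
  exists (1 + `|cov U Z|) => w; split.
    by apply: le_trans (cos_max _) _; rewrite lerDl.
  rewrite normrM normrN; apply: (@le_trans _ _ `|cov U Z|); last by rewrite lerDr.
  by rewrite ler_piMr// sin_max.
split; [by apply: measurable_funD => //; apply: measurable_funM..|].
exists (`|a| * C + D) => w; have [g1 g2] := gC w; have [h1 h2] := hD w.
by split; apply: le_trans (ler_normD _ _) _; apply: lerD => //;
   rewrite normrM; apply: ler_wpM2l.
Qed.

Lemma ibp_pairE U g g' : H U -> ibp_pair U g g' ->
  \int[P]_w (U w * g w) = \int[P]_w g' w.
Proof.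
move=> HU.
have L1b (f : T -> R) C : measurable_fun setT f -> (forall w, `|f w| <= C) -> L1 P f.
  exact: L1_bounded.
have L1U (f : T -> R) C : measurable_fun setT f -> (forall w, `|f w| <= C) -> L1 P (fun w => U w * f w).
  move=> mf fC; apply: (@L1_le _ _ _ P (fun w => C * `|U w|)).
  - by apply: L1Z; apply: L1_norm; exact: (H_L1 Hfacts).
  - by apply: measurable_funM => //; exact: (H_measurable Hfacts).
  - by move=> w; rewrite normrM mulrC ler_wpM2r.
elim=> [Z th HZ|a {}g {}g' h h' gg IHg hh IHh]; first exact: (ibp_cos Hfacts Hlin).
have [mg mg' [C gC]] := ibp_pair_bounded gg.
have [mh mh' [D hD]] := ibp_pair_bounded hh.
transitivity (\int[P]_w (a * (U w * g w) + U w * h w)).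
  by apply: eq_Rintegral => w _; ring.
have i1 : L1 P (fun w => U w * g w) by apply: (L1U _ C) => // w; case: (gC w).
have i2 : L1 P (fun w => U w * h w) by apply: (L1U _ D) => // w; case: (hD w).
have i3 : L1 P g' by apply: (L1b _ C) => // w; case: (gC w).
have i4 : L1 P h' by apply: (L1b _ D) => // w; case: (hD w).
rewrite IntD//; last exact: L1Z.
rewrite IntD//; last exact: L1Z.
by rewrite !IntZ// IHg IHh.
Qed.

(** By bilinearity two cosines suffice, and the product-to-sum formula writes their product with the
    variables Y + Z and Y - Z, which stay in [H]. *)
Lemma ibp_pair_mul U g g' h h' : H U -> ibp_pair U g g' -> ibp_pair U h h' ->
  ibp_pair U (fun w => g w * h w) (fun w => g' w * h w + g w * h' w).
Proof.
move=> HU gg; elim=> [Z th HZ|a {}h {}h' k k' hh IHh kk IHk]; last first.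
  by apply: ibp_pair_ext (ibp_lin_pair a IHh IHk) _ _ => w; ring.
elim: gg => [Y ph HY|a {}g {}g' k k' gg IHg kk IHk]; last first.
  by apply: ibp_pair_ext (ibp_lin_pair a IHg IHk) _ _ => w; ring.
have HD := Hlin 1 1 HY HZ; have HB := Hlin 1 (-1) HY HZ.
apply: ibp_pair_ext (ibp_lin_pair 2^-1 (ibp_cos_pair U (ph + th) HD)
  (ibp_pair_scale 2^-1 (ibp_cos_pair U (ph - th) HB))) _ _ => w.
  rewrite (_ : 1 * Y w + 1 * Z w + (ph + th) = (Y w + ph) + (Z w + th)); last by ring.
  rewrite (_ : 1 * Y w + -1 * Z w + (ph - th) = (Y w + ph) - (Z w + th)); last by ring.
  by rewrite cosD cosB; field.
rewrite !(cov_lin Hfacts)//.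
rewrite (_ : 1 * Y w + 1 * Z w + (ph + th) = (Y w + ph) + (Z w + th)); last by ring.
rewrite (_ : 1 * Y w + -1 * Z w + (ph - th) = (Y w + ph) - (Z w + th)); last by ring.
by rewrite sinD sinB; field.
Qed.

Lemma ibp_pair1 U : H U -> ibp_pair U (fun=> 1) (fun=> 0).
Proof.
move=> HU; have H0 : H (fun=> 0).
  have := Hlin 0 0 HU HU; congr H; apply/funext => w; ring.
apply: ibp_pair_ext (ibp_cos_pair U 0 H0) _ _ => w; rewrite addr0 ?cos0//.
by rewrite sin0 mulr0.
Qed.

Lemma ibp_pair_exp U g g' n : H U -> ibp_pair U g g' ->
  ibp_pair U (fun w => g w ^+ n) (fun w => n%:R * g w ^+ n.-1 * g' w).
Proof.
move=> HU gg; elim: n => [|n IH].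
  by apply: ibp_pair_ext (ibp_pair1 HU) _ _ => w; rewrite ?expr0// !mul0r.
apply: ibp_pair_ext (ibp_pair_mul HU gg IH) _ _ => w; first by rewrite exprS.
case: n IH => [|n] _ /=; first by rewrite expr0 !mul0r mulr0 addr0 mulr1 mul1r mul1r.
by rewrite exprS -!natr1; ring.
Qed.

(** The bounds are those that dominated convergence requires after multiplication by a further
    member V of [H]: g is bounded by 1, and V times the majorant B of the derivatives is integrable
    because both are square integrable. The bound 1 is stable under products. *)
Definition ibp_lim U g g' : Prop := exists (g_ g'_ : nat -> T -> R) (B : T -> R),
  (forall n, ibp_pair U (g_ n) (g'_ n)) /\
  (forall n w, `|g_ n w| <= 1 /\ `|g'_ n w| <= B w) /\
  (forall w, g_ n w @[n --> \oo] --> g w /\ g'_ n w @[n --> \oo] --> g' w) /\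
  measurable_fun setT B /\ L1 P (fun w => B w ^+ 2).

Lemma ibp_lim_mul U g g' h h' : H U -> ibp_lim U g g' -> ibp_lim U h h' ->
  ibp_lim U (fun w => g w * h w) (fun w => g' w * h w + g w * h' w).
Proof.
move=> HU [g_ [g'_ [B [pg [bg [cg [mB iB]]]]]]] [h_ [h'_ [C [ph [bh [ch [mC iC]]]]]]].
exists (fun n w => g_ n w * h_ n w).
exists (fun n w => g'_ n w * h_ n w + g_ n w * h'_ n w), (fun w => B w + C w).
split; first by move=> n; exact: ibp_pair_mul.
split.
  move=> n w; have [g1 gB] := bg n w; have [h1 hC] := bh n w; split.
    by rewrite normrM mulr_ile1.
  apply: le_trans (ler_normD _ _) _; rewrite !normrM; apply: lerD.
    by apply: le_trans gB; rewrite ler_piMr.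
  by apply: le_trans hC; rewrite ler_piMl.
split.
  move=> w; have [g1 g2] := cg w; have [h1 h2] := ch w.
  by split; [exact: cvgM|apply: cvgD; exact: cvgM].
split; first exact: measurable_funD.
apply: (@L1_le _ _ _ P (fun w => 2 * B w ^+ 2 + 2 * C w ^+ 2)).
- by apply: L1D; exact: L1Z.
- by apply: measurable_funX; exact: measurable_funD.
- by move=> w; rewrite ger0_norm ?sqr_ge0//; have := sqr_ge0 (B w - C w); nra.
Qed.

Lemma ibp_lim1 U : H U -> ibp_lim U (fun=> 1) (fun=> 0).
Proof.
move=> HU; exists (fun _ _ => 1), (fun _ _ => 0), (fun=> 0); split.
  by move=> _; exact: ibp_pair1.
split; first by move=> _ w; rewrite normr1 normr0.
split; first by move=> w; split; exact: cvg_cst.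
split; first exact: measurable_cst.
by rewrite expr0n; exact: L1_0.
Qed.

(** Approximation by cos (t Z)^(n + 1) with t = [clt_scale l n]; the chain rule brings out (n + 1) t
    sin (t Z), which tends to 2 l Z. *)
Lemma ibp_lim_gauss U Z l : H U -> H Z -> 0 <= l ->
  ibp_lim U (fun w => expR (- (l * Z w ^+ 2)))
    (fun w => - (2 * l * Z w) * cov U Z * expR (- (l * Z w ^+ 2))).
Proof.
move=> HU HZ l0.
exists (fun n w => cos (clt_scale l n * Z w) ^+ n.+1).
exists (fun n w => - (n.+1%:R * clt_scale l n * sin (clt_scale l n * Z w)) * cov U Z
                   * cos (clt_scale l n * Z w) ^+ n).
exists (fun w => 2 * l * `|cov U Z| * `|Z w|); split.
  move=> n; have HZn := H_scale Hlin (clt_scale l n) HZ.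
  apply: ibp_pair_ext (ibp_pair_exp n.+1 HU (ibp_cos_pair U 0 HZn)) _ _ => w.
    by rewrite addr0.
  rewrite addr0 /= (_ : cov U (fun w0 => clt_scale l n * Z w0) = clt_scale l n * cov U Z).
    by ring.
  rewrite /cov -IntZ ?L12//.
  by apply: eq_Rintegral => w' _; ring.
split.
  move=> n w; split; first by rewrite normrX exprn_ile1// cos_max.
  rewrite normrM; apply: (@le_trans _ _ (`|- (n.+1%:R * clt_scale l n * sin (clt_scale l n * Z w)) * cov U Z|)).
    by rewrite ler_piMr// normrX exprn_ile1// cos_max.
  rewrite normrM normrN; have := clt_scale_sin_le (Z w) n l0.
  by have := normr_ge0 (cov U Z); nra.
split.
  move=> w; split.
    have := @cvg_cos_pow R l (Z w) true l0; under eq_fun do rewrite addn1; exact.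
  apply: cvgM.
    by apply: cvgMl; apply: cvgN; exact: cvg_clt_scale_sin.
  have := @cvg_cos_pow R l (Z w) false l0; under eq_fun do rewrite addn0; exact.
have mZ := H_measurable Hfacts HZ.
split; first by apply: measurable_funM => //; exact: measurableT_comp.
have := L1Z ((2 * l * `|cov U Z|) ^+ 2) (L12 HZ HZ); congr L1; apply/funext => w.
by rewrite [in RHS]exprMn real_normK ?num_real// -expr2.
Qed.

(** Integration by parts of the product V g against U. The unbounded V is replaced by a rescaled
    sine, the product rule is applied to pairs, and the limit is taken in all three integrals. *)
Lemma ibp_limE U V g g' : H U -> H V -> ibp_lim U g g' ->
  [/\ L1 P (fun w => U w * V w * g w), L1 P g, L1 P (fun w => V w * g' w) &
  \int[P]_w (U w * V w * g w) = cov U V * \int[P]_w g w + \int[P]_w (V w * g' w)].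
Proof.
move=> HU HV [g_ [g'_ [B [pg [bg [cg [mB iB]]]]]]].
have mU := H_measurable Hfacts HU; have mV := H_measurable Hfacts HV.
pose s n w : R := n.+1%:R * sin (n.+1%:R^-1 * V w).
pose c n w : R := cos (n.+1%:R^-1 * V w).
have psn n : ibp_pair U (s n) (fun w => cov U V * c n w).
  have HVn := H_scale Hlin n.+1%:R^-1 HV.
  apply: ibp_pair_ext (ibp_pair_scale n.+1%:R (ibp_cos_pair U (- (pi / 2)) HVn)) _ _ => w.
    by rewrite cosBpihalf.
  rewrite (_ : cov U (fun w0 => n.+1%:R^-1 * V w0) = n.+1%:R^-1 * cov U V).
    by rewrite sinBpihalf /c; field; rewrite nat1r pnatr_eq0.
  rewrite /cov -IntZ ?L12//.
  by apply: eq_Rintegral => w' _; ring.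
have ms n : measurable_fun setT (s n) by have [] := ibp_pair_bounded (psn n).
have mc n : measurable_fun setT (c n).
  apply: (measurableT_comp (f := fun x : R => cos x)).
    by apply: continuous_measurable_fun; exact: continuous_cos.
  exact: measurable_funM.
have mg n : measurable_fun setT (g_ n) by have [] := ibp_pair_bounded (pg n).
have mg' n : measurable_fun setT (g'_ n) by have [] := ibp_pair_bounded (pg n).
have B0 w : 0 <= B w by have [_] := bg 0%N w; exact: le_trans.
have cs w : s n w @[n --> \oo] --> V w by exact: cvg_sin_div.
have cc w : c n w @[n --> \oo] --> (1 : R) by exact: cvg_cos_div.
have [i1 l1] : L1 P (fun w => U w * V w * g w) /\
    \int[P]_w (U w * (s n w * g_ n w)) @[n --> \oo] --> \int[P]_w (U w * V w * g w).
  apply: (L1_dct (g := fun w => `|U w * V w|)).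
  - exact: L1_norm (L12 HU HV).
  - by move=> n; do 2 apply: measurable_funM => //.
  - move=> n w; have [g1 _] := bg n w; rewrite normrM [leRHS]normrM; apply: ler_wpM2l => //.
    by rewrite normrM -[leRHS]mulr1; apply: ler_pM => //; exact: sin_div_le.
  - move=> w; rewrite -mulrA; apply: cvgMr; apply: cvgM => //.
    by have [] := cg w.
have [i2 l2] : L1 P g /\ \int[P]_w (c n w * g_ n w) @[n --> \oo] --> \int[P]_w g w.
  apply: (L1_dct (g := fun=> 1)).
  - exact: finite_measure_integrable_cst.
  - by move=> n; apply: measurable_funM.
  - by move=> n w; have [g1 _] := bg n w; rewrite normrM mulr_ile1// cos_max.
  - by move=> w; rewrite -[g w]mul1r; apply: cvgM => //; have [] := cg w.
have [i3 l3] : L1 P (fun w => V w * g' w) /\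
    \int[P]_w (s n w * g'_ n w) @[n --> \oo] --> \int[P]_w (V w * g' w).
  apply: (L1_dct (g := fun w => B w ^+ 2 + V w * V w)).
  - by apply: L1D => //; exact: L12.
  - by move=> n; apply: measurable_funM.
  - move=> n w; have [_ g2] := bg n w; rewrite normrM -expr2 -[V w ^+ 2]real_normK ?num_real//.
    have := sin_div_le (V w) n; rewrite -/(s n w).
    have := normr_ge0 (s n w); have := normr_ge0 (g'_ n w).
    have := sqr_ge0 (B w - `|V w|); have := B0 w; nra.
  - by move=> w; apply: cvgM => //; have [] := cg w.
split => //.
have e n : \int[P]_w (U w * (s n w * g_ n w)) =
    cov U V * \int[P]_w (c n w * g_ n w) + \int[P]_w (s n w * g'_ n w).
  rewrite (ibp_pairE HU (ibp_pair_mul HU (psn n) (pg n))) -IntZ; last first.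
    apply: (@L1_bounded _ _ _ P _ 1); first exact: measurable_funM.
    by move=> w; have [g1 _] := bg n w; rewrite normrM mulr_ile1// cos_max.
  rewrite -IntD; last 2 first.
  - apply: L1Z; apply: (@L1_bounded _ _ _ P _ 1); first exact: measurable_funM.
    by move=> w; have [g1 _] := bg n w; rewrite normrM mulr_ile1// cos_max.
  - have [m1 m2 [C bC]] := ibp_pair_bounded (psn n).
    have [_ _ [D bD]] := ibp_pair_bounded (pg n).
    apply: (@L1_bounded _ _ _ P _ (C * D)); first exact: measurable_funM.
    move=> w; have [c1 _] := bC w; have [_ d1] := bD w; rewrite normrM; exact: ler_pM.
  by apply: eq_Rintegral => w _; rewrite mulrA.
have l4 : \int[P]_w (U w * (s n w * g_ n w)) @[n --> \oo] -->
    cov U V * \int[P]_w g w + \int[P]_w (V w * g' w).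
  by under eq_fun do rewrite e; apply: cvgD => //; apply: cvgMr.
exact: (cvg_unique _ l1 l4).
Qed.

Variables (k : nat) (Y : 'I_k -> T -> R).
Hypothesis HY : forall i, H (Y i).

Definition sqnorm w : R := \sum_i Y i w ^+ 2.
(** Y^T S Y for the covariance matrix S: the derivative of [sqnorm] in the direction of Y_i is 2
    sum_j S_ij Y_j, and weighting it by Y_i and summing over i gives twice this form. *)
Definition covform w : R := \sum_i \sum_j cov (Y i) (Y j) * (Y i w * Y j w).
Definition covtrace : R := \sum_i cov (Y i) (Y i).

(** exp (- l Q) is the product of the factors exp (- l Y_i^2), so the product rule applies factor by
    factor. *)
Lemma ibp_lim_sqnorm U l : H U -> 0 <= l ->
  ibp_lim U (fun w => expR (- (l * sqnorm w)))
    (fun w => - (2 * l) * (\sum_j cov U (Y j) * Y j w) * expR (- (l * sqnorm w))).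
Proof.
move=> HU l0; rewrite /sqnorm; elim: (index_enum _) => [|i r IH].
  have := ibp_lim1 HU; congr (ibp_lim U _ _); apply/funext => w.
    by rewrite big_nil mulr0 oppr0 expR0.
  by rewrite !big_nil !mulr0 mul0r.
have := ibp_lim_mul HU (ibp_lim_gauss HU (HY i) l0) IH.
congr (ibp_lim U _ _); apply/funext => w; rewrite !big_cons [l * (_ + _)]mulrDr opprD expRD//.
by ring.
Qed.

Lemma L1_sqnorm : L1 P sqnorm.
Proof. by apply: L1_sum => i _; exact: L12. Qed.

Lemma L1_covform : L1 P covform.
Proof. by apply: L1_sum => i _; apply: L1_sum => j _; apply: L1Z; exact: L12. Qed.

Lemma Int_sqnorm : \int[P]_w sqnorm w = covtrace.
Proof. by rewrite Int_sum// => i _; exact: L12. Qed.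

(** Integration by parts with U = V = Y_i, summed over i: the terms cov (Y_i, Y_i) add up to the
    trace, and the derivatives of the exponential to the quadratic form. *)
Lemma sqnorm_laplace l : 0 <= l ->
  \int[P]_w ((sqnorm w - covtrace) * expR (- (l * sqnorm w))) =
  2 * \int[P]_w (covform w * (- l * expR (- (l * sqnorm w)))).
Proof.
move=> l0.
pose E w := expR (- (l * sqnorm w)).
have key i := ibp_limE (HY i) (HY i) (ibp_lim_sqnorm (HY i) l0).
have iE : L1 P E.
  apply: (@L1_bounded _ _ _ P _ 1).
    apply: (measurableT_comp (f := fun x : R => expR x)).
      by apply: continuous_measurable_fun; exact: continuous_expR.
    by apply: measurableT_comp => //; apply: measurable_funM => //; exact: L1_measurable L1_sqnorm.
  move=> w; rewrite ger0_norm ?expR_ge0// expR_le1 oppr_le0 mulr_ge0//.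
  by apply: sumr_ge0 => i _; exact: sqr_ge0.
have i1 i : L1 P (fun w => Y i w * Y i w * E w) by have [] := key i.
have i2 i : L1 P (fun w => Y i w * (- (2 * l) * (\sum_j cov (Y i) (Y j) * Y j w) * E w)).
  by have [] := key i.
transitivity (\sum_i \int[P]_w (Y i w * Y i w * E w) - covtrace * \int[P]_w E w).
  rewrite -Int_sum// -IntZ// -IntB//; [|exact: L1_sum|exact: L1Z].
  by apply: eq_Rintegral => w _; rewrite mulrBl /sqnorm -mulr_suml.
have -> : \sum_i \int[P]_w (Y i w * Y i w * E w) = covtrace * \int[P]_w E w +
    \int[P]_w (\sum_i Y i w * (- (2 * l) * (\sum_j cov (Y i) (Y j) * Y j w) * E w)).
  rewrite Int_sum// /covtrace mulr_suml -big_split/=; apply: eq_bigr => i _.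
  by have [] := key i.
rewrite addrAC subrr add0r.
have e w : \sum_i Y i w * (- (2 * l) * (\sum_j cov (Y i) (Y j) * Y j w) * E w) =
    2 * (covform w * (- l * E w)).
  rewrite /covform mulr_suml mulr_sumr; apply: eq_bigr => i _.
  rewrite !mulr_sumr !mulr_suml !mulr_sumr; apply: eq_bigr => j _; ring.
under eq_Rintegral do rewrite e.
rewrite IntZ//; have /(L1Z 2^-1) := L1_sum (index_enum _) (p := xpredT) (fun i _ => i2 i).
congr L1; apply/funext => w; by rewrite e mulKf.
Qed.

End quadratic_form.

(** * Bernstein approximation *)

Section bernstein.
Context (R : realType).
Implicit Types (g h : nat -> R) (u : nat -> nat -> R) (y L : R).

(** The polynomial sum_k C(n, k) g k X^k (1 - X)^(n - k), by de Casteljau's recursion. Indexing g by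
    integers leaves the placement of the nodes to the user, so that values and difference quotients
    are treated alike. *)
Fixpoint bernstein n g : {poly R} :=
  if n is n'.+1 then
    (1 - 'X) * bernstein n' g + 'X * bernstein n' (fun k => g k.+1)
  else (g 0%N)%:P.

Lemma bernsteinSE n g y : (bernstein n.+1 g).[y] =
  (1 - y) * (bernstein n g).[y] + y * (bernstein n (fun k => g k.+1)).[y].
Proof. by rewrite /= !hornerE. Qed.

Let bernsteinB n g h : bernstein n g - bernstein n h = bernstein n (fun k => g k - h k).
Proof.
elim: n g h => [|n IH] g h /=; first by rewrite polyCB.
by rewrite -!IH; ring.
Qed.

Lemma deriv_bernstein n g :
  (bernstein n.+1 g)^`() = n.+1%:R *: bernstein n (fun k => g k.+1 - g k).
Proof.
have step m f : (bernstein m.+1 f)^`() = bernstein m (fun k => f k.+1 - f k) +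
    ((1 - 'X) * (bernstein m f)^`() + 'X * (bernstein m (fun k => f k.+1))^`()).
  rewrite /= derivD !derivM derivB derivX derivC -bernsteinB; ring.
elim: n g => [|n IH] g.
  by rewrite step /= !derivC scale1r; ring.
rewrite step !IH -!scalerAr -scalerDr -[in RHS]nat1r scalerDl scale1r.
by congr (_ + _ *: _).
Qed.

Lemma bernstein_le n g h y : 0 <= y <= 1 -> (forall k, (k <= n)%N -> `|g k| <= h k) ->
  `|(bernstein n g).[y]| <= (bernstein n h).[y].
Proof.
move=> /andP[y0 y1]; elim: n g h => [|n IH] g h gh; first by rewrite !hornerE; exact: gh.
rewrite !bernsteinSE; apply: le_trans (ler_normD _ _) _.
rewrite !normrM (ger0_norm y0) ger0_norm ?subr_ge0//; apply: lerD; apply: ler_wpM2l.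
- by rewrite subr_ge0.
- by apply: IH => k kn; apply: gh; exact: leqW.
- by [].
- by apply: IH => k kn; exact: gh.
Qed.

Lemma bernstein_lin n (a b : R) g y :
  (bernstein n (fun k => a + b * g k)).[y] = a + b * (bernstein n g).[y].
Proof.
elim: n g => [|n IH] g; first by rewrite !hornerE.
by rewrite !bernsteinSE !IH; ring.
Qed.

Lemma bernsteinZ n (b : R) g y :
  (bernstein n (fun k => b * g k)).[y] = b * (bernstein n g).[y].
Proof.
by rewrite -[RHS]add0r -bernstein_lin; congr (bernstein n _).[y]; apply/funext => k; rewrite add0r.
Qed.

(** The mean square deviation from c of a binomial variable: squared bias plus variance. *)
Let bernstein_sqr n c y :
  (bernstein n (fun k => (k%:R - c) ^+ 2)).[y] = (n%:R * y - c) ^+ 2 + n%:R * y * (1 - y).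
Proof.
elim: n c => [|n IH] c; first by rewrite !hornerE/=; ring.
rewrite bernsteinSE IH (_ : (fun k => (k.+1%:R - c) ^+ 2) = (fun k => (k%:R - (c - 1)) ^+ 2)).
  by rewrite IH -natr1; ring.
by apply/funext => k; rewrite -natr1; ring.
Qed.

(** Bernstein's argument: the hypothesis bounds the deviation of u by a small error plus a quadratic
    one, whose binomial mean is O(1 / n). The nodes are k / (n + 1) at degree n because difference
    quotients of n + 2 values are also treated; the term 1 / (n + 1) allows for shifts by one
    node. *)
Lemma cvg_bernstein u y L : 0 <= y <= 1 ->
  (forall e, 0 < e -> exists K, forall n k, (k <= n)%N ->
     `|u n k - L| <= e + K * ((k%:R / n.+1%:R - y) ^+ 2 + n.+1%:R^-1)) ->
  (bernstein n (u n)).[y] @[n --> \oo] --> L.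
Proof.
move=> y01 uL; apply/cvgrPdist_le => e e0.
have e20 : 0 < e / 2 by rewrite divr_gt0.
have [K uK] := uL _ e20.
have bnd n : `|L - (bernstein n (u n)).[y]| <= e / 2 + 2 * `|K| * n.+1%:R^-1.
  have N0 : (0 : R) < n.+1%:R by rewrite ltr0n.
  have -> : L - (bernstein n (u n)).[y] = - (bernstein n (fun k => - L + 1 * u n k)).[y].
    by rewrite bernstein_lin; ring.
  rewrite normrN.
  pose a := e / 2 + `|K| * n.+1%:R^-1; pose b := `|K| / n.+1%:R ^+ 2.
  apply: le_trans (@bernstein_le n _ (fun k => a + b * (k%:R - n.+1%:R * y) ^+ 2) y y01 _) _.
    move=> k kn; rewrite mul1r addrC; apply: le_trans (uK n k kn) _.
    have -> : a + b * (k%:R - n.+1%:R * y) ^+ 2 =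
      e / 2 + `|K| * ((k%:R / n.+1%:R - y) ^+ 2 + n.+1%:R^-1).
      by rewrite /a /b; field; rewrite nat1r pnatr_eq0.
    rewrite lerD2l; apply: ler_wpM2r; last exact: ler_norm.
    by rewrite addr_ge0 ?sqr_ge0// invr_ge0.
  rewrite bernstein_lin bernstein_sqr /a -addrA lerD2l.
  have -> : 2 * `|K| / n.+1%:R = `|K| / n.+1%:R + b * n.+1%:R.
    by rewrite /b; field; rewrite nat1r pnatr_eq0.
  rewrite lerD2l; apply: ler_wpM2l; first by rewrite /b divr_ge0// exprn_ge0.
  have /andP[y0 y1] := y01; have n0 : 0 <= n%:R :> R by rewrite ler0n.
  rewrite -natr1; have := mulr_ge0 n0 y0; nra.
have c0 : 2 * `|K| * n.+1%:R^-1 @[n --> \oo] --> 0.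
  by rewrite -(mulr0 (2 * `|K|)); apply: cvgMr; exact: cvg_harmonic.
near=> n; apply: le_trans (bnd n) _.
have : 2 * `|K| * n.+1%:R^-1 <= e / 2.
  near: n; move/cvgrPdist_le : c0 => /(_ _ e20); apply: filterS => n.
  by rewrite sub0r normrN; apply: le_trans; exact: ler_norm.
by move=> h; rewrite [leRHS]splitr lerD2l.
Unshelve. all: by end_near. Qed.

(** Within the radius of continuity dl the error is at most e; outside, (x - y)^2 / dl^2 >= 1 and K
    = 2 M / dl^2 covers the trivial bound 2 M. *)
Lemma continuous_bernstein_modulus (f : R -> R) y M : 0 <= y <= 1 ->
  (forall x, 0 <= x <= 1 -> `|f x| <= M) -> {for y, continuous f} ->
  forall e, 0 < e -> exists2 K, 0 <= K & forall x, 0 <= x <= 1 ->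
    `|f x - f y| <= e + K * (x - y) ^+ 2.
Proof.
move=> y01 fM cf e e0.
have M0 : 0 <= M by exact: le_trans (normr_ge0 _) (fM y y01).
have := cf => /cvgrPdist_le/(_ _ e0)/nbhs_ballP[dl /= dl0 fd].
have K0 : 0 <= 2 * M / dl ^+ 2 by rewrite divr_ge0 ?sqr_ge0// mulr_ge0.
exists (2 * M / dl ^+ 2) => //.
move=> x x01; have [xd|dx] := ltP `|y - x| dl.
  have := fd x xd; rewrite distrC => /le_trans; apply.
  by rewrite lerDl mulr_ge0 ?sqr_ge0.
have h1 : `|f x - f y| <= 2 * M.
  by apply: le_trans (ler_normB _ _) _; have := fM x x01; have := fM y y01; lra.
apply: le_trans h1 _; rewrite -[leLHS]add0r; apply: lerD; first exact: ltW.
rewrite mulrAC ler_pdivlMr ?exprn_gt0//; apply: ler_wpM2l; first by rewrite mulr_ge0.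
by rewrite -real_normK ?num_real// -[leRHS]real_normK ?num_real// distrC ler_sqr ?nnegrE// (gtr0_norm dl0)//.
Qed.

End bernstein.

(** * From exponentials to bounded C^1 functions *)

Section laplace_to_C1.
Context d (T : measurableType d) (R : realType) (P : probability T R).
Variables (Q G : T -> R) (c : R).
Hypotheses (Q0 : forall w, 0 <= Q w) (iQ : L1 P Q) (iG : L1 P G).
Hypothesis QG : forall l, 0 <= l ->
  \int[P]_w ((Q w - c) * expR (- (l * Q w))) =
  2 * \int[P]_w (G w * (- l * expR (- (l * Q w)))).
Implicit Types f phi psi : R -> R.

(** The link between f and its derivative f' is left out of the definition, so that the two
    components can pass to the limit separately. *)
Definition stein_pair f (f' : R -> R) : Prop :=
  [/\ L1 P (fun w => (Q w - c) * f (Q w)), L1 P (fun w => G w * f' (Q w)) &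
   \int[P]_w ((Q w - c) * f (Q w)) = 2 * \int[P]_w (G w * f' (Q w))].

Let iQc : L1 P (fun w => Q w - c).
Proof. by apply: L1B => //; exact: finite_measure_integrable_cst. Qed.

Lemma stein_pair_exp l : 0 <= l ->
  stein_pair (fun q => expR (- (l * q))) (fun q => - l * expR (- (l * q))).
Proof.
move=> l0; have mQ := L1_measurable iQ; have mG := L1_measurable iG.
have mE : measurable_fun setT (fun w => expR (- (l * Q w))).
  apply: (measurableT_comp (f := fun x : R => expR x)).
    by apply: continuous_measurable_fun; exact: continuous_expR.
  by apply: measurableT_comp => //; apply: measurable_funM.
have E1 w : `|expR (- (l * Q w))| <= 1.
  by rewrite ger0_norm ?expR_ge0// expR_le1 oppr_le0 mulr_ge0.
split; last exact: QG.
- apply: (@L1_le _ _ _ P (fun w => `|Q w - c|)); first exact: L1_norm.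
    by apply: measurable_funM => //; exact: measurable_funB.
  by move=> w; rewrite normrM ler_piMr.
- apply: (@L1_le _ _ _ P (fun w => `|l| * `|G w|)).
  + by apply: L1Z; exact: L1_norm.
  + by apply: measurable_funM => //; exact: measurable_funM.
  + move=> w; rewrite normrM mulrC; apply: ler_wpM2r => //.
    by rewrite normrM normrN ler_piMr.
Qed.

Lemma stein_pair_lin a f (f' : R -> R) g g' : stein_pair f f' -> stein_pair g g' ->
  stein_pair (fun q => a * f q + g q) (fun q => a * f' q + g' q).
Proof.
move=> [i1 i2 e1] [i3 i4 e2].
have E1 w : (Q w - c) * (a * f (Q w) + g (Q w)) =
  a * ((Q w - c) * f (Q w)) + (Q w - c) * g (Q w) by ring.
have E2 w : G w * (a * f' (Q w) + g' (Q w)) = a * (G w * f' (Q w)) + G w * g' (Q w).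
  by ring.
split.
- by rewrite (funext E1); apply: L1D => //; exact: L1Z.
- by rewrite (funext E2); apply: L1D => //; exact: L1Z.
- under eq_Rintegral do rewrite E1.
  under [in RHS]eq_Rintegral do rewrite E2.
  rewrite !IntD//; [|exact: L1Z..].
  by rewrite !IntZ// e1 e2; ring.
Qed.

Lemma stein_pair_sum n (a : nat -> R) (f f' : nat -> R -> R) :
  (forall i, stein_pair (f i) (f' i)) ->
  stein_pair (fun q => \sum_(i < n) a i * f i q) (fun q => \sum_(i < n) a i * f' i q).
Proof.
move=> S; elim: n => [|n IH].
  have := stein_pair_lin (-1) (S 0%N) (S 0%N); congr stein_pair;
  by apply/funext => q; rewrite big_ord0; ring.
have := stein_pair_lin (a n) (S n) IH; congr stein_pair;
by apply/funext => q; rewrite big_ord_recr addrC.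
Qed.

(** In the variable y = exp (- e q) the monomial y^i is the exponential of parameter i e. *)
Lemma stein_pair_poly e (p : {poly R}) : 0 <= e ->
  stein_pair (fun q => p.[expR (- (e * q))])
    (fun q => - e * expR (- (e * q)) * (p^`()).[expR (- (e * q))]).
Proof.
move=> e0; have S i := @stein_pair_exp (i%:R * e) (mulr_ge0 (ler0n _ i) e0).
have Ei i q : expR (- (i%:R * e * q)) = expR (- (e * q)) ^+ i.
  by rewrite -expRM_natl; congr expR; ring.
have := stein_pair_sum (size p) (fun i => p`_i) S; congr stein_pair; apply/funext => q.
  rewrite horner_coef; apply: eq_bigr => i _; by rewrite Ei.
rewrite -[in RHS](coefK p) poly_def raddf_sum/= horner_sum mulr_sumr.
apply: eq_bigr => i _; rewrite Ei derivZ derivXn hornerZ hornerMn hornerXn.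
case: (nat_of_ord i) => [|k] /=; first by rewrite mulr0n expr0; ring.
by rewrite exprS -mulr_natl; ring.
Qed.

Lemma stein_pair_lim (f_ f'_ : nat -> R -> R) f f' M :
  (forall n, stein_pair (f_ n) (f'_ n)) ->
  (forall n q, 0 <= q -> `|f_ n q| <= M /\ `|f'_ n q| <= M) ->
  (forall q, 0 <= q -> f_ n q @[n --> \oo] --> f q /\ f'_ n q @[n --> \oo] --> f' q) ->
  stein_pair f f'.
Proof.
move=> S bM cf.
have [i1 l1] : L1 P (fun w => (Q w - c) * f (Q w)) /\
    \int[P]_w ((Q w - c) * f_ n (Q w)) @[n --> \oo] --> \int[P]_w ((Q w - c) * f (Q w)).
  apply: (L1_dct (g := fun w => M * `|Q w - c|)).
  - by apply: L1Z; exact: L1_norm.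
  - by move=> n; have [/L1_measurable] := S n.
  - by move=> n w; rewrite normrM mulrC; apply: ler_wpM2r => //; have [] := bM n _ (Q0 w).
  - by move=> w; apply: cvgMr; have [] := cf _ (Q0 w).
have [i2 l2] : L1 P (fun w => G w * f' (Q w)) /\
    \int[P]_w (G w * f'_ n (Q w)) @[n --> \oo] --> \int[P]_w (G w * f' (Q w)).
  apply: (L1_dct (g := fun w => M * `|G w|)).
  - by apply: L1Z; exact: L1_norm.
  - by move=> n; have [_ /L1_measurable] := S n.
  - by move=> n w; rewrite normrM mulrC; apply: ler_wpM2r => //; have [] := bM n _ (Q0 w).
  - by move=> w; apply: cvgMr; have [] := cf _ (Q0 w).
split => //.
have l3 : \int[P]_w ((Q w - c) * f_ n (Q w)) @[n --> \oo] --> 2 * \int[P]_w (G w * f' (Q w)).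
  have e n : \int[P]_w ((Q w - c) * f_ n (Q w)) = 2 * \int[P]_w (G w * f'_ n (Q w)).
    by have [] := S n.
  by under eq_fun do rewrite e; apply: cvgMr.
exact: (cvg_unique _ l1 l3).
Qed.

(** Bernstein polynomials of psi converge together with their derivatives. Continuity of psi' is
    asked on ]0, 1] alone, since exp (- e q) never reaches 0. *)
Lemma stein_pair_C1_exp e psi psi' M : 0 < e ->
  (forall y : R, is_derive y 1 psi (psi' y)) ->
  (forall y : R, 0 <= y <= 1 -> `|psi' y| <= M) -> (forall y : R, 0 <= y <= 1 -> `|psi y| <= M) ->
  (forall y : R, 0 < y <= 1 -> {for y, continuous psi'}) ->
  stein_pair (fun q => psi (expR (- (e * q))))
    (fun q => - e * expR (- (e * q)) * psi' (expR (- (e * q)))).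
Proof.
move=> e0 dpsi bM' bM cpsi'.
have cpsi := is_derive_continuous dpsi.
have M0 : 0 <= M by apply: le_trans (bM 0 _) => //; rewrite lexx ler01.
pose g n k := psi (k%:R / n.+1%:R).
pose u n k := n.+1%:R * (g n k.+1 - g n k).
have Npos n : (0 : R) < n.+1%:R by rewrite ltr0n.
have in01 n k : (k <= n.+1)%N -> 0 <= (k%:R / n.+1%:R : R) <= 1.
  by move=> kn; apply/andP; split; [exact: divr_ge0|rewrite ler_pdivrMr// mul1r ler_nat].
(* The coefficients of the derivative are difference quotients of psi, hence values of psi' within 1
   / (n + 1) of the node. *)
have uE n k : (k <= n)%N -> exists2 xi, u n k = psi' xi &
    0 <= xi <= 1 /\ `|xi - k%:R / n.+1%:R| <= n.+1%:R^-1.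
  move=> kn; have lt : (k%:R / n.+1%:R : R) < k.+1%:R / n.+1%:R.
    by rewrite ltr_pM2r ?invr_gt0// ltr_nat.
  have cw := @continuous_subspaceT _ _ `[k%:R / n.+1%:R : R, k.+1%:R / n.+1%:R] _ cpsi.
  have [xi xiI xiE] := MVT lt (fun x _ => dpsi x) cw.
  move: xiI; rewrite in_itv/= => /andP[x1 x2].
  have /andP[a0 a1] := in01 n k (leqW kn).
  have /andP[b0 b1] := in01 n k.+1 kn.
  exists xi.
    rewrite /u /g xiE -[k.+1%:R]natr1; field.
    by rewrite nat1r pnatr_eq0.
  split; first by apply/andP; split; [exact: le_trans a0 (ltW x1)|exact: le_trans (ltW x2) b1].
  rewrite ger0_norm; last by rewrite subr_ge0 ltW.
  have kE : k.+1%:R / n.+1%:R = k%:R / n.+1%:R + n.+1%:R^-1 :> R.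
    by rewrite -[k.+1%:R]natr1 mulrDl mul1r.
  by rewrite lerBlDl -kE ltW.
have eE q : 0 <= q -> 0 < expR (- (e * q)) <= 1.
  by move=> q0; rewrite expR_gt0 expR_le1 oppr_le0 mulr_ge0// ltW.
have Ein q : 0 <= q -> 0 <= expR (- (e * q)) <= 1 by move=> /eE/andP[/ltW -> ->].
have dE n y : (bernstein n.+1 (g n))^`().[y] = (bernstein n (u n)).[y].
  by rewrite deriv_bernstein hornerZ -bernsteinZ.
have u_bnd n k : (k <= n)%N -> `|u n k| <= M by move=> /uE[xi -> [/bM']].
have cvg_psi y : 0 <= y <= 1 -> (bernstein n.+1 (g n)).[y] @[n --> \oo] --> psi y.
  move=> y01.
  (* One step of the recursion turns degree n + 1 into two sequences of degree n, with nodes k / (n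
     + 1) and (k + 1) / (n + 1). *)
  under eq_fun do rewrite bernsteinSE.
  rewrite (_ : psi y = (1 - y) * psi y + y * psi y); last by ring.
  have mod := continuous_bernstein_modulus y01 bM (@cpsi y).
  apply: cvgD; apply: cvgMr; apply: cvg_bernstein => // e1 e10.
    have [K K0 Kf] := mod _ e10; exists K => n k kn.
    apply: le_trans (Kf _ (in01 _ _ (leqW kn))) _.
    by rewrite lerD2l ler_wpM2l// lerDl invr_ge0.
  have [K K0 Kf] := mod _ e10; exists (2 * K) => n k kn.
  apply: le_trans (Kf _ (in01 _ _ _)) _; first by [].
  rewrite lerD2l (mulrC 2) -mulrA; apply: ler_wpM2l => //.
  have -> : k.+1%:R / n.+1%:R = k%:R / n.+1%:R + n.+1%:R^-1 :> R by rewrite -[k.+1%:R]natr1 mulrDl mul1r.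
  have n0 : 0 < n.+1%:R^-1 :> R by rewrite invr_gt0.
  have n1 : n.+1%:R^-1 <= 1 :> R by rewrite invf_le1// ler1n.
  rewrite addrAC; move: (k%:R / n.+1%:R - y) => x; move: (n.+1%:R^-1) n0 n1 => z z0 z1.
  have zz : z ^+ 2 <= z by rewrite expr2; apply: ler_piMr => //; exact: ltW.
  have := sqr_ge0 (x - z); nra.
have cvg_psi' y : 0 < y <= 1 -> (bernstein n (u n)).[y] @[n --> \oo] --> psi' y.
  move=> y01; have y01' : 0 <= y <= 1 by case/andP: y01 => /ltW -> ->.
  have mod := continuous_bernstein_modulus y01' bM' (cpsi' y y01).
  apply: cvg_bernstein => // e1 e10.
  have [K K0 Kf] := mod _ e10; exists (2 * K) => n k kn.
  have [xi -> [xi01 xik]] := uE n k kn.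
  apply: le_trans (Kf _ xi01) _.
  rewrite lerD2l (mulrC 2) -mulrA; apply: ler_wpM2l => //.
  have n0 : 0 < n.+1%:R^-1 :> R by rewrite invr_gt0.
  have n1 : n.+1%:R^-1 <= 1 :> R by rewrite invf_le1// ler1n.
  have x2 : (xi - k%:R / n.+1%:R) ^+ 2 <= n.+1%:R^-1 ^+ 2.
    by rewrite -real_normK ?num_real// ler_sqr// nnegrE ltW.
  move: (k%:R / n.+1%:R) x2 => x; move: (n.+1%:R^-1) n0 n1 => z z0 z1 x2.
  have zz : z ^+ 2 <= z by rewrite expr2; apply: ler_piMr => //; exact: ltW.
  have := sqr_ge0 (x - y - (xi - x)); nra.
apply: (@stein_pair_lim (fun n q => (bernstein n.+1 (g n)).[expR (- (e * q))])
  (fun n q => - e * expR (- (e * q)) * (bernstein n.+1 (g n))^`().[expR (- (e * q))]) _ _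
  (M + e * M)).
- by move=> n; apply: stein_pair_poly; exact: ltW.
- move=> n q q0; have y01 := Ein _ q0; split.
    apply: (@le_trans _ _ M); last by rewrite lerDl mulr_ge0// ltW.
    apply: le_trans (@bernstein_le R n.+1 (g n) (fun k => M + 0 * 1) _ y01 _) _.
      by move=> k kn; rewrite mul0r addr0; apply: bM; exact: in01.
    by rewrite bernstein_lin mul0r addr0.
  rewrite dE normrM normrM normrN (gtr0_norm e0) (ger0_norm (expR_ge0 _)).
  apply: (@le_trans _ _ (e * M)); last by rewrite lerDr.
  rewrite -mulrA; apply: ler_wpM2l; first exact: ltW.
  apply: (@le_trans _ _ (1 * M)); last by rewrite mul1r.
  case/andP: y01 => y0 y1; apply: ler_pM => //.
  apply: le_trans (@bernstein_le R n (u n) (fun k => M + 0 * 1) _ _ _) _.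
  + by rewrite y0.
  + by move=> k kn; rewrite mul0r addr0; exact: u_bnd.
  + by rewrite bernstein_lin mul0r addr0.
- move=> q q0; split; first exact: cvg_psi (Ein _ q0).
  by apply: cvgMr; under eq_fun do rewrite dE; exact: cvg_psi' (eE _ q0).
Qed.

(* The factor exp (- 2 e q) makes the transported function C1 at y = exp (- e q) = 0. *)
Lemma stein_pair_damped e phi phi' A : 0 < e -> 0 <= A ->
  (forall x : R, is_derive x 1 phi (phi' x)) -> continuous phi' ->
  (forall x, `|phi x| <= A) -> (forall x, `|phi' x| <= A) ->
  stein_pair (fun q => expR (- (e * q)) ^+ 2 * phi q)
    (fun q => expR (- (e * q)) ^+ 2 * (phi' q - 2 * e * phi q)).
Proof.
move=> e0 A0 dphi cphi' bphi bphi'.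
(* q = - ln y / e inverts y = exp (- e q). The square gives |psi y| <= A y^2, whence derivative 0 at
   y = 0. *)
pose psi (y : R) := if 0 < y then y ^+ 2 * phi (- (ln y / e)) else 0.
pose psi' (y : R) := if 0 < y then
  2 * y * phi (- (ln y / e)) - y * (phi' (- (ln y / e)) / e) else 0.
have dpsi (y : R) : is_derive y 1 psi (psi' y).
  have [y0|y0|<-] := ltgtP 0 y.
  - have dln := is_derive1_ln y0.
    apply: (@near_eq_is_derive R R^o R^o (fun y : R => y ^+ 2 * phi (- (ln y / e)))).
      by near=> z; rewrite /psi ifT//; near: z; exact: lt_nbhsr.
    have dp := dphi (- (ln y / e)).
    rewrite /psi' y0; apply: is_derive_eq; rewrite -![_ *: _]/(_ * _)/=; field.
    by rewrite !gt_eqF.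
  - apply: (@near_eq_is_derive R R^o R^o (cst (0 : R))).
      by near=> z; rewrite /psi ifF//; apply/negbTE; rewrite -leNgt ltW//; near: z; exact: lt_nbhsl.
    by rewrite /psi' ltNge (ltW y0)/=; exact: is_derive_cst.
  - apply: (@is_derive_quadratic R _ _ _ A) => h.
    rewrite /psi /psi' ltxx mulr0 add0r !subr0.
    case: ifP => _; last by rewrite normr0 mulr_ge0// sqr_ge0.
    by rewrite normrM mulrC (ger0_norm (sqr_ge0 _)) ler_wpM2r ?sqr_ge0.
have cpsi' (y : R) : 0 < y <= 1 -> {for y, continuous psi'}.
  move=> /andP[y0 _].
  have cl : {for y, continuous (fun y : R => - (ln y / e))}.
    by apply: cvgN; apply: cvgMl; exact: continuous_ln.
  have cphi := is_derive_continuous dphi.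
  have c1 : {for y, continuous (fun y : R => 2 * y * phi (- (ln y / e)) - y * (phi' (- (ln y / e)) / e))}.
    apply: cvgB; apply: cvgM.
    - by apply: cvgMr; exact: cvg_id.
    - by apply: (continuous_comp cl); exact: cphi.
    - exact: cvg_id.
    - by apply: cvgMl; apply: (continuous_comp cl); exact: cphi'.
  have e1 : psi' y = 2 * y * phi (- (ln y / e)) - y * (phi' (- (ln y / e)) / e).
    by rewrite /psi' y0.
  change (psi' x @[x --> y] --> psi' y); rewrite e1; apply: cvg_trans c1; apply: near_eq_cvg.
  by near=> z; rewrite /psi' ifT//; near: z; exact: lt_nbhsr.
pose M := 2 * A + A / e + A.
have Ae : 0 <= A / e by rewrite divr_ge0// ltW.
have b1 (y : R) : 0 <= y <= 1 -> `|psi' y| <= M.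
  move=> /andP[y0 y1]; rewrite /psi' /M; case: ifP => _; last by rewrite normr0; lra.
  apply: le_trans (ler_normB _ _) _; rewrite !normrM normr_nat (ger0_norm y0).
  rewrite (ger0_norm (x := e^-1)); last by rewrite invr_ge0 ltW.
  have h1 : 2 * y * `|phi (- (ln y / e))| <= 2 * A.
    by rewrite -mulrA; apply: ler_wpM2l => //; rewrite -[leRHS]mul1r ler_pM.
  have h2 : y * (`|phi' (- (ln y / e))| / e) <= A / e.
    rewrite mulrA ler_wpM2r ?invr_ge0 ?(ltW e0)//.
    by rewrite -[leRHS]mul1r ler_pM.
  by apply: le_trans (lerD h1 h2) _; rewrite lerDl.
have b2 (y : R) : 0 <= y <= 1 -> `|psi y| <= M.
  move=> /andP[y0 y1]; rewrite /psi /M; case: ifP => _; last by rewrite normr0; lra.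
  rewrite normrM (ger0_norm (sqr_ge0 _)).
  have : y ^+ 2 * `|phi (- (ln y / e))| <= A.
    by rewrite -[leRHS]mul1r ler_pM ?sqr_ge0// expr_le1.
  lra.
have := stein_pair_C1_exp e0 dpsi b1 b2 cpsi'; congr stein_pair; apply/funext => q;
  have lnE : - (ln (expR (- (e * q))) / e) = q.
- by rewrite expRK mulNr opprK mulrAC mulfV ?mul1r// gt_eqF.
- by rewrite /psi expR_gt0 lnE.
- by rewrite expRK mulNr opprK mulrAC mulfV ?mul1r// gt_eqF.
- by rewrite /psi' expR_gt0 lnE; field; rewrite gt_eqF.
Unshelve. all: by end_near. Qed.

(** The damping parameter e = 1 / (n + 1) tends to 0; as e <= 1, 3 A bounds |phi'| + 2 e |phi|
    throughout. *)
Lemma stein_pair_C1 phi phi' A :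
  (forall x : R, is_derive x 1 phi (phi' x)) -> continuous phi' ->
  (forall x, `|phi x| <= A) -> (forall x, `|phi' x| <= A) -> stein_pair phi phi'.
Proof.
move=> dphi cphi' bphi bphi'.
have A0 : 0 <= A by exact: le_trans (normr_ge0 _) (bphi 0).
have n0 n : 0 < n.+1%:R^-1 :> R by rewrite invr_gt0.
apply: (stein_pair_lim (fun n => stein_pair_damped (n0 n) A0 dphi cphi' bphi bphi') (M := 3 * A)).
- move=> n q q0; set E := expR _ ^+ 2.
  have E1 : `|E| <= 1.
    by rewrite /E normrX exprn_ile1// ger0_norm ?expR_ge0// expR_le1 oppr_le0 mulr_ge0// invr_ge0.
  split; rewrite normrM -[leRHS]mul1r; apply: ler_pM => //.
    by apply: le_trans (bphi q) _; lra.
  apply: le_trans (ler_normB _ _) _; rewrite !normrM normr_nat.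
  have n1 : `|n.+1%:R^-1| <= 1 :> R by rewrite ger0_norm ?invr_ge0// invf_le1// ler1n.
  have : `|n.+1%:R^-1| * `|phi q| <= A by rewrite -[leRHS]mul1r ler_pM.
  by have := bphi' q; rewrite -mulrA; lra.
- move=> q q0.
  have h0 (x : R) : x / n.+1%:R @[n --> \oo] --> 0.
    by rewrite -(mulr0 x); apply: cvgMr; exact: cvg_harmonic.
  have E1 : expR (- (n.+1%:R^-1 * q)) ^+ 2 @[n --> \oo] --> (1 : R).
    have E0 : expR (- (n.+1%:R^-1 * q)) @[n --> \oo] --> (1 : R).
      rewrite -[X in _ --> X]expR0; apply: continuous_cvg; first exact: continuous_expR.
      by rewrite -[X in _ --> X]oppr0; apply: cvgN; under eq_fun do rewrite mulrC; exact: h0.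
    by rewrite -[X in _ --> X]mulr1; exact: (cvgM E0 E0).
  split.
    by rewrite -[X in _ --> X]mul1r; apply: cvgM => //; exact: cvg_cst.
  rewrite -[X in _ --> X]mul1r; apply: cvgM => //.
  rewrite -[X in _ --> X]subr0; apply: cvgB; first exact: cvg_cst.
  by under eq_fun do rewrite mulrAC; exact: h0.
Qed.

End laplace_to_C1.

(** * Fourth moments *)

Section matrix_sums.
Context (R : realType) (k : nat).
Implicit Types (p b : 'I_k -> R) (S : 'I_k -> 'I_k -> R).

(** Expansion of the nonnegative double sum of p_i p_j (b_i - b_j)^2. *)
Lemma weighted_cauchy_schwarz p b : (forall j, 0 <= p j) ->
  (\sum_j p j * b j) ^+ 2 <= (\sum_j p j) * \sum_j p j * b j ^+ 2.
Proof.
move=> p0.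
have : 0 <= \sum_i \sum_j p i * p j * (b i - b j) ^+ 2.
  by apply: sumr_ge0 => i _; apply: sumr_ge0 => j _; rewrite mulr_ge0 ?sqr_ge0// mulr_ge0.
have -> : \sum_i \sum_j p i * p j * (b i - b j) ^+ 2 =
    \sum_i \sum_j ((p j * (p i * b i ^+ 2) + p i * (p j * b j ^+ 2))
       - 2 * (p i * b i * (p j * b j))).
  by apply: eq_bigr => i _; apply: eq_bigr => j _; ring.
have -> : \sum_i \sum_j ((p j * (p i * b i ^+ 2) + p i * (p j * b j ^+ 2))
       - 2 * (p i * b i * (p j * b j))) =
    2 * ((\sum_j p j) * \sum_j p j * b j ^+ 2) - 2 * (\sum_j p j * b j) ^+ 2.
  transitivity (\sum_i ((\sum_j p j) * (p i * b i ^+ 2) + p i * (\sum_j p j * b j ^+ 2)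
      - 2 * (p i * b i * (\sum_j p j * b j)))).
    apply: eq_bigr => i _; rewrite sumrB big_split/= -mulr_suml -mulr_sumr.
    by rewrite -mulr_sumr -mulr_sumr.
  rewrite sumrB big_split/= -mulr_sumr -mulr_suml -mulr_sumr -mulr_suml; ring.
lra.
Qed.

(* The maximal row sum bounds the operator norm of the symmetric matrix S. *)
Lemma sum_sqr_mul_le S (rho : R) : (forall i j, S i j = S j i) ->
  (forall i, \sum_j `|S i j| <= rho) ->
  \sum_i \sum_l (\sum_j S i j * S j l) ^+ 2 <= rho ^+ 2 * \sum_i \sum_j S i j ^+ 2.
Proof.
move=> symS rowS.
have [k0|k0] := posnP k.
  have n0 (i : 'I_k) : False by move: i; rewrite k0 => -[].
  by rewrite !big1 ?mulr0// => i; case: (n0 i).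
have rho0 : 0 <= rho by apply: le_trans (rowS (Ordinal k0)); apply: sumr_ge0.
(* Cauchy-Schwarz with weights |S_ij| costs one row sum here; the sum over i left at the end is a
   second row sum, by symmetry. *)
apply: (@le_trans _ _ (\sum_i \sum_l rho * \sum_j `|S i j| * S j l ^+ 2)).
  apply: ler_sum => i _; apply: ler_sum => l _.
  apply: (@le_trans _ _ ((\sum_j `|S i j| * `|S j l|) ^+ 2)).
    rewrite -real_normK ?num_real// ler_sqr ?nnegrE//; last first.
      by apply: sumr_ge0 => j _; rewrite mulr_ge0.
    apply: le_trans (ler_norm_sum _ _ _) _; apply: ler_sum => j _.
    by rewrite normrM.
  apply: le_trans (weighted_cauchy_schwarz _ _) _ => //.
  apply: ler_pM => //; [exact: sumr_ge0| |].
    by apply: sumr_ge0 => j _; rewrite mulr_ge0 ?sqr_ge0.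
  by apply: ler_sum => j _; rewrite real_normK ?num_real.
have -> : \sum_i \sum_l rho * \sum_j `|S i j| * S j l ^+ 2 =
    rho * \sum_j \sum_l S j l ^+ 2 * \sum_i `|S j i|.
  rewrite [RHS]mulr_sumr; under eq_bigr do under eq_bigr do rewrite mulr_sumr.
  under eq_bigr do rewrite exchange_big/=.
  rewrite exchange_big/=; apply: eq_bigr => j _; rewrite exchange_big mulr_sumr/=.
  apply: eq_bigr => l _; rewrite !mulr_sumr; apply: eq_bigr => i _.
  by rewrite (symS i j); ring.
rewrite expr2 -mulrA; apply: ler_wpM2l => //; rewrite mulr_sumr.
apply: ler_sum => j _; rewrite mulr_sumr; apply: ler_sum => l _.
by rewrite mulrC; apply: ler_wpM2r; rewrite ?sqr_ge0.
Qed.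

End matrix_sums.

Section fourth_moments.
Context d (T : measurableType d) (R : realType) (P : probability T R).
Variable H : (T -> R) -> Prop.
Hypothesis Hfacts : forall Z, H Z -> gaussian_facts P Z.
Hypothesis Hlin : forall (a b : R) Y Z, H Y -> H Z -> H (fun w => a * Y w + b * Z w).
Local Notation cov := (cov P).

Let L12 := H_L1_2 Hfacts.
Let L14 := H_L1_4 Hfacts.

(** Polarization: the product is a signed sum of fourth powers of Y1 + b Y2 + c Y3 + e Y4 over the
    eight choices of signs, each of which contains Y1 Y2 Y3 Y4 with coefficient 24 up to sign; hence
    the constant 192, which is 8 times 24. *)
Lemma wick4 Y1 Y2 Y3 Y4 : H Y1 -> H Y2 -> H Y3 -> H Y4 ->
  \int[P]_w (Y1 w * Y2 w * Y3 w * Y4 w) =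
  cov Y1 Y2 * cov Y3 Y4 + cov Y1 Y3 * cov Y2 Y4 + cov Y1 Y4 * cov Y2 Y3.
Proof.
move=> H1 H2 H3 H4.
pose Z b c e w := (1 * (1 * Y1 w + b * Y2 w) + 1 * (c * Y3 w + e * Y4 w)) : R.
have HZ b c e : H (Z b c e) by apply: Hlin; apply: Hlin.
have covlin a b Y Y' U : H Y -> H Y' -> H U ->
    cov U (fun w => a * Y w + b * Y' w) = a * cov U Y + b * cov U Y'.
  by move=> ? ? ?; exact: (cov_lin Hfacts).
have covC' U V : cov U V = cov V U by exact: covC.
have covZ b c e U : H U -> cov U (Z b c e) = cov U Y1 + b * cov U Y2 + c * cov U Y3 + e * cov U Y4.
  move=> HU; rewrite /Z covlin//; [|exact: Hlin|exact: Hlin].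
  by rewrite !covlin//; ring.
have E4 b c e : \int[P]_w (Z b c e w ^+ 4) = 3 * (cov (Z b c e) (Z b c e)) ^+ 2.
  by have [_ _ -> _] := Hfacts (HZ b c e); congr (_ * _ ^+ 2); apply: eq_Rintegral => w _.
have iZ b c e : L1 P (fun w => Z b c e w ^+ 4) by have [] := Hfacts (HZ b c e).
have pol w : Y1 w * Y2 w * Y3 w * Y4 w = 192^-1 *
    ((Z 1 1 1 w ^+ 4 - Z (-1) 1 1 w ^+ 4) - (Z 1 (-1) 1 w ^+ 4 - Z (-1) (-1) 1 w ^+ 4)
    - ((Z 1 1 (-1) w ^+ 4 - Z (-1) 1 (-1) w ^+ 4) - (Z 1 (-1) (-1) w ^+ 4 - Z (-1) (-1) (-1) w ^+ 4))).
  by rewrite /Z; field.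
under eq_Rintegral do rewrite pol.
rewrite IntZ; last by do ?[exact: iZ | apply: L1B].
rewrite !IntB; do ?[exact: iZ | apply: L1B].
have covZZ b c e : cov (Z b c e) (Z b c e) =
    (cov Y1 Y1 + b * cov Y1 Y2 + c * cov Y1 Y3 + e * cov Y1 Y4) +
    b * (cov Y1 Y2 + b * cov Y2 Y2 + c * cov Y2 Y3 + e * cov Y2 Y4) +
    c * (cov Y1 Y3 + b * cov Y2 Y3 + c * cov Y3 Y3 + e * cov Y3 Y4) +
    e * (cov Y1 Y4 + b * cov Y2 Y4 + c * cov Y3 Y4 + e * cov Y4 Y4).
  rewrite covZ// ![cov (Z b c e) _]covC' !covZ//.
  by rewrite (covC' Y2 Y1) (covC' Y3 Y1) (covC' Y4 Y1) (covC' Y3 Y2) (covC' Y4 Y2) (covC' Y4 Y3).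
rewrite !E4 !covZZ.
by field.
Qed.

Variables (k : nat) (Y : 'I_k -> T -> R).
Hypothesis HY : forall i, H (Y i).
Let S i j := cov (Y i) (Y j).
Let symS i j : S i j = S j i. Proof. exact: covC. Qed.

(** This is tr S^2, by symmetry of S. It is both half the variance of [sqnorm] and the mean of
    [covform]. *)
Definition cov_frob2 : R := \sum_i \sum_j cov (Y i) (Y j) ^+ 2.

Let quad (N : 'I_k -> 'I_k -> R) w := \sum_i \sum_j N i j * (Y i w * Y j w).

Let L1_quad N : L1 P (quad N).
Proof. by apply: L1_sum => i _; apply: L1_sum => j _; apply: L1Z; exact: L12. Qed.

Let Int_quad N : \int[P]_w quad N w = \sum_i \sum_j N i j * S i j.
Proof.
rewrite Int_sum; last by move=> i _; apply: L1_sum => j _; apply: L1Z; exact: L12.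
apply: eq_bigr => i _; rewrite Int_sum; last by move=> j _; apply: L1Z; exact: L12.
by apply: eq_bigr => j _; rewrite IntZ//; exact: L12.
Qed.

Let quad_sqr N w : quad N w ^+ 2 =
  \sum_i \sum_j \sum_l \sum_m N i j * N l m * (Y i w * Y j w * Y l w * Y m w).
Proof.
rewrite expr2 /quad big_distrl; apply: eq_bigr => i _ /=.
rewrite big_distrl; apply: eq_bigr => j _ /=.
rewrite big_distrr; apply: eq_bigr => l _ /=.
rewrite big_distrr; apply: eq_bigr => m _ /=; ring.
Qed.

Let L1_quad2 N : L1 P (fun w => quad N w ^+ 2).
Proof.
rewrite (funext (quad_sqr N)).
by do 4 (apply: L1_sum => ? _); apply: L1Z; apply: L14.
Qed.

(** Of the three Wick pairings the first gives the squared mean e^2 and the other two agree by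
    symmetry of N, so that the variance is 2 tr (N S N S). *)
Let var_quad N (e := \sum_i \sum_j N i j * S i j) : (forall i j, N i j = N j i) ->
  \int[P]_w ((quad N w - e) ^+ 2) =
  2 * \sum_i \sum_j \sum_l \sum_m N i j * N l m * (S i l * S j m).
Proof.
move=> symN.
have i2 := L1_quad2 N; have i1 := L1_quad N.
have ic : L1 P (fun=> e ^+ 2) by exact: finite_measure_integrable_cst.
transitivity (\int[P]_w (quad N w ^+ 2 - 2 * e * quad N w + e ^+ 2)).
  by apply: eq_Rintegral => w _; ring.
rewrite IntD//; last by apply: L1B => //; exact: L1Z.
rewrite IntB//; last exact: L1Z.
have intc : \int[P]_w (fun=> e ^+ 2) w = e ^+ 2.
  by rewrite Rintegral_cst//= -[RHS]mulr1; congr (_ * _);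
  exact: (congr1 fine (probability_setT P)).
rewrite IntZ// Int_quad -/e intc.
under eq_Rintegral do rewrite quad_sqr.
have -> : \int[P]_x (\sum_i \sum_j \sum_l \sum_m N i j * N l m * (Y i x * Y j x * Y l x * Y m x)) =
    \sum_i \sum_j \sum_l \sum_m N i j * N l m * (S i j * S l m + S i l * S j m + S i m * S j l).
  do 4 (rewrite Int_sum; [apply: eq_bigr => ? _|
    by move=> ? _; do ?[exact: L14 | apply: L1Z | apply: L1_sum => ? _]]).
  by rewrite IntZ ?wick4//; exact: L14.
have -> : \sum_i \sum_j \sum_l \sum_m N i j * N l m * (S i j * S l m + S i l * S j m + S i m * S j l) =
    e ^+ 2 + \sum_i \sum_j \sum_l \sum_m N i j * N l m * (S i l * S j m)
    + \sum_i \sum_j \sum_l \sum_m N i j * N l m * (S i m * S j l).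
  rewrite expr2 {1}/e big_distrl/= -!big_split/=; apply: eq_bigr => i _.
  rewrite big_distrl/= -!big_split/=; apply: eq_bigr => j _.
  rewrite big_distrr/= -!big_split/=; apply: eq_bigr => l _.
  rewrite big_distrr/= -!big_split/=; apply: eq_bigr => m _; ring.
have -> : \sum_i \sum_j \sum_l \sum_m N i j * N l m * (S i m * S j l) =
    \sum_i \sum_j \sum_l \sum_m N i j * N l m * (S i l * S j m).
  apply: eq_bigr => i _; apply: eq_bigr => j _; rewrite exchange_big/=.
  by apply: eq_bigr => l _; apply: eq_bigr => m _; rewrite (symN m l).
by ring.
Qed.

Let sqnormE w : sqnorm Y w = quad (fun i j => (i == j)%:R) w.
Proof.
apply: eq_bigr => i _; rewrite (bigD1 i)//= big1 ?addr0 ?eqxx ?mul1r//.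
by move=> j ji; rewrite eq_sym (negbTE ji) mul0r.
Qed.

Let covtraceE : covtrace P Y = \sum_i \sum_j (i == j)%:R * S i j.
Proof.
apply: eq_bigr => i _; rewrite (bigD1 i)//= big1 ?addr0 ?eqxx ?mul1r//.
by move=> j ji; rewrite eq_sym (negbTE ji) mul0r.
Qed.

Lemma var_sqnorm : \int[P]_w ((sqnorm Y w - covtrace P Y) ^+ 2) = 2 * cov_frob2.
Proof.
under eq_Rintegral do rewrite sqnormE covtraceE.
rewrite var_quad; last by move=> i j; rewrite eq_sym.
congr (_ * _); apply: eq_bigr => i _.
rewrite (bigD1 i)//= [X in _ + X]big1 ?addr0; last first.
  move=> j ji; apply: big1 => l _; apply: big1 => m _.
  by rewrite eq_sym (negbTE ji) !mul0r.
apply: eq_bigr => l _; rewrite (bigD1 l)//= big1 ?addr0; last first.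
  by move=> m ml; rewrite [l == m]eq_sym (negbTE ml) mulr0 mul0r.
by rewrite !eqxx !mul1r.
Qed.

Lemma L1_covform_sqr : L1 P (fun w => (covform P Y w - cov_frob2) ^+ 2).
Proof.
have -> : (fun w => (covform P Y w - cov_frob2) ^+ 2) =
    (fun w => quad S w ^+ 2 - 2 * cov_frob2 * quad S w + cov_frob2 ^+ 2).
  by apply/funext => w; rewrite /covform /quad; ring.
apply: L1D; last exact: finite_measure_integrable_cst.
by apply: L1B; [exact: L1_quad2|apply: L1Z; exact: L1_quad].
Qed.

(** [var_quad] with N = S gives 2 tr S^4, and tr S^4 is the sum of the squared entries of S^2. *)
Lemma var_covform_le (rho : R) : (forall i, \sum_j `|cov (Y i) (Y j)| <= rho) ->
  \int[P]_w ((covform P Y w - cov_frob2) ^+ 2) <= 2 * (rho ^+ 2 * cov_frob2).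
Proof.
move=> rowS.
have -> : cov_frob2 = \sum_i \sum_j S i j * S i j.
  by apply: eq_bigr => i _; apply: eq_bigr => j _; rewrite expr2.
rewrite var_quad//; apply: ler_wpM2l => //.
apply: le_trans (_ : \sum_i \sum_l (\sum_j S i j * S j l) ^+ 2 <= _); last first.
  apply: le_trans (sum_sqr_mul_le symS rowS) _.
  by under eq_bigr do under eq_bigr do rewrite expr2.
rewrite le_eqVlt; apply/orP; left; apply/eqP.
apply: eq_bigr => i _; under eq_bigr do rewrite exchange_big/=.
rewrite exchange_big/=; apply: eq_bigr => m _.
rewrite expr2 big_distrl/=; apply: eq_bigr => j _.
by rewrite big_distrr/=; apply: eq_bigr => l _; rewrite /S; ring.
Qed.

End fourth_moments.

(** * Stein's equation *)

Section stein_solution.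
Context (R : realType).
Notation mu := (@lebesgue_measure R).
Local Notation g := (normal_pdf (0 : R) 1).
Implicit Types h : R -> R.

Let one0 : (1 : R) != 0. Proof. exact: oner_neq0. Qed.

Let cg : continuous g. Proof. exact: continuous_normal_pdf. Qed.

Let g0 x : 0 < g x.
Proof. by rewrite normal_pdfE// mulr_gt0 ?expR_gt0// normal_peak_gt0. Qed.

Let ge0 x : 0 <= g x. Proof. exact: ltW. Qed.

Let dg (x : R) : is_derive x 1 g (- (x * g x)).
Proof.
have := is_derive_normal_pdf 0 x one0; rewrite subr0 expr1n divr1; exact.
Qed.

Let ig : L1 mu g. Proof. exact: integrable_normal_pdf. Qed.

Let ixg : L1 mu (fun x => x * g x).
Proof.
apply: (@quartic_growth_L1 R 0 1 id) => //.
by apply: (@quartic_growth_le R 0 1 _ _ (@quartic_growth_exp R 0 1 isT)) => x; rewrite subr0 expr1 mul1r.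
Qed.

Let Int_xg x : \int[mu]_(t in `]-oo, x]) (- (t * g t)) = g x.
Proof.
have cxg : continuous (fun t : R => - (t * g t)).
  by move=> y; apply: cvgN; apply: cvgM; [exact: cvg_id|exact: cg].
have [_ lim0] := @normal_pdf_cvg0 R 0 1 one0.
by have := half_line_FTC cxg (L1N ixg) dg lim0 x; rewrite subr0.
Qed.

Definition normal_int h : R := \int[mu]_t (h t * g t).

Section solution.
Variable h : R -> R.
Hypotheses (ch : continuous h) (h01 : forall x, 0 <= h x <= 1).
Let c := normal_int h.

Let L1g (u : R -> R) (C : R) : continuous u -> (forall x, `|u x| <= C) ->
  L1 mu (fun x => u x * g x).
Proof.
move=> cu uC; apply: (@L1_le _ _ _ mu (fun x => C * g x)); first exact: L1Z.
  by apply: measurable_funM; apply: continuous_measurable_fun.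
by move=> x; rewrite normrM (gtr0_norm (g0 x)) ler_wpM2r.
Qed.

Let ihg : L1 mu (fun x => h x * g x).
Proof.
by apply: (L1g (C := 1)) => // x; have /andP[? ?] := h01 x; rewrite ger0_norm.
Qed.

Let c01 : 0 <= c <= 1.
Proof.
apply/andP; split.
  by apply: Rintegral_ge0 => x _; rewrite mulr_ge0//; have /andP[] := h01 x.
rewrite (_ : 1 = \int[mu]_x g x); last by rewrite /Rintegral integral_normal_pdf.
by apply: Int_le => // x; rewrite ler_piMl//; have /andP[] := h01 x.
Qed.

Let k t := (h t - c) * g t.

Let hc1 x : `|h x - c| <= 1.
Proof. by rewrite ler_norml; have := h01 x; have := c01; lra. Qed.

Let ck : continuous k.
Proof.
move=> x; apply: cvgM; last exact: cg.
by apply: cvgB; [exact: ch|exact: cvg_cst].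
Qed.

Let ik : L1 mu k.
Proof.
apply: (L1g (C := 1)) => // x.
by apply: cvgB; [exact: ch|exact: cvg_cst].
Qed.

Let K x := \int[mu]_(t in `]-oo, x]) k t.

Let dK (x : R) : is_derive x 1 K (k x).
Proof. exact: is_derive_half_line. Qed.

Let Int_k : \int[mu]_t k t = 0.
Proof.
rewrite /k; transitivity (\int[mu]_t (h t * g t - c * g t)).
  by apply: eq_Rintegral => t _; ring.
rewrite IntB//; last exact: L1Z.
by rewrite IntZ// {2}/Rintegral integral_normal_pdf mulr1 subrr.
Qed.

Let complement_half_line x (u : R -> R) : L1 mu u ->
  \int[mu]_t u t - \int[mu]_(t in `]-oo, x]) u t = \int[mu]_(t in `]x, +oo[) u t.
Proof.
have eT : [set` `]-oo, +oo[] = [set: R] by rewrite set_itvE.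
by rewrite /L1 -eT => iu; rewrite (Rintegral_itvB iu).
Qed.

Let K_right x : K x = - \int[mu]_(t in `]x, +oo[) k t.
Proof.
have := complement_half_line x ik; rewrite Int_k sub0r -/(K x) => <-.
by rewrite opprK.
Qed.

Let sub_int (A : set R) (u v : R -> R) : measurable A -> L1 mu u -> L1 mu v ->
  (forall x, A x -> u x <= v x) -> \int[mu]_(x in A) u x <= \int[mu]_(x in A) v x.
Proof.
by move=> mA iu iv uv; apply: le_Rintegral => //; [apply: integrableS iu|apply: integrableS iv].
Qed.

Let sub_norm (A : set R) (u v : R -> R) : measurable A -> L1 mu u -> L1 mu v ->
  (forall x, A x -> `|u x| <= v x) -> `|\int[mu]_(x in A) u x| <= \int[mu]_(x in A) v x.
Proof.
move=> mA iu iv uv; apply: le_trans (le_normr_Rintegral _ _) _ => //.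
  by apply: integrableS iu.
by apply: sub_int => //; exact: L1_norm.
Qed.

(** On the half line beyond x, away from 0, one has |x| <= |t|, and the integral of |t| g there is g
    x. For x > 0 the right half line is used, which is possible because the total integral of [k] is
    0. *)
Let xK x : `|x * K x| <= g x.
Proof.
have ixk : L1 mu (fun t => x * k t) by exact: L1Z.
have [x0|x0] := leP x 0.
  rewrite /K -RintegralZl//; last by apply: integrableS ik.
  rewrite -[leRHS]Int_xg; apply: sub_norm => //; first exact: L1N.
  move=> t /=; rewrite in_itv/= => tx; have t0 := le_trans tx x0.
  rewrite /k mulrA normrM (gtr0_norm (g0 t)) -mulNr ler_wpM2r//.
  rewrite normrM ler0_norm//; have := hc1 t; nra.
rewrite K_right mulrN normrN -RintegralZl//; last by apply: integrableS ik.
have -> : g x = \int[mu]_(t in `]x, +oo[) (t * g t).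
  have := complement_half_line x (L1N ixg); rewrite Int_xg.
  have -> : \int[mu]_t (- (t * g t)) = 0.
    have cxg : continuous (fun t : R => - (t * g t)).
      by move=> y; apply: cvgN; apply: cvgM; [exact: cvg_id|exact: cg].
    have [lim1 lim0] := @normal_pdf_cvg0 R 0 1 one0.
    by have := whole_line_FTC cxg (L1N ixg) dg lim0 lim1; rewrite subrr.
  rewrite sub0r => /(congr1 -%R); rewrite opprK => ->.
  rewrite -mulN1r -RintegralZl//; last by apply: integrableS (L1N ixg).
  by apply: eq_Rintegral => t _; rewrite mulN1r opprK.
apply: sub_norm => // t /=; rewrite in_itv/= andbT => xt.
rewrite /k mulrA normrM (gtr0_norm (g0 t)) ler_wpM2r//.
by rewrite normrM gtr0_norm//; have := hc1 t; have := normr_ge0 (h t - c); nra.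
Qed.

Let K1 x : `|K x| <= 1.
Proof.
apply: le_trans (sub_norm _ ik ig _) _ => //.
  by move=> t _; rewrite normrM (gtr0_norm (g0 t)) ler_piMl.
have e1 : \int[mu]_x g x = 1 by rewrite /Rintegral integral_normal_pdf.
by rewrite -[leRHS]e1 -subr_ge0 complement_half_line//; apply: Rintegral_ge0.
Qed.

(** f = K / g is the classical solution by variation of constants. *)
Lemma stein_solution : exists (f f' : R -> R) (A : R),
  [/\ forall x : R, is_derive x 1 f (f' x), continuous f',
      forall x, `|f x| <= A, forall x, `|f' x| <= A &
      forall x, f' x - x * f x = h x - c].
Proof.
pose f x := K x / g x; pose f' x := h x - c + x * f x.
have gne x : g x != 0 by rewrite gt_eqF.
have df (x : R) : is_derive x 1 f (f' x).
  have := dK x; have := dg x => ? ?.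
  have -> : f = K * (fun x => (g x)^-1) by [].
  apply: is_derive_eq; rewrite -![_ *: _]/(_ * _) /f' /f /k -exprVn; field.
  exact: gne.
have xf x : `|x * f x| <= 1.
  by rewrite /f mulrA normrM normfV (gtr0_norm (g0 x)) ler_pdivrMr// mul1r.
have cf := is_derive_continuous df.
(* |f| is at most |x f| <= 1 for |x| >= 1 and at most 1 / g 1 for |x| < 1; |f'| is at most |h - c| +
   |x f| <= 2. *)
exists f, f', (2 + (g 1)^-1); split => //.
- move=> x; apply: cvgD; first by apply: cvgB; [exact: ch|exact: cvg_cst].
  by apply: cvgM; [exact: cvg_id|exact: cf].
- move=> x; have gi : 0 <= (g 1)^-1 by rewrite invr_ge0.
  have [x1|x1] := leP 1 `|x|.
    apply: (@le_trans _ _ 1); last by lra.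
    by apply: le_trans _ (xf x); rewrite [leRHS]normrM ler_peMl.
  apply: (@le_trans _ _ (g 1)^-1); last by lra.
  rewrite /f normrM normfV (gtr0_norm (g0 x)) -[leRHS]mul1r; apply: ler_pM => //.
    by rewrite invr_ge0.
  rewrite lef_pV2 ?posrE// !normal_pdfE//; apply: ler_wpM2l; first exact: normal_peak_ge0.
  rewrite ler_expR !subr0 !expr1n !mulNr lerN2 ler_wpM2r ?invr_ge0//.
  by rewrite -real_normK ?num_real// expr_le1// ltW.
- move=> x; apply: le_trans (ler_normD _ _) _.
  have gi : 0 <= (g 1)^-1 by rewrite invr_ge0.
  have := hc1 x; have := xf x; lra.
- by move=> x; rewrite /f' addrK.
Qed.

End solution.

End stein_solution.

(** * A central limit theorem for Gaussian quadratic forms *)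

Section clt.
Context d (T : measurableType d) (R : realType) (P : probability T R).
Variable H : (T -> R) -> Prop.
Hypothesis Hfacts : forall Z, H Z -> gaussian_facts P Z.
Hypothesis Hlin : forall (a b : R) Y Z, H Y -> H Z -> H (fun w => a * Y w + b * Z w).

Definition normalized_sqnorm k (Y : 'I_k -> T -> R) w : R :=
  (sqnorm Y w - covtrace P Y) / Num.sqrt (2 * cov_frob2 P Y).

Let int_cst (c : R) : \int[P]_w (fun=> c) w = c.
Proof.
rewrite Rintegral_cst//= -[RHS]mulr1; congr (_ * _).
exact: (congr1 fine (probability_setT P)).
Qed.

(** Inserting the normalized variable F in Stein's equation and applying [stein_pair_C1] leaves
    E[(1 - Y^T S Y / tr S^2) f'(F)], at most A times a mean absolute deviation. The row sum bound
    controls the corresponding mean square. *)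
Lemma stein_bound k (Y : 'I_k -> T -> R) (rho e A c : R) (h f f' : R -> R) :
  (forall i, H (Y i)) -> 0 < e -> 0 < cov_frob2 P Y ->
  (forall i, \sum_j `|cov P (Y i) (Y j)| <= rho) ->
  rho ^+ 2 <= e ^+ 2 * cov_frob2 P Y ->
  (forall x : R, is_derive x 1 f (f' x)) -> continuous f' ->
  (forall x, `|f x| <= A) -> (forall x, `|f' x| <= A) ->
  (forall x, f' x - x * f x = h x - c) ->
  `|\int[P]_w h (normalized_sqnorm Y w) - c| <= A * (3 * e).
Proof.
move=> HY e0 S0 rowS rhoS df cf' bf bf' fE.
set S2 := cov_frob2 P Y in S0 rhoS *; set tr := covtrace P Y.
pose sg := Num.sqrt (2 * S2); set Q := sqnorm Y.
have A0 : 0 <= A := le_trans (normr_ge0 _) (bf 0).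
have sg0 : 0 < sg by rewrite sqrtr_gt0 mulr_gt0.
have sg2 : sg ^+ 2 = 2 * S2 by rewrite sqr_sqrtr// mulr_ge0// ltW.
set F := normalized_sqnorm Y.
have FE w : F w = (Q w - tr) / sg by [].
pose phi q := f ((q - tr) / sg); pose phi' q := f' ((q - tr) / sg) / sg.
have iQ : L1 P Q := L1_sqnorm Hfacts HY.
have iG : L1 P (covform P Y) := L1_covform Hfacts HY.
have Q0 w : 0 <= Q w by apply: sumr_ge0 => i _; exact: sqr_ge0.
have dphi (x : R) : is_derive x 1 phi (phi' x).
  have dx := df ((x - tr) / sg).
  rewrite /phi /phi'; apply: is_derive_eq; rewrite -![_ *: _]/(_ * _); ring.
have cphi' : continuous phi'.
  move=> x; apply: cvgMl; apply: continuous_comp; last exact: cf'.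
  by apply: cvgMl; apply: cvgB; [exact: cvg_id|exact: cvg_cst].
have Asg : 0 <= A / sg by rewrite divr_ge0// ltW.
have [||iL iR eq] := stein_pair_C1 Q0 iQ iG (sqnorm_laplace Hfacts Hlin HY) dphi cphi' (A := A + A / sg).
- by move=> x; apply: le_trans (bf _) _; rewrite lerDl.
- move=> x; rewrite normrM normfV (gtr0_norm sg0).
  by apply: le_trans (ler_wpM2r _ (bf' _)) _; rewrite ?invr_ge0 ?(ltW sg0)// lerDr.
rewrite -/tr in iL eq.
have iFf : L1 P (fun w => F w * f (F w)).
  have := L1Z sg^-1 iL; congr L1; apply/funext => w; rewrite /phi FE; ring.
have iGf : L1 P (fun w => S2^-1 * covform P Y w * f' (F w)).
  have := L1Z (sg * S2^-1) iR; congr L1; apply/funext => w; rewrite /phi' FE; field.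
  by rewrite !gt_eqF.
have mF : measurable_fun setT F.
  by apply: measurable_funM => //; apply: measurable_funB => //; exact: L1_measurable iQ.
have if' : L1 P (fun w => f' (F w)).
  apply: (@L1_bounded _ _ _ P _ A) => //.
  by apply: (measurableT_comp _ mF); exact: continuous_measurable_fun.
(* The factor 2 of the identity and the two factors 1 / [sg] combine to 1 / tr S^2, since [sg]^2 = 2
   tr S^2. *)
have e1 : \int[P]_w (F w * f (F w)) = \int[P]_w (S2^-1 * covform P Y w * f' (F w)).
  transitivity (sg^-1 * \int[P]_w ((Q w - tr) * phi (Q w))).
    by rewrite -IntZ//; apply: eq_Rintegral => w _; rewrite /phi FE; ring.
  rewrite eq mulrA -IntZ//; apply: eq_Rintegral => w _; rewrite /phi' FE.
  have -> : S2^-1 = 2 / sg ^+ 2 by rewrite sg2; field; rewrite gt_eqF.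
  by field; rewrite gt_eqF.
have -> : \int[P]_w h (F w) - c = \int[P]_w ((1 - S2^-1 * covform P Y w) * f' (F w)).
  have -> : \int[P]_w h (F w) = \int[P]_w (f' (F w) - F w * f (F w) + c).
    by apply: eq_Rintegral => w _; rewrite fE subrK.
  rewrite IntD; [|exact: L1B|exact: finite_measure_integrable_cst].
  rewrite int_cst addrK IntB// e1 -IntB//.
  by apply: eq_Rintegral => w _; ring.
have iV := L1_covform_sqr Hfacts HY.
have iR' : L1 P (fun w => (1 - S2^-1 * covform P Y w) * f' (F w)).
  by have := L1B if' iGf; congr L1; apply/funext => w; ring.
apply: le_trans (Int_norm iR') _.
(* |x| <= e + x^2 / e replaces Cauchy-Schwarz. As the mean of x^2 is at most 2 e^2, this yields the
   3 e of the statement. *)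
have iB : L1 P (fun w => A * (e + e^-1 * (S2^-1 ^+ 2 * (covform P Y w - S2) ^+ 2))).
  apply: L1Z; apply: L1D; first exact: finite_measure_integrable_cst.
  by do 2 apply: L1Z.
apply: le_trans (Int_le (L1_norm iR') iB _) _.
  move=> w; rewrite normrM mulrC; apply: ler_pM => //.
  have -> : 1 - S2^-1 * covform P Y w = - (S2^-1 * (covform P Y w - S2)).
    by field; rewrite gt_eqF.
  rewrite normrN -exprMn -[in leRHS]real_normK ?num_real//.
  set x := `|_|; have x0 : 0 <= x by exact: normr_ge0.
  rewrite -(ler_pM2l e0) mulrDr mulrA mulfV ?gt_eqF// mul1r.
  by have := sqr_ge0 (e - x); nra.
rewrite IntZ; last first.
  apply: L1D; first exact: finite_measure_integrable_cst.
  by do 2 apply: L1Z.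
apply: ler_wpM2l => //.
rewrite IntD; [|exact: finite_measure_integrable_cst|by do 2 apply: L1Z].
rewrite int_cst IntZ; last exact: L1Z.
rewrite IntZ//.
have := var_covform_le Hfacts Hlin HY rowS; rewrite -/S2 => V.
set J := Rintegral _ _ _ in V *.
have J2 : J <= 2 * (e ^+ 2 * S2 ^+ 2).
  apply: le_trans V _; apply: ler_wpM2l => //; rewrite [S2 ^+ 2]expr2 mulrA.
  by apply: ler_wpM2r => //; exact: ltW.
have : e^-1 * (S2^-1 ^+ 2 * J) <= e^-1 * (S2^-1 ^+ 2 * (2 * (e ^+ 2 * S2 ^+ 2))).
  by do 2 (apply: ler_wpM2l; first by rewrite ?exprn_ge0// invr_ge0 ltW).
have -> : e^-1 * (S2^-1 ^+ 2 * (2 * (e ^+ 2 * S2 ^+ 2))) = 2 * e.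
  by field; rewrite !gt_eqF.
lra.
Qed.

Local Notation g := (normal_pdf (0 : R) 1).

Definition normal_cdf (x : R) : R := \int[lebesgue_measure]_(t in `]-oo, x]) g t.

Let ig : L1 lebesgue_measure g. Proof. exact: integrable_normal_pdf. Qed.

Let ge0 x : 0 <= g x. Proof. exact: normal_pdf_ge0. Qed.

Let normal_cdf_indic x : normal_cdf x = \int[lebesgue_measure]_t (\1_`]-oo, x] t * g t).
Proof.
rewrite /normal_cdf Rintegral_mkcond; apply: eq_Rintegral => t _.
by rewrite patchE indicE; case: ifP => _; rewrite ?mul1r ?mul0r.
Qed.

Let normal_cdf_lipschitz x e : 0 <= e ->
  normal_cdf (x + e) - normal_cdf x <= normal_peak 1 * e.
Proof.
move=> e0; apply: le_trans (ler_norm _) _.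
have := @MVT_le R normal_cdf g x (x + e) (normal_peak 1).
rewrite [x + e]addrC addrK (ger0_norm e0); apply=> z _; split.
  by apply: is_derive_half_line => //; apply: continuous_normal_pdf; exact: oner_neq0.
by rewrite ger0_norm//; apply: normal_pdf_ub; exact: oner_neq0.
Qed.

(** For e > 0: equal to 1 up to x, to 0 from x + e on, and linear between. *)
Definition ramp (x e y : R) : R := Num.max 0 (Num.min 1 ((x + e - y) / e)).

Let ramp01 x e y : 0 <= ramp x e y <= 1.
Proof. by rewrite /ramp le_max lexx/= ge_max ler01/= ge_min lexx. Qed.

Let ramp_continuous x e : continuous (ramp x e).
Proof.
move=> y; apply: (@continuous_max R R (fun=> 0) _ y); first exact: cvg_cst.
apply: (@continuous_min R R (fun=> 1) _ y); first exact: cvg_cst.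
by apply: cvgMl; apply: cvgB; [exact: cvg_cst|exact: cvg_id].
Qed.

Let ramp_ge x e y : 0 < e -> \1_`]-oo, x] y <= ramp x e y.
Proof.
move=> e0; rewrite indicE; case: (boolP (_ \in _)) => [|_]; last by have /andP[] := ramp01 x e y.
rewrite inE/= in_itv/= => yx; rewrite /ramp le_max; apply/orP; right.
by rewrite le_min lexx/= ler_pdivlMr// mul1r; lra.
Qed.

Let ramp_le x e y : 0 < e -> ramp x e y <= \1_`]-oo, (x + e)] y.
Proof.
move=> e0; rewrite indicE; case: (boolP (_ \in _)) => [_|]; first by have /andP[] := ramp01 x e y.
rewrite notin_setE/= in_itv/= => /negP; rewrite -ltNge => yx.
by rewrite /ramp ge_max lexx/= ge_min; apply/orP; right; rewrite pmulr_lle0 ?invr_gt0//; lra.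
Qed.

Let L1_ramp x e : L1 lebesgue_measure (fun y => ramp x e y * g y).
Proof.
apply: (@L1_le _ _ _ lebesgue_measure g) => //.
  apply: measurable_funM; last exact: measurable_normal_pdf.
  by apply: continuous_measurable_fun; exact: ramp_continuous.
move=> y; have /andP[r0 r1] := ramp01 x e y.
by rewrite normrM (ger0_norm r0) (ger0_norm (ge0 y)) ler_piMl.
Qed.

Let L1_indic x : L1 lebesgue_measure (fun y => \1_`]-oo, x] y * g y).
Proof.
apply: (@L1_le _ _ _ lebesgue_measure g) => //.
  by apply: measurable_funM; [exact: measurable_indic|exact: measurable_normal_pdf].
move=> y; rewrite normrM (ger0_norm (ge0 y)) ler_piMl// indicE.
by case: (_ \in _); rewrite ?normr1 ?normr0.
Qed.

(** The hypothesis is that rho^2 / tr S^2 tends to 0 for some row sum bounds rho. Convergence of the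
    means of continuous functions with values in [0, 1] passes to the indicator of a half line,
    squeezed between two ramps that vanish from x and from x + e2 on, since the limiting
    distribution function is Lipschitz. *)
Lemma quadratic_form_clt (k : nat -> nat) (Y : forall n, 'I_(k n) -> T -> R) (x : R) :
  (forall n i, H (@Y n i)) ->
  (forall e, 0 < e -> \forall n \near \oo, exists rho : R,
    [/\ 0 < cov_frob2 P (@Y n),
        forall i, \sum_j `|cov P (@Y n i) (@Y n j)| <= rho &
        rho ^+ 2 <= e ^+ 2 * cov_frob2 P (@Y n)]) ->
  fine (P [set w | normalized_sqnorm (@Y n) w <= x]) @[n --> \oo] --> normal_cdf x.
Proof.
move=> HY hyp.
have mF n : measurable_fun setT (normalized_sqnorm (@Y n)).
  apply: measurable_funM => //; apply: measurable_funB => //.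
  exact: L1_measurable (L1_sqnorm Hfacts (HY n)).
have conv (h : R -> R) : continuous h -> (forall y, 0 <= h y <= 1) ->
    \int[P]_w h (normalized_sqnorm (@Y n) w) @[n --> \oo] --> normal_int h.
  move=> ch h01; have [f [f' [A [df cf' bf bf' fE]]]] := stein_solution ch h01.
  have A0 : 0 <= A := le_trans (normr_ge0 _) (bf 0).
  apply/cvgrPdist_le => e e0.
  pose e1 := e / (3 * (A + 1)).
  have e10 : 0 < e1 by rewrite divr_gt0// mulr_gt0// ltr_wpDl.
  apply: filterS (hyp e1 e10) => n [rho [S0 rowS rhoS]].
  rewrite distrC; apply: le_trans (stein_bound (HY n) e10 S0 rowS rhoS df cf' bf bf' fE) _.
  have -> : A * (3 * e1) = e * (A / (A + 1)) by rewrite /e1; field; rewrite gt_eqF// ltr_wpDl.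
  apply: ler_piMr; first exact: ltW.
  by rewrite ler_pdivrMr ?ltr_wpDl// mul1r lerDl.
have PE n : fine (P [set w | normalized_sqnorm (@Y n) w <= x]) =
    \int[P]_w \1_`]-oo, x] (normalized_sqnorm (@Y n) w).
  have -> : [set w | normalized_sqnorm (@Y n) w <= x] = normalized_sqnorm (@Y n) @^-1` `]-oo, x].
    by apply/seteqP; split=> w /=; rewrite in_itv.
  rewrite /Rintegral -[RHS]/(fine (\int[P]_w (\1_(normalized_sqnorm (@Y n) @^-1` `]-oo, x]) w)%:E)).
  rewrite integral_indic ?setIT//; last first.
    by rewrite -[X in measurable X]setTI; exact: mF.
have iind n z : L1 P (fun w => \1_`]-oo, z] (normalized_sqnorm (@Y n) w) : R).
  apply: (@L1_bounded _ _ _ P _ 1).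
    by apply: (measurableT_comp _ (mF n)); exact: measurable_indic.
  by move=> w; rewrite indicE; case: (_ \in _); rewrite ?normr1 ?normr0.
have iramp n z e : L1 P (fun w => ramp z e (normalized_sqnorm (@Y n) w)).
  apply: (@L1_bounded _ _ _ P _ 1).
    apply: (measurableT_comp _ (mF n)); apply: continuous_measurable_fun.
    exact: ramp_continuous.
  by move=> w; have /andP[r0 r1] := ramp01 z e (normalized_sqnorm (@Y n) w); rewrite ger0_norm.
apply/cvgrPdist_le => e e0.
pose pk := normal_peak (1 : R).
have pk0 : 0 <= pk := normal_peak_ge0 1.
(* Half of e pays for the width of the ramp, at slope [pk]; the other half pays for the convergence
   of the means. *)
pose e2 := e / (2 * (pk + 1)).
have e20 : 0 < e2 by rewrite divr_gt0// mulr_gt0// ltr_wpDl.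
have pke : pk * e2 <= e / 2.
  have -> : pk * e2 = e / 2 * (pk / (pk + 1)) by rewrite /e2; field; rewrite gt_eqF// ltr_wpDl.
  apply: ler_piMr; first by rewrite divr_ge0// ltW.
  by rewrite ler_pdivrMr ?ltr_wpDl// mul1r lerDl.
have eh : 0 < e / 2 by rewrite divr_gt0.
have /cvgrPdist_le/(_ _ eh) c1 := conv _ (@ramp_continuous x e2) (ramp01 x e2).
have /cvgrPdist_le/(_ _ eh) c2 := conv _ (@ramp_continuous (x - e2) e2) (ramp01 (x - e2) e2).
have up : normal_int (ramp x e2) <= normal_cdf (x + e2).
  rewrite normal_cdf_indic; apply: Int_le => // y.
  by apply: ler_wpM2r => //; exact: ramp_le.
have dn : normal_cdf (x - e2) <= normal_int (ramp (x - e2) e2).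
  rewrite normal_cdf_indic; apply: Int_le => // y.
  by apply: ler_wpM2r => //; exact: ramp_ge.
have l1 := normal_cdf_lipschitz x (ltW e20).
have := normal_cdf_lipschitz (x - e2) (ltW e20); rewrite subrK => l2.
near=> n; rewrite PE.
have b1 : \int[P]_w \1_`]-oo, x] (normalized_sqnorm (@Y n) w) <=
    \int[P]_w ramp x e2 (normalized_sqnorm (@Y n) w).
  by apply: Int_le => // w; exact: ramp_ge.
have b2 : \int[P]_w ramp (x - e2) e2 (normalized_sqnorm (@Y n) w) <=
    \int[P]_w \1_`]-oo, x] (normalized_sqnorm (@Y n) w).
  by apply: Int_le => // w; have := @ramp_le (x - e2) e2 (normalized_sqnorm (@Y n) w) e20; rewrite subrK.
have : `|normal_int (ramp x e2) - \int[P]_w ramp x e2 (normalized_sqnorm (@Y n) w)| <= e / 2.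
  by near: n.
have : `|normal_int (ramp (x - e2) e2) - \int[P]_w ramp (x - e2) e2 (normalized_sqnorm (@Y n) w)| <= e / 2.
  by near: n.
rewrite !ler_norml -/pk in l1 l2 *; lra.
Unshelve. all: by end_near. Qed.

End clt.

(** * Double differences of the variogram *)

Section taylor.
Context (R : realType).

Lemma is_derive_shift_exp (x : R) q (z : R) :
  is_derive z 1 (fun y => (y - x) ^+ q) (q%:R * (z - x) ^+ q.-1).
Proof.
elim: q => [|q IH]; first by rewrite mul0r; exact: is_derive_cst.
have -> : (fun y : R => (y - x) ^+ q.+1) = (fun y => (y - x) * (y - x) ^+ q).
  by apply/funext => y; rewrite exprS.
apply: is_derive_eq; rewrite -![_ *: _]/(_ * _) /=.
case: q {IH} => [|q] /=; first by rewrite !expr0; ring.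
by rewrite exprS -!natr1; ring.
Qed.

(** F q plays the q-th derivative on [lo, hi]. The derivative of the remainder is the remainder, of
    order one less, of the shifted family, so the mean value theorem gives the induction step; it
    loses the factor 1 / N!, which is immaterial. *)
Lemma taylor_bound (F : nat -> R -> R) (lo hi x y B : R) N :
  (forall q (z : R), (q < N)%N -> lo <= z <= hi -> is_derive z 1 (F q) (F q.+1 z)) ->
  (forall z : R, lo <= z <= hi -> `|F N z| <= B) ->
  lo <= x <= hi -> lo <= y <= hi ->
  `|F 0%N y - \sum_(q < N) F q x / q`!%:R * (y - x) ^+ q| <= B * `|y - x| ^+ N.
Proof.
elim: N F y => [|N IH] F y dF bF xI yI.
  by rewrite big_ord0 subr0 expr0 mulr1; exact: bF.
pose G z := F 0%N z - \sum_(q < N.+1) F q x / q`!%:R * (z - x) ^+ q.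
have Gx : G x = 0.
  rewrite /G big_ord_recl /= fact0 divr1 expr0 mulr1 big1 ?addr0 ?subrr// => i _.
  by rewrite /bump/= add1n ?subrr expr0n/= mulr0.
rewrite -[X in `|X|]/(G y) -[G y]subr0 -Gx exprS [`|_| * _]mulrC mulrA.
apply: (@MVT_le R G (fun z => F 1%N z - \sum_(q < N) F q.+1 x / q`!%:R * (z - x) ^+ q)).
move=> z zxy; have zI : lo <= z <= hi.
  move: zxy xI yI; case/andP=> z1 z2 /andP[x1 x2] /andP[y1 y2]; apply/andP; split.
    by apply: le_trans z1; rewrite le_min x1 y1.
  by apply: le_trans z2 _; rewrite ge_max x2 y2.
split; last first.
  apply: (@le_trans _ _ (B * `|z - x| ^+ N)).
    apply: (IH (fun q => F q.+1)) => // q z' qN z'I; exact: dF.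
  apply: ler_wpM2l; first exact: le_trans (normr_ge0 _) (bF x xI).
  apply: lerXn2r; rewrite ?nnegrE//.
  case/andP: zxy; case: (leP x y) => xy z1 z2; first by rewrite !ger0_norm ?subr_ge0// lerB.
  by rewrite !ler0_norm ?subr_le0// ?(ltW xy)// lerN2 lerB.
have d0 : is_derive z 1 (F 0%N) (F 1%N z) by exact: dF.
have -> : \sum_(q < N) F q.+1 x / q`!%:R * (z - x) ^+ q =
    \sum_(q < N.+1) F q x / q`!%:R * (q%:R * (z - x) ^+ q.-1).
  rewrite big_ord_recl /= !mul0r mulr0 add0r; apply: eq_bigr => i _.
  rewrite /bump/= add1n factS natrM; field.
  by rewrite nat1r !pnatr_eq0 -lt0n fact_gt0.
have ds (q : 'I_N.+1) : is_derive z 1 (fun z => F q x / q`!%:R * (z - x) ^+ q)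
    (F q x / q`!%:R * (q%:R * (z - x) ^+ q.-1)).
  have dq := is_derive_shift_exp x q z.
  by apply: is_derive_eq; rewrite -![_ *: _]/(_ * _); ring.
have dsum := @is_derive_sum R R^o R^o N.+1 (fun q : 'I_N.+1 => fun z => F q x / q`!%:R * (z - x) ^+ q) z 1 _ ds.
have -> : G = F 0%N - \sum_(q < N.+1) (fun z => F q x / q`!%:R * (z - x) ^+ q).
  by apply/funext => u; rewrite /G; congr (_ - _); rewrite fct_sumE.
exact: is_deriveB.
Qed.

End taylor.

Section double_difference.
Context (R : realType) (a : seq R) (M : nat).
Hypothesis aM : has_order a M.
Local Notation L := (size a).

(** With f = V this is minus the covariance of two differences at lag k; k is real so that negative
    lags are allowed. *)
Definition double_difference (f : R -> R) (k delta : R) : R :=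
  \sum_(j < L) \sum_(j' < L) a`_j * a`_j' * f ((k + j'%:R - j%:R) * delta).

Definition moment q : R := \sum_(j < L) \sum_(j' < L) a`_j * a`_j' * (j'%:R - j%:R) ^+ q.

Let m q : R := \sum_(j < L) a`_j * j%:R ^+ q.

Let momentE q : moment q = \sum_(i < q.+1) (-1) ^+ i * m i * m (q - i) *+ 'C(q, i).
Proof.
rewrite /moment; under eq_bigr do under eq_bigr do rewrite exprBn mulr_sumr.
under eq_bigr do rewrite exchange_big/=.
rewrite exchange_big/=; apply: eq_bigr => i _.
have -> : (-1) ^+ i * m i * m (q - i) *+ 'C(q, i) = ((-1) ^+ i *+ 'C(q, i)) * (m i * m (q - i)).
  by rewrite mulrnAl mulrA.
rewrite /m big_distrlr mulr_sumr; apply: eq_bigr => j _ /=.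
rewrite mulr_sumr; apply: eq_bigr => j' _.
by rewrite mulrnAl mulrnAr; congr (_ *+ _); ring.
Qed.

(** In each term of [momentE] one of the indices i and q - i is below M. *)
Lemma moment_eq0 q : (q < 2 * M)%N -> moment q = 0.
Proof.
move=> qM; rewrite momentE big1// => i _.
have [iM|Mi] := ltnP i M.
  by rewrite [m i](aM.1 i iM) mulr0 mul0r mul0rn.
rewrite [m (q - i)](aM.1 (q - i)%N _) ?mulr0 ?mul0rn// ltn_subLR; last by rewrite -ltnS.
by rewrite (leq_trans qM)// mul2n -addnn leq_add2r.
Qed.

(** Only i = M survives in [momentE], leaving, up to sign and a binomial coefficient, the square of
    the first non-zero moment of a. *)
Lemma moment_neq0 : moment (2 * M) != 0.
Proof.
have lt : (M < (2 * M).+1)%N by rewrite ltnS leq_pmull.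
rewrite momentE (bigD1 (Ordinal lt))//= big1 ?addr0.
  have -> : (2 * M - M = M)%N by rewrite mul2n -addnn addnK.
  rewrite -mulr_natr !mulf_neq0 ?aM.2//; first by rewrite expf_eq0 oppr_eq0 oner_eq0 andbF.
  by rewrite pnatr_eq0 -lt0n bin_gt0 leq_pmull.
have aux (i : nat) : (i <= 2 * M)%N -> (M <= i)%N -> i != M -> (2 * M - i < M)%N.
  move=> i2 Mi iM; rewrite ltn_subLR//.
  by rewrite mul2n -addnn ltn_add2r ltn_neqAle eq_sym iM.
move=> i iM; have [iltM|Mi] := ltnP i M.
  by rewrite [m i](aM.1 i iltM) mulr0 mul0r mul0rn.
rewrite [m (_ - i)](aM.1 (2 * M - i)%N _) ?mulr0 ?mul0rn//.
by apply: aux => //; rewrite -ltnS.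
Qed.

Definition abs_mass : R := \sum_(j < L) \sum_(j' < L) `|a`_j * a`_j'|.

Lemma abs_mass_ge0 : 0 <= abs_mass.
Proof. by apply: sumr_ge0 => j _; exact: sumr_ge0. Qed.

Lemma double_difference_le f k delta B :
  (forall j j' : 'I_L, `|f ((k + j'%:R - j%:R) * delta)| <= B) ->
  `|double_difference f k delta| <= abs_mass * B.
Proof.
move=> fB; rewrite /double_difference /abs_mass mulr_suml.
apply: le_trans (ler_norm_sum _ _ _) _; apply: ler_sum => j _; rewrite mulr_suml.
apply: le_trans (ler_norm_sum _ _ _) _; apply: ler_sum => j' _; rewrite normrM.
exact: ler_wpM2l.
Qed.

Lemma double_differenceD f g (c : R) k delta :
  double_difference (fun x => c * f x + g x) k delta =
  c * double_difference f k delta + double_difference g k delta.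
Proof.
rewrite /double_difference mulr_sumr -big_split/=; apply: eq_bigr => j _.
rewrite mulr_sumr -big_split/=; apply: eq_bigr => j' _; ring.
Qed.

Lemma double_difference_monomial n k delta : (n < 2 * M)%N ->
  double_difference (fun x => x ^+ n) k delta = 0.
Proof.
move=> nM; rewrite /double_difference.
transitivity (\sum_(i < n.+1) (k ^+ (n - i) * delta ^+ n *+ 'C(n, i)) * moment i).
  rewrite /moment; under [RHS]eq_bigr do rewrite mulr_sumr.
  rewrite [RHS]exchange_big; apply: eq_bigr => j _ /=.
  under [RHS]eq_bigr do rewrite mulr_sumr.
  rewrite [RHS]exchange_big; apply: eq_bigr => j' _ /=.
  rewrite exprMn -addrA exprDn mulr_suml mulr_sumr; apply: eq_bigr => i _.
  by rewrite !mulrnAl mulrnAr; congr (_ *+ _); ring.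
rewrite big1// => i _; rewrite moment_eq0 ?mulr0//.
by apply: leq_ltn_trans nM; rewrite -ltnS.
Qed.

(** Expansion about the centre k delta. The offsets j' - j lie between - (L - 1) and L - 1, whence
    the interval on which the derivatives are needed. *)
Lemma double_difference_taylor (F : nat -> R -> R) (k delta B : R) N : 0 < delta ->
  (forall q (z : R), (q < N)%N -> (k - L%:R + 1) * delta <= z <= (k + L%:R - 1) * delta ->
     is_derive z 1 (F q) (F q.+1 z)) ->
  (forall z : R, (k - L%:R + 1) * delta <= z <= (k + L%:R - 1) * delta -> `|F N z| <= B) ->
  `|double_difference (F 0%N) k delta -
    \sum_(q < N) F q (k * delta) / q`!%:R * delta ^+ q * moment q| <=
  abs_mass * (B * (L%:R * delta) ^+ N).
Proof.
move=> d0 dF bF.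
pose u (x : R) := F 0%N x - \sum_(q < N) F q (k * delta) / q`!%:R * (x - k * delta) ^+ q.
have -> : double_difference (F 0%N) k delta -
    \sum_(q < N) F q (k * delta) / q`!%:R * delta ^+ q * moment q =
    double_difference u k delta.
  rewrite /double_difference /u.
  transitivity (\sum_(j < L) \sum_(j' < L) (a`_j * a`_j' * F 0%N ((k + j'%:R - j%:R) * delta) -
     \sum_(q < N) F q (k * delta) / q`!%:R * delta ^+ q * (a`_j * a`_j' * (j'%:R - j%:R) ^+ q))).
    rewrite /moment; under [X in _ = X]eq_bigr do rewrite sumrB.
    rewrite sumrB; congr (_ - _).
    under eq_bigr do rewrite mulr_sumr.
    rewrite exchange_big/=; apply: eq_bigr => j _.
    under eq_bigr do rewrite mulr_sumr.
    by rewrite exchange_big.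
  apply: eq_bigr => j _; apply: eq_bigr => j' _; rewrite mulrBr; congr (_ - _).
  rewrite mulr_sumr; apply: eq_bigr => q _.
  have -> : (k + j'%:R - j%:R) * delta - k * delta = delta * (j'%:R - j%:R) by ring.
  by rewrite exprMn; ring.
apply: double_difference_le => j j'.
have jL : (j%:R : R) <= L%:R - 1 by rewrite lerBrDr natr1 ler_nat.
have j'L : (j'%:R : R) <= L%:R - 1 by rewrite lerBrDr natr1 ler_nat.
have j0 : 0 <= (j%:R : R) by []; have j'0 : 0 <= (j'%:R : R) by [].
have B0 : 0 <= B.
  apply: le_trans (normr_ge0 _) (bF (k * delta) _).
  by rewrite !ler_pM2r//; apply/andP; split; lra.
rewrite /u; apply: le_trans (taylor_bound dF bF _ _) _.
- by rewrite !ler_pM2r//; apply/andP; split; lra.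
- by rewrite !ler_pM2r//; apply/andP; split; lra.
apply: ler_wpM2l => //; apply: lerXn2r; rewrite ?nnegrE ?mulr_ge0 ?(ltW d0)//.
have -> : (k + j'%:R - j%:R) * delta - k * delta = (j'%:R - j%:R) * delta by ring.
rewrite normrM (gtr0_norm d0) ler_pM2r// ler_norml; apply/andP; split; lra.
Qed.

End double_difference.

(** * Expansion of a function at 0 from that of a higher derivative *)

Section expansion_at_0.
Context (R : realType).
Implicit Types (f r : R -> R) (s c : R).

Lemma derivable_is_derive1 f (x : R) : derivable f x 1 -> is_derive x 1 f (f^`()%classic x).
Proof. by move=> df; rewrite derive1E; exact: derivableP. Qed.

Lemma derive1n_parity f (b : bool) N : (forall x, f (- x) = (-1) ^+ b * f x) ->
  times_differentiable N f -> forall k x, (k <= N)%N ->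
  f^`(k)%classic (- x) = (-1) ^+ (b + k) * f^`(k)%classic x.
Proof.
move=> fe df; elim=> [|k IH] x kN; first by rewrite addn0 ?derive1n0.
have dk y := df k y kN.
have d1 : is_derive x 1 (fun y : R => f^`(k)%classic (- y)) (- f^`(k.+1)%classic (- x)).
  have := derivable_is_derive1 (dk (- x)); rewrite -derive1nS => d0.
  have -> : (fun y : R => f^`(k)%classic (- y)) = f^`(k)%classic \o -%R by [].
  by apply: is_derive_eq; first [ring | (rewrite -![_ *: _]/(_ * _); ring)].
have d2 : is_derive x 1 (fun y : R => f^`(k)%classic (- y)) ((-1) ^+ (b + k) * f^`(k.+1)%classic x).
  have := derivable_is_derive1 (dk x); rewrite -derive1nS => d0.
  have -> : (fun y : R => f^`(k)%classic (- y)) = (fun y => (-1) ^+ (b + k) * f^`(k)%classic y).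
    by apply/funext => y; rewrite IH// ltnW.
  apply: is_derive_eq; rewrite -![_ *: _]/(_ * _); ring.
have : - f^`(k.+1)%classic (- x) = (-1) ^+ (b + k) * f^`(k.+1)%classic x.
  by case: d1 => _ <-; case: d2 => _ <-.
by rewrite addnS exprS mulN1r mulNr => <-; rewrite opprK.
Qed.

Definition taylor0 f N (h : R) : R := \sum_(q < N.+1) f^`(q)%classic 0 / q`!%:R * h ^+ q.

(** Odd derivatives of an even function vanish at 0; this carries the expansion from h > 0 to h <
    0. *)
Lemma taylor0_even f D : (forall x, f (- x) = f x) -> times_differentiable (2 * D) f ->
  forall h, taylor0 f (2 * D) (- h) = taylor0 f (2 * D) h.
Proof.
move=> fe df h; apply: eq_bigr => q _.
have [oq|eq] := boolP (odd q); last by rewrite [in LHS]exprNn -signr_odd (negbTE eq) mul1r.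
have := @derive1n_parity f false (2 * D) _ df q 0 (leq_ord q).
have sq : (-1) ^+ (false + q) = -1 :> R by rewrite add0n -signr_odd oq expr1.
rewrite oppr0 sq mulN1r => H.
have f0 : f^`(q)%classic 0 = 0.
  by have := H (fun x => etrans (fe x) (esym (mul1r _))); lra.
by rewrite f0 !mul0r.
Qed.

(** The factor produced by integrating h^s N times from 0. *)
Definition expansion_coef s N : R := \prod_(i < N) (s + i.+1%:R)^-1.

Lemma expansion_coef_gt0 s N : 0 < s -> 0 < expansion_coef s N.
Proof. by move=> s0; apply: prodr_gt0 => i _; rewrite invr_gt0 addr_gt0. Qed.

Let is_derive_taylor0 f N (x : R) :
  is_derive x 1 (taylor0 f N.+1) (taylor0 f^`()%classic N x).
Proof.
have -> : taylor0 f N.+1 = \sum_(q < N.+2) (fun h => f^`(q)%classic 0 / q`!%:R * h ^+ q).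
  by apply/funext => h; rewrite /taylor0 fct_sumE.
have -> : taylor0 f^`()%classic N x = \sum_(q < N.+2) f^`(q)%classic 0 / q`!%:R * (q%:R * x ^+ q.-1).
  rewrite big_ord_recl /= !mul0r mulr0 add0r /taylor0; apply: eq_bigr => i _.
  rewrite /bump/= add1n !add0n -derive1nS derive1Sn factS natrM; field.
  by rewrite nat1r !pnatr_eq0 -lt0n fact_gt0.
apply: is_derive_sum => q.
have := @is_derive_shift_exp R 0 q x; rewrite subr0.
have -> : (fun y : R => (y - 0) ^+ q) = (fun y => y ^+ q) by apply/funext => y; rewrite subr0.
move=> dq; apply: is_derive_eq; rewrite -![_ *: _]/(_ * _); ring.
Qed.

Let cvg_at_right0 f N c a : {for 0, continuous f} -> 0 < a ->
  f t - taylor0 f N.+1 t - c * t `^ a @[t --> 0^'+] --> 0.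
Proof.
move=> cf a0.
rewrite [X in _ --> X](_ : 0 = f 0 - taylor0 f N.+1 0 - c * 0); last first.
  rewrite mulr0 subr0 /taylor0 big_ord_recl/= ?derive1n0 fact0 divr1 expr0 mulr1.
  by rewrite big1 ?addr0 ?subrr// => i _; rewrite expr0n/= mulr0.
apply: cvgB; last by apply: cvgMr; exact: powR_cvg0.
apply: cvgB; first exact: cvg_at_right_filter.
apply: cvg_at_right_filter.
exact: (is_derive_continuous (is_derive_taylor0 f N)).
Qed.

(** The expansion of the N-th derivative is integrated N times; each integration is a mean value
    estimate on the error, which tends to 0 at 0, and keeps the same e. *)
Lemma expansion_at_0 f N c s r : 0 < s -> times_differentiable N f ->
  (forall h, f^`(N)%classic h = f^`(N)%classic 0 + c * `|h| `^ s + r h) ->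
  (forall e, 0 < e -> exists2 eta, 0 < eta & forall h, 0 < h < eta -> `|r h| <= e * h `^ s) ->
  forall e, 0 < e -> exists2 eta, 0 < eta & forall h, 0 < h < eta ->
    `|f h - taylor0 f N h - c * expansion_coef s N * h `^ (s + N%:R)| <= e * h `^ (s + N%:R).
Proof.
move=> s0; elim: N f => [|N IH] f df fN ro e e0.
  have [eta eta0 H] := ro e e0; exists eta => // h h0.
  have hp : 0 < h by case/andP: h0.
  rewrite /expansion_coef big_ord0 mulr1 addr0 /taylor0 big_ord_recl big_ord0 addr0/=.
  rewrite ?derive1n0 fact0 divr1 expr0 mulr1.
  have := fN h; rewrite ?derive1n0 (gtr0_norm hp) => ->.
  by rewrite (_ : _ - _ = r h); [exact: H|ring].
have df' : times_differentiable N f^`()%classic.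
  by move=> k x kN; rewrite -derive1Sn; exact: df.
have fN' h : (f^`()^`(N))%classic h = (f^`()^`(N))%classic 0 + c * `|h| `^ s + r h.
  by rewrite -derive1Sn; exact: fN.
have [eta eta0 H] := IH _ df' fN' ro e e0.
set a := s + N%:R in H; have a0 : 0 < a by rewrite ltr_wpDr.
have a1E : s + N.+1%:R = a + 1 by rewrite /a -natr1 addrA.
have cE : c * expansion_coef s N.+1 * (a + 1) = c * expansion_coef s N.
  rewrite /expansion_coef big_ord_recr/= a1E; field; rewrite gt_eqF// addr_gt0//.
pose g t := f t - taylor0 f N.+1 t - c * expansion_coef s N.+1 * t `^ (a + 1).
have dg (x : R) : 0 < x -> is_derive x 1 g
    (f^`()%classic x - taylor0 f^`()%classic N x - c * expansion_coef s N * x `^ a).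
  move=> x0; have d0 := derivable_is_derive1 (df 0%N x isT); rewrite derive1n0 in d0.
  have d1 := is_derive_taylor0 f N x; have d2 := is_derive1_powR (a + 1) x0.
  rewrite /g; apply: is_derive_eq; rewrite -![_ *: _]/(_ * _) addrK -cE; ring.
have cf : {for 0, continuous f}.
  by apply/differentiable_continuous/derivable1_diffP; have := df 0%N 0 isT; rewrite derive1n0.
have g0 := @cvg_at_right0 f N (c * expansion_coef s N.+1) (a + 1) cf (addr_gt0 a0 ltr01).
exists eta => // h /andP[h0 heta]; rewrite a1E -[X in `|X|]/(g h).
(* The power is differentiated on h > 0 only, so the estimate starts at a small t > 0 where the
   error is at most an arbitrary e'. *)
apply/ler_addgt0Pr => e' e'0.
have [t /andP[t0 th] gt] : exists2 t, 0 < t < h & `|g t| <= e'.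
  have /cvgrPdist_le/(_ _ e'0) ge := g0.
  near (0 : R)^'+ => t; exists t.
    apply/andP; split; first by near: t; exact: nbhs_right_gt.
    by near: t; exact: nbhs_right_lt.
  rewrite -normrN -sub0r; by near: t.
have : `|g h - g t| <= e * h `^ a * `|h - t|.
  apply: (@MVT_le R g (fun x => f^`()%classic x - taylor0 f^`()%classic N x - c * expansion_coef s N * x `^ a)).
  rewrite min_l ?max_r ?(ltW th)// => z /andP[tz zh].
  have z0 : 0 < z by exact: lt_le_trans tz.
  split; first exact: dg.
  apply: le_trans (H z _) _; first by rewrite z0 (le_lt_trans zh).
  by apply: ler_wpM2l; [exact: ltW|apply: ge0_ler_powR; rewrite ?nnegrE// ltW].
have -> : h `^ (a + 1) = h `^ a * h.
  by rewrite powRD ?(gt_eqF h0) ?implybT// powRr1// ltW.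
rewrite mulrA (gtr0_norm (x := h - t)) ?subr_gt0// => gg.
rewrite -[g h](subrK (g t)); apply: le_trans (ler_normD _ _) _; apply: lerD => //.
apply: le_trans gg _; apply: ler_wpM2l; first by rewrite mulr_ge0 ?powR_ge0// ltW.
by rewrite gerBl ltW.
Unshelve. all: by end_near. Qed.

End expansion_at_0.

Section power_derivatives.
Context (R : realType).
Implicit Types p s x : R.

(** The falling factorial p (p - 1) ... (p - q + 1), coefficient of the q-th derivative of x^p. *)
Definition ffactr p q : R := \prod_(i < q) (p - i%:R).

Lemma is_derive_power p q x : 0 < x ->
  is_derive x 1 (fun y => ffactr p q * y `^ (p - q%:R)) (ffactr p q.+1 * x `^ (p - q.+1%:R)).
Proof.
move=> x0; have dp := is_derive1_powR (p - q%:R) x0.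
apply: is_derive_eq; rewrite -![_ *: _]/(_ * _) /ffactr big_ord_recr/=.
rewrite (_ : p - q.+1%:R = p - q%:R - 1); last by rewrite -natr1; ring.
ring.
Qed.

Lemma ge0_ler_powRN p x y : p <= 0 -> 0 < x -> x <= y -> y `^ p <= x `^ p.
Proof.
move=> p0 x0 xy; have y0 := lt_le_trans x0 xy.
rewrite -[p]opprK !(powRN _ (- p)) lef_pV2 ?posrE ?powR_gt0//.
by apply: ge0_ler_powR; rewrite ?oppr_ge0// nnegrE ltW.
Qed.

End power_derivatives.

(** * A lag where the double difference of |x|^p does not vanish *)

Section nonvanishing.
Context (R : realType) (a : seq R) (M D : nat) (s : R).
Hypotheses (aM : has_order a M) (pa : proper_sequence a).
Hypothesis a0 : \sum_(j < size a) a`_j = 0.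
Hypotheses (s02 : 0 < s < 2) (DM : D%:R + s / 2 + 1 / 4 < M%:R :> R).
Local Notation L := (size a).
Local Notation p := (s + (2 * D)%:R).
Local Notation dd := (double_difference a).

Let DM' : (D < M)%N.
Proof.
by rewrite -(ltr_nat R); case/andP: s02 => s0 _; apply: le_lt_trans DM; lra.
Qed.

Let L2 : (1 < L)%N.
Proof.
case: pa => an ah _; move: a0 an ah; case: a => [//|x [|//]].
by rewrite big_ord1/= => -> _; rewrite eqxx.
Qed.

Let LE1 : L.-1 = (L - 2).+1.
Proof. by rewrite -subSn// subSS subn1. Qed.

(* Up to a monomial, |x| ^ p vanishes on [0, +oo[, and at lag L - 2 only the pair
   of extreme indices meets a negative argument. *)
Let nonvanishing1 : s = 1 -> dd (fun x => `|x| `^ p) (L - 2)%:R 1 != 0.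
Proof.
move=> s1.
pose u (x : R) := `|x| ^+ (2 * D).+1 - x ^+ (2 * D).+1.
have -> : (fun x : R => `|x| `^ p) = (fun x => 1 * x ^+ (2 * D).+1 + u x).
  apply/funext => x; rewrite s1 (_ : 1 + (2 * D)%:R = (2 * D).+1%:R); last by rewrite -natr1 addrC.
  by rewrite powR_mulrn// /u mul1r addrC subrK.
rewrite double_differenceD (double_difference_monomial aM) ?mulr0 ?add0r; last first.
  by apply: (@leq_trans (2 * D.+1)); [rewrite mulnS|rewrite leq_mul2l].
have L0 : (0 < L)%N by exact: ltnW.
have Ll : (L.-1 < L)%N by rewrite prednK.
rewrite /double_difference (bigD1 (Ordinal Ll))//= [X in _ + X]big1; last first.
  move=> j jL; apply: big1 => j' _.
  have jL1 : (j <= L - 2)%N.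
    have : (j < L.-1)%N.
      rewrite ltn_neqAle -ltnS prednK// ltn_ord andbT.
      by apply: contra jL => /eqP e; apply/eqP/val_inj.
    by rewrite LE1 ltnS.
  have x0 : 0 <= ((L - 2)%:R + j'%:R - j%:R) * (1 : R).
    by rewrite mulr1 subr_ge0 -natrD ler_nat (leq_trans jL1)// leq_addr.
  by rewrite /u ger0_norm// subrr mulr0.
rewrite addr0 (bigD1 (Ordinal L0))//= big1 ?addr0; last first.
  move=> j' j'0; have j'1 : (0 < j')%N.
    by rewrite lt0n; apply: contra j'0 => /eqP e; apply/eqP/val_inj.
  have x0 : 0 <= ((L - 2)%:R + j'%:R - L.-1%:R) * (1 : R).
    by rewrite mulr1 subr_ge0 -natrD ler_nat LE1 -addn1 leq_add2l.
  by rewrite /u ger0_norm// subrr mulr0.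
(* The one remaining argument is - 1, where u takes the value 2, so the sum is twice the product of
   the end coefficients. *)
have -> : ((L - 2)%:R - L.-1%:R) * 1 = -1 :> R.
  rewrite LE1 -natr1; ring.
rewrite /u normrN normr1 expr1n exprS mulN1r exprM sqrrN !expr1n opprK.
have [_ ah al] := pa; rewrite -nth_last in al; rewrite !mulf_neq0//.
Qed.

(** p lies strictly between 2 D and 2 D + 2, so it could only be the integer 2 D + 1, which means s
    = 1. *)
Let ff_neq0 q : s != 1 -> ffactr p q != 0.
Proof.
move=> s1; apply/prodf_neq0 => i _; apply/negP => /eqP e.
have si : s + (2 * D)%:R = i%:R by lra.
have i1 : ((2 * D) < i)%N by rewrite -(ltr_nat R) -si ltrDr; case/andP: s02.
have i2 : (i < (2 * D).+2)%N.
  by rewrite -(ltr_nat R) -si -!natr1; case/andP: s02 => _; lra.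
have ei : (nat_of_ord i = (2 * D).+1)%N by apply/eqP; rewrite eqn_leq -ltnS i2 i1.
by move/eqP: s1; apply; move: si; rewrite ei -natr1; lra.
Qed.

(* At a large lag k the double difference is governed by its Taylor term of order
   2 M, a non-zero multiple of k ^ (p - 2 M). *)
Let nonvanishing2 : s != 1 -> exists k : nat, dd (fun x => `|x| `^ p) k%:R 1 != 0.
Proof.
move=> s1; apply: contrapT => /forallNP H.
have H0 k : dd (fun x => `|x| `^ p) k%:R 1 = 0 by apply/eqP/negPn/negP; exact: H.
pose N := (2 * M).+1.
pose c := ffactr p (2 * M) / (2 * M)`!%:R * moment a (2 * M).
have c0 : c != 0.
  rewrite !mulf_neq0 ?ff_neq0 ?(moment_neq0 aM)//.
pose C := abs_mass a * (`|ffactr p N| * (2^-1 `^ (p - N%:R)) * L%:R ^+ N).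
have pN : p - N%:R <= 0.
  rewrite /N -natr1 !natrM; case/andP: s02 => s0 _; have := DM; lra.
(* Were all double differences zero, the Taylor term c k^(p - 2 M) would be bounded by a remainder
   of order k^(p - 2 M - 1), and |c| k would stay bounded. The condition 2 L <= k keeps all
   arguments at least k / 2. *)
have main k : (2 * L <= k)%N -> (0 < k)%N -> `|c| * k%:R <= C.
  move=> Lk k0; have kR : (0 : R) < k%:R by rewrite ltr0n.
  have LkR : 2 * L%:R <= k%:R :> R by rewrite -natrM ler_nat.
  have LR : 1 <= L%:R :> R by rewrite ler1n ltnW.
  have low (z : R) : (k%:R - L%:R + 1) * 1 <= z -> 0 < (2^-1 * k%:R : R) <= z.
    by rewrite mulr1 mulr_gt0 ?invr_gt0// => kz; lra.
  pose F q x := ffactr p q * x `^ (p - q%:R).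
  have h1 q (z : R) : (q < N)%N -> (k%:R - L%:R + 1) * 1 <= z <= (k%:R + L%:R - 1) * 1 ->
      is_derive z 1 (F q) (F q.+1 z).
    by move=> _ /andP[/low/andP[y1 y2] _]; apply: is_derive_power; exact: lt_le_trans y2.
  have h2 (z : R) : (k%:R - L%:R + 1) * 1 <= z <= (k%:R + L%:R - 1) * 1 ->
      `|F N z| <= `|ffactr p N| * (2^-1 * k%:R) `^ (p - N%:R).
    move=> /andP[/low/andP[y1 y2] _]; rewrite normrM; apply: ler_wpM2l => //.
    by rewrite ger0_norm ?powR_ge0//; exact: ge0_ler_powRN.
  have := double_difference_taylor ltr01 h1 h2; rewrite /F.
  have -> : dd (fun x : R => ffactr p 0 * x `^ (p - 0%:R)) k%:R 1 = 0.
    rewrite -(H0 k); apply: eq_bigr => j _; apply: eq_bigr => j' _; congr (_ * _).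
    have x0 : 0 <= (k%:R + j'%:R - j%:R) * (1 : R).
      rewrite mulr1 subr_ge0 -natrD ler_nat; apply: leq_trans (leq_addr _ _).
      apply: leq_trans (ltnW (ltn_ord j)) _; apply: leq_trans Lk; exact: leq_pmull.
    by rewrite /ffactr big_ord0 mul1r subr0 ger0_norm.
  rewrite sub0r normrN big_ord_recr/= big1 ?add0r; last first.
    by move=> q _; rewrite (moment_eq0 aM) ?mulr0.
  rewrite !mulr1 expr1n mulr1.
  have -> : ffactr p (2 * M) * k%:R `^ (p - (2 * M)%:R) / (2 * M)`!%:R * moment a (2 * M) =
    c * k%:R `^ (p - (2 * M)%:R) by rewrite /c; ring.
  rewrite normrM (ger0_norm (powR_ge0 _ _)) powRM ?invr_ge0//.
  have -> : p - N%:R = p - (2 * M)%:R - 1 by rewrite /N -natr1; ring.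
  have -> : k%:R `^ (p - (2 * M)%:R - 1) = k%:R `^ (p - (2 * M)%:R) / k%:R :> R.
    by rewrite powRB ?(gt_eqF kR) ?implybT// powRr1// ltW.
  have w0 : 0 < (k%:R : R) `^ (p - (2 * M)%:R) by exact: powR_gt0.
  set w := _ `^ (p - (2 * M)%:R) in w0 *.
  rewrite /C.
  have -> : p - N%:R = p - (2 * M)%:R - 1 by rewrite /N -natr1; ring.
  set h := 2^-1 `^ _; set A := abs_mass a; set f := `|ffactr p N|; set l := L%:R ^+ N.
  have -> : A * (f * (h * (w / k%:R)) * l) = (A * (f * h * l)) / k%:R * w by ring.
  by rewrite ler_pM2r// ler_pdivlMr.
have [k0 _ hk] := @nbhs_infty_gtr R (C / `|c|).
pose k := maxn k0 (2 * L).+1.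
have := main k (leq_trans (leqnSn _) (leq_maxr _ _)) (leq_trans _ (leq_maxr _ _)).
have := hk k (leq_maxl _ _); rewrite /= ltr_pdivrMr ?normr_gt0// => h1 /(_ isT).
by rewrite mulrC leNgt h1.
Qed.

Lemma abs_power_nonvanishing : exists k : nat, dd (fun x => `|x| `^ p) k%:R 1 != 0.
Proof.
by have [/nonvanishing1 h|/nonvanishing2//] := eqVneq s 1; exists (L - 2)%N.
Qed.

End nonvanishing.

(** * Upper and lower bounds on the double differences of V *)

Section variogram.
Context (R : realType) (V r : R -> R) (a : seq R) (M D : nat) (C s alpha : R).
Local Notation d := (remainder_order s).
Hypotheses (Veven : forall x, V (- x) = V x).
Hypotheses (Vsmooth : smooth_on [set h : R | 0 < h] V).
Hypotheses (Vdiff : times_differentiable (2 * D) V).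
Hypotheses (C0 : 0 < C) (s02 : 0 < s < 2).
Hypothesis VE : forall h : R, V^`(2 * D)%classic h =
  V^`(2 * D)%classic 0 + C * (-1) ^+ D * `|h| `^ s + r h.
Hypothesis ro : r =o_ (0 : R) (fun h : R => `|h| `^ s).
Variables (beta K' : R).
Hypothesis betaI : s - d%:R < beta < - (1 / 2).
Hypothesis rd : forall h : R, 0 < h -> (alpha = 1 -> h < 1) ->
  `|r^`(d)%classic h| <= K' * h `^ beta.
Hypotheses (pa : proper_sequence a) (a0 : \sum_(j < size a) a`_j = 0).
Hypotheses (aM : has_order a M) (DM : D%:R + s / 2 + 1 / 4 < M%:R :> R).
Local Notation L := (size a).
Local Notation p := (s + (2 * D)%:R).
Local Notation dd := (double_difference a).

Let c' := C * (-1) ^+ D * expansion_coef s (2 * D).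
Let g (k : R) := dd (fun x => `|x| `^ p) k 1.

Let s0 : 0 < s. Proof. by case/andP: s02. Qed.

Let p0 : 0 < p. Proof. by rewrite ltr_wpDr. Qed.

Let DM2 : (2 * D < 2 * M)%N.
Proof. by rewrite ltn_mul2l /= -(ltr_nat R); apply: le_lt_trans DM; have := s0; lra. Qed.

Lemma double_difference_poly (c : nat -> R) m k delta : (m <= 2 * M)%N ->
  dd (fun x => \sum_(q < m) c q * x ^+ q) k delta = 0.
Proof.
elim: m => [|m IH] mM.
  rewrite /double_difference big1// => j _; rewrite big1// => j' _.
  by rewrite big_ord0 mulr0.
have -> : (fun x => \sum_(q < m.+1) c q * x ^+ q) =
    (fun x => c m * x ^+ m + \sum_(q < m) c q * x ^+ q).
  by apply/funext => x; rewrite big_ord_recr addrC.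
by rewrite double_differenceD (double_difference_monomial aM)// IH ?mulr0 ?addr0// ltnW.
Qed.

Let abs_power_scale k delta : 0 < delta ->
  dd (fun x => `|x| `^ p) k delta = delta `^ p * g k.
Proof.
move=> d0; rewrite /g /double_difference mulr_sumr; apply: eq_bigr => j _.
rewrite mulr_sumr; apply: eq_bigr => j' _.
by rewrite mulr1 normrM powRM// (gtr0_norm d0); ring.
Qed.

(** Meant for bounded lags: the Taylor polynomial of degree 2 D is killed because D < M, and
    evenness of V covers the negative arguments that occur at small lags. *)
Lemma double_difference_near0 e : 0 < e -> exists2 eta, 0 < eta &
  forall (k : nat) delta, 0 < delta -> (k + L)%:R * delta < eta ->
    `|dd V k%:R delta - c' * (delta `^ p * g k%:R)| <=
    abs_mass a * (e * ((k + L)%:R * delta) `^ p).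
Proof.
move=> e0.
have ro' e1 : 0 < e1 -> exists2 eta, 0 < eta & forall h, 0 < h < eta -> `|r h| <= e1 * h `^ s.
  move=> e10; have /eqoP/(_ _ e10)/nbhs_ballP[eta /= eta0 H] := ro.
  exists eta => // h /andP[h0 he]; have := H h; rewrite /ball/= sub0r normrN (gtr0_norm h0).
  by move=> /(_ he); rewrite (ger0_norm (powR_ge0 h s)).
have [eta eta0 H] := expansion_at_0 s0 Vdiff VE ro' e0.
exists eta => // k delta d0 kd.
pose W x := V x - taylor0 V (2 * D) x - c' * `|x| `^ p.
have V0 : V 0 = taylor0 V (2 * D) 0.
  rewrite /taylor0 big_ord_recl/= fact0 divr1 expr0 mulr1 big1 ?addr0// => i _.
  by rewrite expr0n/= mulr0.
have bW x : `|x| < eta -> `|W x| <= e * `|x| `^ p.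
  move=> xe; have [x0|x0|x0] := ltgtP 0 x.
  - rewrite /W (gtr0_norm x0); apply: H; by rewrite x0 -(gtr0_norm x0).
  - rewrite /W -Veven -(taylor0_even Veven Vdiff) (ltr0_norm x0); apply: H.
    by rewrite oppr_gt0 x0 -(ltr0_norm x0).
  - rewrite /W -x0 V0 subrr normr0 powR0 ?gt_eqF// !mulr0 subrr normr0.
    by rewrite lexx.
have -> : dd V k%:R delta - c' * (delta `^ p * g k%:R) = dd W k%:R delta.
  rewrite -abs_power_scale//.
  have -> : dd V k%:R delta = dd (fun x => c' * `|x| `^ p + (1 * taylor0 V (2 * D) x + W x)) k%:R delta.
    congr (dd _ _ _); apply/funext => x; rewrite /W; ring.
  rewrite !double_differenceD /taylor0.
  by rewrite (double_difference_poly (fun q => V^`(q)%classic 0 / q`!%:R))//; ring.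
apply: double_difference_le => j j'.
have jL := ltn_ord j; have j'L := ltn_ord j'.
have b1 : `|(k%:R + j'%:R - j%:R) * delta| <= (k + L)%:R * delta.
  rewrite normrM (gtr0_norm d0) ler_pM2r// ler_norml natrD.
  have : (j%:R : R) <= L%:R by rewrite ler_nat ltnW.
  have : (j'%:R : R) <= L%:R by rewrite ler_nat ltnW.
  have : 0 <= (j%:R : R) by []. have : 0 <= (j'%:R : R) by []. have : 0 <= (k%:R : R) by [].
  by move=> ? ? ? ? ?; apply/andP; split; lra.
apply: le_trans (bW _ (le_lt_trans b1 kd)) _; apply: ler_wpM2l; first exact: ltW.
by apply: ge0_ler_powR; rewrite ?nnegrE ?(ltW p0)// mulr_ge0// ltW.
Qed.

(** On h > 0 a bound on a derivative of r becomes one on a derivative of V. The boolean factor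
    accounts for the constant, which disappears after one differentiation. *)
Lemma derive1n_remainder k h : 0 < h ->
  r^`(k)%classic h = V^`(2 * D + k)%classic h - C * (-1) ^+ D * (ffactr s k * h `^ (s - k%:R))
    - (k == 0%N)%:R * V^`(2 * D)%classic 0.
Proof.
elim: k h => [|k IH] h h0.
  rewrite addn0 VE (gtr0_norm h0) /ffactr big_ord0 subr0 eqxx; rewrite (_ : true%:R = 1 :> R)//.
  rewrite derive1n0; ring.
rewrite derive1nS derive1E.
pose u (x : R) := V^`(2 * D + k)%classic x - C * (-1) ^+ D * (ffactr s k * x `^ (s - k%:R))
    - (k == 0%N)%:R * V^`(2 * D)%classic 0.
have -> : 'D_1 (r^`(k)%classic) h = 'D_1 u h.
  apply: near_eq_derive; near=> x; apply: IH; near: x; exact: lt_nbhsr.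
have dV := derivable_is_derive1 (@Vsmooth (2 * D + k)%N h h0); rewrite -derive1nS -addnS in dV.
have dp := is_derive_power s k h0.
have du : is_derive h 1 u (V^`(2 * D + k.+1)%classic h -
    C * (-1) ^+ D * (ffactr s k.+1 * h `^ (s - k.+1%:R))).
  by rewrite /u; apply: is_derive_eq; rewrite -![_ *: _]/(_ * _); ring.
by case: du => _ ->; rewrite mul0r subr0.
Unshelve. all: by end_near. Qed.

Let d0 : (0 < d)%N. Proof. by rewrite /remainder_order; case: ifP. Qed.

(** A Taylor expansion of order 2 D + d needs this many vanishing moments. Since D + s / 2 + 1 / 4 <
    M, one has M >= D + 1, and even M >= D + 2 when s >= 3 / 2, the case d = 3. *)
Let Nd : (2 * D + d <= 2 * M)%N.
Proof.
have := DM2; rewrite /remainder_order; case: ltP => s32 _.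
  have DM1 : (D < M)%N by rewrite -(ltr_nat R); apply: le_lt_trans DM; have := s0; lra.
  by rewrite addn2; apply: (@leq_trans (2 * D.+1)); [rewrite mulnS|rewrite leq_mul2l].
have DM1 : (D.+1 < M)%N by rewrite -(ltr_nat R) -natr1; apply: le_lt_trans DM; lra.
by apply: (@leq_trans (2 * D.+2)); [rewrite !mulnS addnA addnC leq_add2r|rewrite leq_mul2l].
Qed.

Let C1 := `|C * (-1) ^+ D * ffactr s d|.

Let derive_bound h : 0 < h -> (alpha = 1 -> h < 1) ->
  `|V^`(2 * D + d)%classic h| <= C1 * h `^ (s - d%:R) + `|K'| * h `^ beta.
Proof.
move=> h0 h1; have -> : V^`(2 * D + d)%classic h =
    C * (-1) ^+ D * ffactr s d * h `^ (s - d%:R) + r^`(d)%classic h.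
  by rewrite derive1n_remainder// (negbTE (lt0n_neq0 d0)) (_ : false%:R = 0 :> R)//; ring.
apply: le_trans (ler_normD _ _) _; apply: lerD.
  by rewrite normrM (ger0_norm (powR_ge0 _ _)).
apply: le_trans (rd h0 h1) _; apply: ler_wpM2r; [exact: powR_ge0|exact: ler_norm].
Qed.

Local Notation N := (2 * D + d)%N.

Let NE : N%:R = p - s + d%:R :> R.
Proof. by rewrite natrD; ring. Qed.

Let C2 := abs_mass a * ((C1 * (L%:R^-1 `^ (s - d%:R)) + `|K'| * (L%:R^-1 `^ beta)) * L%:R ^+ N).

Let C20 : 0 <= C2.
Proof.
apply: mulr_ge0; first exact: abs_mass_ge0.
apply: mulr_ge0; last exact: exprn_ge0.
by apply: addr_ge0; apply: mulr_ge0; rewrite ?powR_ge0 ?normr_ge0.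
Qed.

Let L2 : (1 < L)%N.
Proof.
case: pa => an ah _; move: a0 an ah; case: a => [//|x [|//]].
by rewrite big_ord1/= => -> _; rewrite eqxx.
Qed.

(** Only the Taylor remainder is left, delta^N times the N-th derivative near k delta. The power
    term gives delta^p k^(s - d); the other gives delta^(beta + N) k^beta, and beta + N > p because
    beta > s - d. With delta <= 1 and k >= 1 both are at most a constant times delta^p k^beta. *)
Lemma double_difference_far (k : nat) delta : (L <= k)%N -> 0 < delta <= 1 ->
  (alpha = 1 -> (k%:R + L%:R - 1) * delta < 1) ->
  `|dd V k%:R delta| <= C2 * (delta `^ p * k%:R `^ beta).
Proof.
move=> Lk /andP[dl0 dl1] top.
have LR : 1 < L%:R :> R by rewrite ltr1n.
have LkR : L%:R <= k%:R :> R by rewrite ler_nat.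
have kR : 1 < k%:R :> R by exact: lt_le_trans LkR.
have L0 : 0 < L%:R :> R by lra.
have k0 : 0 < k%:R :> R by lra.
(* x is below every argument: k - L + 1 >= k / L for k >= L, a bound that stays proportional to k
   delta even at k = L. *)
pose x := L%:R^-1 * (k%:R * delta).
have x0 : 0 < x by rewrite !mulr_gt0 ?invr_gt0.
have low (z : R) : (k%:R - L%:R + 1) * delta <= z -> x <= z.
  apply: le_trans; rewrite /x mulrA ler_pM2r// mulrC ler_pdivrMr//.
  have l1 : 0 <= L%:R - 1 :> R by rewrite subr_ge0 ltW.
  have l2 : 0 <= k%:R - L%:R :> R by rewrite subr_ge0.
  by have := mulr_ge0 l1 l2; nra.
have h1 q (z : R) : (q < N)%N -> (k%:R - L%:R + 1) * delta <= z <= (k%:R + L%:R - 1) * delta ->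
    is_derive z 1 (V^`(q)%classic) (V^`(q.+1)%classic z).
  move=> _ /andP[/low xz _]; have z0 := lt_le_trans x0 xz.
  by rewrite derive1nS; apply: derivable_is_derive1; exact: Vsmooth.
have [bs b12] := andP betaI.
have bN : beta <= 0 by lra.
have sN : s - d%:R <= 0 by lra.
have h2 (z : R) : (k%:R - L%:R + 1) * delta <= z <= (k%:R + L%:R - 1) * delta ->
    `|V^`(N)%classic z| <= C1 * x `^ (s - d%:R) + `|K'| * x `^ beta.
  move=> /andP[/low xz z2]; have z0 := lt_le_trans x0 xz.
  apply: le_trans (derive_bound z0 _) _; first by move=> /top; exact: le_lt_trans.
  by apply: lerD; (apply: ler_wpM2l; [exact: normr_ge0|exact: ge0_ler_powRN]).
have := double_difference_taylor dl0 h1 h2.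
rewrite big1 ?subr0; last first.
  by move=> q _; rewrite (moment_eq0 aM) ?mulr0// (leq_trans (ltn_ord q)).
rewrite derive1n0 => /le_trans; apply; rewrite /C2 -mulrA; apply: ler_wpM2l; first exact: abs_mass_ge0.
rewrite exprMn (_ : _ * (L%:R ^+ N * delta ^+ N) =
  (C1 * (x `^ (s - d%:R) * delta ^+ N) + `|K'| * (x `^ beta * delta ^+ N)) * L%:R ^+ N); last by ring.
rewrite mulrAC; apply: ler_wpM2r; first by rewrite exprn_ge0.
rewrite mulrDl -!mulrA -(powR_mulrn N (ltW dl0)).
have xE u : x `^ u = L%:R^-1 `^ u * (k%:R `^ u * delta `^ u).
  by rewrite /x !powRM ?mulr_ge0 ?invr_ge0// ltW.
have dE u : delta `^ u * delta `^ N%:R = delta `^ (u + N%:R).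
  by rewrite powRD// (gt_eqF dl0) implybT.
rewrite !xE; apply: lerD; (apply: ler_wpM2l; first exact: normr_ge0); rewrite -!mulrA;
  (apply: ler_wpM2l; first exact: powR_ge0).
  rewrite dE NE (_ : s - d%:R + (p - s + d%:R) = p); last by ring.
  rewrite mulrC; apply: ler_wpM2l; first exact: powR_ge0.
  by apply: ler_powR; [exact: ltW|exact: ltW].
rewrite dE NE mulrC; apply: ler_wpM2r; first exact: powR_ge0.
by apply: ger_powR; [rewrite dl0|lra].
Qed.

(** beta may be below - 1, whereas the sum of k^theta up to n is of order n^(1 + theta) only for
    theta > - 1; any value in ]- 1, - 1/2[ would do in place of - 3/4. *)
Let theta := Num.max beta (- (3 / 4)).

Lemma double_difference_bounds : exists (c1 c2 eta th : R) (k0 : nat),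
  [/\ 0 < c1, 0 < eta, - 1 < th, th < - (1 / 2) &
   forall delta, 0 < delta <= 1 -> delta < eta ->
   c1 * delta `^ p <= `|dd V k0%:R delta| /\
   forall k : nat, (alpha = 1 -> (k%:R + L%:R - 1) * delta < 1) ->
     `|dd V k%:R delta| <= c2 * (delta `^ p * k.+1%:R `^ th)].
Proof.
have [k0 gk0] := abs_power_nonvanishing aM pa a0 s02 DM.
have AM0 := abs_mass_ge0 a.
have c'0 : c' != 0.
  rewrite !mulf_neq0// ?signr_eq0//; first by rewrite gt_eqF.
  by rewrite gt_eqF// expansion_coef_gt0.
have L0 : 0 < L%:R :> R by rewrite ltr0n ltnW.
have q0 (k : nat) : 0 < (k + L)%:R :> R by rewrite ltr0n addn_gt0 (ltnW L2) orbT.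
pose G := `|c' * g k0%:R|.
have G0 : 0 < G by rewrite normr_gt0 mulf_neq0.
(* With this e the error at lag k0 is at most half of the main term G delta^p. *)
pose e := G / (2 * (abs_mass a + 1) * (k0 + L)%:R `^ p).
have e0 : 0 < e by rewrite divr_gt0// !mulr_gt0 ?powR_gt0// ltr_wpDl.
have [eta1 eta10 H1] := double_difference_near0 e0.
have [eta2 eta20 H2] := double_difference_near0 ltr01.
have [bs b12] := andP betaI.
have th1 : - 1 < theta by rewrite /theta lt_max; apply/orP; right; lra.
have th2 : theta < - (1 / 2) by rewrite /theta gt_max b12/=; lra.
have th0 : theta <= 0 by lra.
(* [C3] serves the lags k < L, through the expansion at 0 with error parameter 1; [C2] serves the
   lags k >= L. *)
pose C3 := `|c'| * (\sum_(k < L) `|g k%:R|) + abs_mass a * (2 * L%:R) `^ p.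
have C30 : 0 <= C3.
  by rewrite addr_ge0// mulr_ge0 ?powR_ge0//; apply: sumr_ge0.
(* The factor 2 and the power L^theta pass from k^theta and from a constant to (k + 1)^theta. The
   two terms of the minimum keep all arguments in the range of the expansion at 0, for k0 and for k
   < L. *)
exists (G / 2), (C2 * 2 + C3 / L%:R `^ theta), (Num.min (eta1 / (k0 + L)%:R) (eta2 / (2 * L%:R))), theta, k0.
split => //; first by rewrite divr_gt0.
  by rewrite lt_min !divr_gt0// mulr_gt0.
move=> delta /andP[dl0 dl1]; rewrite lt_min => /andP[l1 l2]; split.
  have := H1 k0 delta dl0; rewrite -ltr_pdivlMl// mulrC => /(_ l1) H.
  have dp : 0 <= delta `^ p by exact: powR_ge0.
  have : abs_mass a * (e * ((k0 + L)%:R * delta) `^ p) <= G / 2 * delta `^ p.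
    rewrite powRM ?(ltW dl0)//.
    have -> : abs_mass a * (e * ((k0 + L)%:R `^ p * delta `^ p)) =
        (abs_mass a / (abs_mass a + 1)) * (G / 2 * delta `^ p).
      by rewrite /e; field; rewrite !gt_eqF ?powR_gt0// ltr_wpDl.
    apply: ler_piMl; first by rewrite mulr_ge0// divr_ge0// ltW.
    by rewrite ler_pdivrMr ?mul1r ?lerDl// ltr_wpDl.
  move=> /(le_trans H); have -> : c' * (delta `^ p * g k0%:R) = delta `^ p * (c' * g k0%:R) by ring.
  have : `|delta `^ p * (c' * g k0%:R)| = delta `^ p * G by rewrite normrM ger0_norm.
  move: (delta `^ p * (c' * _)) (dd _ _ _) => u v uE uv.
  have := ler_normD (u - v) v; rewrite subrK distrC uE; lra.
move=> k top; have [kL|Lk] := ltnP k L.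
  have kd : (k + L)%:R * delta < eta2.
    apply: le_lt_trans (_ : 2 * L%:R * delta < _).
      by rewrite ler_pM2r// -natrM ler_nat mul2n -addnn leq_add2r ltnW.
    by move: l2; rewrite ltr_pdivlMr ?mulr_gt0// mulrC.
  have H := H2 k delta dl0 kd.
  have b : `|dd V k%:R delta| <= C3 * delta `^ p.
    rewrite -[dd V _ _](subrK (c' * (delta `^ p * g k%:R))).
    apply: le_trans (ler_normD _ _) _; rewrite /C3 mulrDl addrC; apply: lerD.
      rewrite normrM -mulrA; apply: ler_wpM2l => //; rewrite normrM mulrC (ger0_norm (powR_ge0 _ _)).
      apply: ler_wpM2r; first exact: powR_ge0.
      by rewrite (bigD1 (Ordinal kL))//= lerDl; exact: sumr_ge0.
    apply: le_trans H _; rewrite mul1r -mulrA; apply: ler_wpM2l => //.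
    rewrite -powRM ?mulr_ge0// ?(ltW dl0)//; apply: ge0_ler_powR; rewrite ?nnegrE ?(ltW p0)//.
    - by rewrite mulr_ge0// ltW.
    - by rewrite !mulr_ge0// ltW.
    - by rewrite ler_pM2r// -natrM ler_nat mul2n -addnn leq_add2r ltnW.
  apply: le_trans b _; rewrite [leRHS]mulrDl -[leLHS]add0r; apply: lerD.
    by apply: mulr_ge0; [exact: mulr_ge0|rewrite mulr_ge0 ?powR_ge0].
  rewrite -mulrA; apply: ler_wpM2l => //.
  rewrite mulrCA mulrC; apply: ler_peMl; first exact: powR_ge0.
  rewrite mulrC ler_pdivlMr ?powR_gt0// mul1r; apply: ge0_ler_powRN => //.
  by rewrite ler_nat.
apply: le_trans (double_difference_far Lk _ top) _; first by rewrite dl0.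
have k1 : (0 < k)%N by apply: leq_trans Lk; exact: ltnW.
have kR : 1 <= k%:R :> R by rewrite ler1n.
rewrite [leRHS]mulrDl -[leLHS]addr0; apply: lerD; last first.
  by apply: mulr_ge0; [rewrite divr_ge0 ?powR_ge0|rewrite mulr_ge0 ?powR_ge0].
rewrite -mulrA; apply: ler_wpM2l => //; rewrite mulrCA; apply: ler_wpM2l; first exact: powR_ge0.
apply: (@le_trans _ _ (k%:R `^ theta)); first by apply: ler_powR => //; rewrite /theta le_max lexx.
apply: (@le_trans _ _ (2 * (2 * k%:R) `^ theta)).
  rewrite powRM// mulrA; apply: ler_peMl; first exact: powR_ge0.
  rewrite -{1}(powRr1 (_ : 0 <= 2 :> R))// -powRD ?pnatr_eq0 ?implybT//.
  by rewrite -[leLHS](powRr0 2); apply: ler_powR; lra.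
apply: ler_wpM2l => //; apply: ge0_ler_powRN => //.
rewrite -natr1; lra.
Qed.

End variogram.

(** * The central limit theorem for a-variations *)

Section powers_of_n.
Context (R : realType).

(** Applied to the mesh itself and to the rate n^(- kappa), written with the same function. *)
Lemma mesh_cvg0 (kappa e : R) : 0 < kappa -> 0 < e ->
  \forall n \near \oo, mesh kappa n < e.
Proof.
move=> k0 e0; near=> n.
have n0 : 0 < n%:R :> R by rewrite ltr0n; near: n; exact: nbhs_infty_gt.
rewrite /mesh powRN -[ltRHS]invrK ltf_pV2 ?posrE ?powR_gt0 ?invr_gt0//.
have -> : e^-1 = (e^-1 `^ kappa^-1) `^ kappa.
  by rewrite -powRrM mulVf ?powRr1 ?invr_ge0 ?(ltW e0)// gt_eqF.
apply: gt0_ltr_powR; rewrite ?nnegrE ?powR_ge0 ?(ltW n0)//.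
by near: n; exact: nbhs_infty_gtr.
Unshelve. all: by end_near. Qed.

(** Comparison with the integral of x^th: each term is at most an increment of x^(1 + th) / (1 +
    th), by the mean value theorem. *)
Lemma sum_powR_le (th : R) n : - 1 < th -> th <= 0 ->
  \sum_(k < n) k.+1%:R `^ th <= n%:R `^ (1 + th) / (1 + th).
Proof.
move=> th1 th0; have t0 : 0 < 1 + th by lra.
elim: n => [|n IH]; first by rewrite big_ord0 divr_ge0 ?powR_ge0// ltW.
rewrite big_ord_recr/=.
suff step : n.+1%:R `^ th * (1 + th) <= n.+1%:R `^ (1 + th) - n%:R `^ (1 + th).
  apply: le_trans (lerD IH (lexx _)) _.
  by rewrite ler_pdivlMr// mulrDl divfK ?gt_eqF//; lra.
(* The derivative of the power is available for positive x, so the first increment is computed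
   directly. *)
have [->|n0] := posnP n.
  by rewrite !powR1 powR0 ?gt_eqF//; lra.
have nR : 0 < n%:R :> R by rewrite ltr0n.
have nn1 : n%:R < n.+1%:R :> R by rewrite ltr_nat.
pose F (x : R) := x `^ (1 + th).
have dF (x : R) : x \in `]n%:R, n.+1%:R[ -> is_derive x 1 F ((1 + th) * x `^ th).
  rewrite in_itv/= => /andP[nx _]; have x0 : 0 < x by exact: lt_trans nx.
  by have := is_derive1_powR (1 + th) x0; rewrite (_ : 1 + th - 1 = th)//; ring.
have cF : {within `[n%:R, n.+1%:R], continuous F}.
  apply: derivable_within_continuous => x; rewrite in_itv/= => /andP[nx _].
  by have [] := is_derive1_powR (1 + th) (lt_le_trans nR nx).
have [x] := MVT nn1 dF cF; rewrite in_itv/= => /andP[nx xn1] ->.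
rewrite -natr1 addrAC subrr add0r mulr1 mulrC; apply: ler_wpM2l; first exact: ltW.
by rewrite natr1; apply: ge0_ler_powRN => //; [exact: lt_trans nx|exact: ltW].
Qed.

(* Each distance to i is attained at most twice. *)
Lemma sum_dist_le (f : nat -> R) m (i : 'I_m) : (forall k, 0 <= f k) ->
  \sum_(j < m) f (if (i <= j)%N then j - i else i - j)%N <= 2 * \sum_(k < m) f k.
Proof.
move=> f0.
rewrite -(big_mkord xpredT (fun j => f (if (i <= j)%N then j - i else i - j)%N)).
rewrite -(big_mkord xpredT f) mulr_natl mulr2n.
have im := ltn_ord i.
rewrite (@big_cat_nat _ _ _ i)//=; last exact: ltnW.
apply: lerD.
  rewrite big_nat_rev/= add0n.
  have -> : \sum_(0 <= j < i) f (if (i <= i - j.+1)%N then i - j.+1 - i else i - (i - j.+1))%N =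
      \sum_(0 <= j < i) f j.+1.
    apply: eq_big_nat => j /andP[_ ji]; rewrite leqNgt ltn_subrL /= (leq_ltn_trans _ ji)//=.
    by rewrite subKn.
  rewrite [leRHS](@big_cat_nat _ _ _ i.+1)//=.
  by rewrite [X in _ <= X + _]big_nat_recl//= -addrA ler_wpDl// lerDl; exact: sumr_ge0.
have -> : \sum_(i <= j < m) f (if (i <= j)%N then j - i else i - j)%N = \sum_(i <= j < m) f (j - i)%N.
  by apply: eq_big_nat => j /andP[->].
rewrite -{1}[nat_of_ord i]add0n big_addn.
under eq_bigr do rewrite addnK.
rewrite [leRHS](@big_cat_nat _ _ _ (m - i))//= ?leq_subr//.
by rewrite lerDl; exact: sumr_ge0.
Qed.

End powers_of_n.

(** * The Gaussian space of the process *)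

Section gaussian_process_space.
Context (disp : measure_display) (T : measurableType disp) (R : realType).
Context (P : probability T R) (X : R -> {RV P >-> R}).
Hypotheses (gX : gaussian_process X) (cX : centered_process X).

(** The concrete [H]: combinations of values of the process, given by lists of pairs of a
    coefficient and a time, so that sums are concatenations. *)
Definition process_space (Z : T -> R) : Prop :=
  exists l : seq (R * R), Z = fun w => \sum_(x <- l) x.1 * X x.2 w.

Lemma process_space_lin (b c : R) Y Z : process_space Y -> process_space Z ->
  process_space (fun w => b * Y w + c * Z w).
Proof.
move=> [l ->] [m ->].
exists ([seq (b * x.1, x.2) | x <- l] ++ [seq (c * x.1, x.2) | x <- m]).
apply/funext => w; rewrite big_cat/= !big_map !mulr_sumr.
by congr (_ + _); apply: eq_bigr => x _; rewrite mulrA.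
Qed.

Lemma process_space_sum n (c t : 'I_n -> R) :
  process_space (fun w => \sum_(i < n) c i * X (t i) w).
Proof.
exists [seq (c i, t i) | i <- enum 'I_n]; apply/funext => w.
by rewrite big_map big_enum.
Qed.

Let facts1 t : gaussian_facts P (X t).
Proof.
apply: gaussian_rv_facts; [exact: measurable_funP| |exact: cX].
have := gX (fun _ : 'I_1 => t) (fun=> 1); congr gaussian_rv.
by apply/funext => w; rewrite big_ord1 mul1r.
Qed.

Let L1X t : L1 P (X t).
Proof.
have [mX i4 _ _] := facts1 t.
apply: (@L1_le _ _ _ P (fun w => 1 + X t w ^+ 4)) => //.
  by apply: L1D => //; exact: finite_measure_integrable_cst.
move=> w; rewrite (exprM _ 2 2) -[X t w ^+ 2]real_normK ?num_real//.
by have := normr_ge0 (X t w); move: `|_| => x x0; have := sqr_ge0 (x ^+ 2 - x);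
  have := sqr_ge0 (x - 1); nra.
Qed.

Lemma process_space_facts Z : process_space Z -> gaussian_facts P Z.
Proof.
move=> [l ->]; apply: gaussian_rv_facts.
- by apply: measurable_sum => x; apply: measurable_funM => //; exact: measurable_funP.
- have := gX (fun i => (tnth (in_tuple l) i).2) (fun i => (tnth (in_tuple l) i).1).
  by congr gaussian_rv; apply/funext => w; rewrite [RHS]big_tnth.
- have iS : L1 P (fun w => \sum_(x <- l) x.1 * X x.2 w).
    by apply: L1_sum => x _; exact: L1Z.
  rewrite unlock -[LHS]fineK; last exact: integrable_fin_num iS.
  rewrite -[fine _]/(\int[P]_w (\sum_(x <- l) x.1 * X x.2 w)) Int_sum; last first.
    by move=> x _; exact: L1Z.
  rewrite big1// => x _; rewrite IntZ//.
  by have := cX x.2; rewrite unlock /Rintegral => ->; rewrite mulr0.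
Qed.

End gaussian_process_space.

Section covariance_of_differences.
Context (disp : measure_display) (T : measurableType disp) (R : realType).
Context (P : probability T R) (X : R -> {RV P >-> R}) (a : seq R) (alpha : R).
Hypotheses (gX : gaussian_process X) (cX : centered_process X).
Hypotheses (sX : stationary_increments X) (a0 : \sum_(j < size a) a`_j = 0).
Local Notation V := (semi_variogram X).
Local Notation L := (size a).

(** Ordinals start at 0 and the differences at 1, whence [i.+1]. *)
Definition differences n (i : 'I_(n.+1 - L)) (w : T) : R :=
  a_difference a (mesh alpha n) (fun t => X t w) i.+1.

Let Hfacts := process_space_facts gX cX.

Let HX t : process_space X (X t).
Proof.
by exists [:: (1, t)]; apply/funext => w; rewrite big_seq1 mul1r.
Qed.

Lemma differences_space n i : process_space X (@differences n i).
Proof. exact: process_space_sum. Qed.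

Lemma semi_variogram_cov u v : 2 * V (v - u) =
  cov P (X u) (X u) + cov P (X v) (X v) - 2 * cov P (X u) (X v).
Proof.
rewrite (semi_variogramE u (v - u) sX) mulrA mulfV ?mul1r//.
have L12 := H_L1_2 Hfacts.
transitivity (\int[P]_w (X u w * X u w + X v w * X v w - 2 * (X u w * X v w))).
  by rewrite unlock /Rintegral; congr fine; apply: eq_integral => w _; rewrite [u + _]addrC subrK; congr EFin; ring.
rewrite IntB; [|by apply: L1D; exact: L12|by apply: L1Z; exact: L12].
by rewrite IntD ?IntZ//; exact: L12.
Qed.

Lemma semi_variogram_even h : V (- h) = V h.
Proof.
have := semi_variogram_cov 0 h; have := semi_variogram_cov h 0.
rewrite sub0r subr0 (covC P (X h) (X 0)) => h1 h2.
suff : 2 * V (- h) = 2 * V h by lra.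
by rewrite h1 h2; ring.
Qed.

(** By [semi_variogram_cov], cov (X_u, X_v) is - V (v - u) plus half of each variance. Each variance
    depends on one index only and is cancelled by the zero sum of a. *)
Lemma cov_differences n (i i' : 'I_(n.+1 - L)) :
  cov P (differences i) (differences i') =
  - double_difference a V (i'%:R - i%:R) (mesh alpha n).
Proof.
set dl := mesh alpha n.
have L12 := H_L1_2 Hfacts.
pose x (k : nat) (j : 'I_L) := (k.+1 + j)%:R * dl.
have -> : cov P (differences i) (differences i') =
    \sum_(j < L) \sum_(j' < L) a`_j * a`_j' * cov P (X (x i j)) (X (x i' j')).
  transitivity (\int[P]_w (\sum_(j < L) \sum_(j' < L) a`_j * a`_j' * (X (x i j) w * X (x i' j') w))).
    apply: eq_Rintegral => w _; rewrite /differences /a_difference big_distrlr/=.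
    by apply: eq_bigr => j _; apply: eq_bigr => j' _; rewrite -/(x i j) -/(x i' j'); ring.
  rewrite Int_sum; last by move=> j _; apply: L1_sum => j' _; apply: L1Z; exact: L12.
  apply: eq_bigr => j _; rewrite Int_sum; last by move=> j' _; apply: L1Z; exact: L12.
  by apply: eq_bigr => j' _; rewrite IntZ//; exact: L12.
have VE j j' : cov P (X (x i j)) (X (x i' j')) = - V ((i'%:R - i%:R + j'%:R - j%:R) * dl)
    + 2^-1 * cov P (X (x i j)) (X (x i j)) + 2^-1 * cov P (X (x i' j')) (X (x i' j')).
  have := semi_variogram_cov (x i j) (x i' j').
  have -> : x i' j' - x i j = (i'%:R - i%:R + j'%:R - j%:R) * dl.
    by rewrite /x !natrD -!natr1; ring.
  by move: (V _) (cov _ _ _) (cov _ _ _) (cov _ _ _) => v c1 c2 c3; lra.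
under eq_bigr do under eq_bigr do rewrite VE !mulrDr.
under eq_bigr do rewrite !big_split/=.
rewrite !big_split/=.
have -> : \sum_(j < L) \sum_(j' < L) a`_j * a`_j' * (2^-1 * cov P (X (x i j)) (X (x i j))) = 0.
  rewrite big1// => j _.
  transitivity ((\sum_(j' < L) a`_j') * (a`_j * (2^-1 * cov P (X (x i j)) (X (x i j))))).
    by rewrite mulr_suml; apply: eq_bigr => j' _; ring.
  by rewrite a0 mul0r.
have -> : \sum_(j < L) \sum_(j' < L) a`_j * a`_j' * (2^-1 * cov P (X (x i' j')) (X (x i' j'))) = 0.
  rewrite exchange_big big1//= => j' _.
  transitivity ((\sum_(j < L) a`_j) * (a`_j' * (2^-1 * cov P (X (x i' j')) (X (x i' j'))))).
    by rewrite mulr_suml; apply: eq_bigr => j _; ring.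
  by rewrite a0 mul0r.
rewrite !addr0 /double_difference -sumrN; apply: eq_bigr => j _.
by rewrite -sumrN; apply: eq_bigr => j' _; rewrite mulrN.
Qed.

Lemma norm_cov_differences n (i i' : 'I_(n.+1 - L)) :
  `|cov P (differences i) (differences i')| =
  `|double_difference a V (if (i <= i')%N then i' - i else i - i')%N%:R (mesh alpha n)|.
Proof.
case: ifP => ii; first by rewrite cov_differences normrN natrB.
rewrite covC cov_differences normrN natrB//.
by move/negbT : ii; rewrite -ltnNge => /ltnW.
Qed.

Lemma Van_sqnorm n : Van X a alpha n = sqnorm (@differences n).
Proof.
apply/funext => w; rewrite /Van /quadratic_a_variation /sqnorm big_add1/=.
by rewrite big_mkord.
Qed.

Lemma normalized_Van_sqnorm n : normalized_Van X a alpha n = normalized_sqnorm P (@differences n).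
Proof.
have HY := @differences_space n.
have iQ := L1_sqnorm Hfacts HY.
have EQ : ('E_P[sqnorm (@differences n)] = (covtrace P (@differences n))%:E)%E.
  rewrite unlock -[LHS]fineK; last exact: integrable_fin_num iQ.
  exact: (congr1 EFin (Int_sqnorm Hfacts HY)).
apply/funext => w; rewrite /normalized_Van /normalized_sqnorm Van_sqnorm EQ /=.
congr (_ / Num.sqrt _); rewrite -(var_sqnorm Hfacts (@process_space_lin _ _ _ _ X) HY).
rewrite /variance unlock EQ /= unlock; congr fine.
Qed.

End covariance_of_differences.

Section row_sums.
Context (R : realType).

(** The entries at lag k0 above the diagonal number m - k0; for m <= k0 the truncated difference
    makes the bound trivial. *)
Lemma card_shift_sum_ge (f : nat -> nat -> R) m k0 (b : R) :
  (forall i j, 0 <= f i j) -> (forall i, b <= f i (i + k0)%N) ->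
  (m - k0)%:R * b <= \sum_(i < m) \sum_(j < m) f i j.
Proof.
move=> f0 fb.
have -> : (m - k0)%:R * b = \sum_(i < m - k0) b by rewrite sumr_const card_ord mulr_natl.
rewrite (big_ord_widen m (fun=> b)) ?leq_subr// big_mkcond/=.
apply: ler_sum => i _; case: ifP => ik; last exact: sumr_ge0.
have im : (i + k0 < m)%N by rewrite addnC -ltn_subRL.
by rewrite (bigD1 (Ordinal im))//= ler_wpDr ?sumr_ge0.
Qed.

End row_sums.

Theorem theorem3p4 (disp : measure_display) (T : measurableType disp)
    (R : realType) (P : probability T R) (X : R -> {RV P >-> R})
    (alpha : R) (D : nat) (C s : R) (r : R -> R) (a : seq R) (M : nat)
    (V := semi_variogram X) (d := remainder_order s) :
  gaussian_process X -> centered_process X -> stationary_increments X ->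
  0 < alpha <= 1 ->
  smooth_on [set h : R | 0 < h] V ->
  times_differentiable (2 * D) V ->
  0 < C -> 0 < s < 2 ->
  (forall h : R, V^`(2 * D)%classic h =
     V^`(2 * D)%classic 0 + C * (-1) ^+ D * `|h| `^ s + r h) ->
  r =o_ (0 : R) (fun h : R => `|h| `^ s) ->
  (alpha < 1 ->
     exists K : R, forall h : R, 1 < `|h| -> `|r h| <= K * `|h| `^ s) ->
  (exists beta K' : R,
     [/\ s - d%:R < beta < - (1 / 2),
         alpha = 1 -> forall h : R, 0 < `|h| < 1 ->
           `|r^`(d)%classic h| <= K' * `|h| `^ beta
       & alpha < 1 -> forall h : R, h != 0 ->
           `|r^`(d)%classic h| <= K' * `|h| `^ beta]) ->
  proper_sequence a -> \sum_(j < size a) a`_j = 0 -> has_order a M ->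
  D%:R + s / 2 + 1 / 4 < M%:R :> R ->
  cvg_in_distribution P (normalized_Van X a alpha) (normal_prob 0 1).
Proof.
move=> gX cX sX /andP[al0 al1] Vsm Vdf C0 s02 VE ro _ [beta [K' [bI rd1 rd2]]] pa a0 aM DM.
have Veven := semi_variogram_even gX cX sX.
have rd (h : R) : 0 < h -> (alpha = 1 -> h < 1) -> `|r^`(d)%classic h| <= K' * h `^ beta.
  move=> h0 h1; rewrite -{2}(gtr0_norm h0).
  have [a1|a1] := eqVneq alpha 1; first by apply: rd1; rewrite // (gtr0_norm h0) h0 h1.
  by apply: rd2; [rewrite lt_neqAle a1|rewrite gt_eqF].
have [c1 [c2 [eta [th [k0 [c10 eta0 th1 th2 bnd]]]]]] :=
  double_difference_bounds Veven Vsm Vdf C0 s02 VE ro bI rd pa a0 aM DM.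
have Hfacts := process_space_facts gX cX.
pose Y n := @differences _ T R P X a alpha n.
have HY n i : process_space X (Y n i) by exact: differences_space.
pose L := size a.
have t0 : 0 < 1 + th by lra.
move=> x _.
have nE : normal_prob (0 : R) 1 `]-oo, x]%classic = (normal_cdf x)%:E.
  rewrite /normal_cdf /Rintegral fineK// -[X in X \is a fin_num]/(normal_prob 0 1 `]-oo, x]%classic).
  exact: fin_num_measure.
rewrite [X in _ --> X]nE.
have PE n : P [set w | normalized_Van X a alpha n w <= x] =
    (fine (P [set w | normalized_sqnorm P (Y n) w <= x]))%:E.
  rewrite fineK; last first.
    apply: fin_num_measure; rewrite -[X in measurable X]setTI.
    have mF : measurable_fun setT (normalized_sqnorm P (Y n)).
      apply: measurable_funM => //; apply: measurable_funB => //.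
      exact: L1_measurable (L1_sqnorm Hfacts (HY n)).
    have -> : [set w | normalized_sqnorm P (Y n) w <= x] =
        normalized_sqnorm P (Y n) @^-1` `]-oo, x]%classic.
      by apply/seteqP; split=> w /=; rewrite in_itv.
    exact: mF.
  by rewrite (normalized_Van_sqnorm a alpha gX cX).
under eq_fun do rewrite PE.
apply: cvg_EFin; first exact: nearW.
apply: (quadratic_form_clt Hfacts (@process_space_lin _ _ _ _ X)) => [n i|e e0].
  exact: differences_space.
(* The row sum bound rho will be at most c3 delta^p n^(1 + th), and tr S^2 at least n (c1 delta^p)^2
   / 2. So rho^2 / tr S^2 is at most a constant times n^(- kappa), and e1 is the threshold for n^(-
   kappa) that makes it at most e^2. *)
pose c3 := 2 * c2 / (1 + th).
pose kappa := - (1 + 2 * th).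
have kappa0 : 0 < kappa by rewrite /kappa; lra.
pose e1 := e ^+ 2 * (c1 ^+ 2 / 2) / (c3 ^+ 2 + 1).
have e10 : 0 < e1.
  by rewrite divr_gt0 ?mulr_gt0 ?exprn_gt0 ?divr_gt0// ltr_wpDl ?sqr_ge0.
near=> n.
have n0 : (0 < n)%N by near: n; exact: nbhs_infty_gt.
have nR : 0 < n%:R :> R by rewrite ltr0n.
set dl := mesh alpha n.
have dl0 : 0 < dl by rewrite powR_gt0.
have dl1 : dl <= 1.
  rewrite /dl /mesh powRN invf_le1 ?powR_gt0// -[leLHS](powRr0 n%:R).
  by apply: ler_powR; [rewrite ler1n|exact: ltW].
have dleta : mesh alpha n < eta by near: n; exact: mesh_cvg0.
have dl01 : 0 < dl <= 1 by rewrite dl0.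
have [lower upper] := bnd dl dl01 dleta.
set p := s + (2 * D)%:R in lower upper *.
set m := (n.+1 - L)%N.
(* From this n on, m - k0 is at least n / 2 ([mk0]). *)
have nbig : (2 * (L + k0) <= n)%N by near: n; exact: nbhs_infty_ge.
have Ln : (L <= n)%N by apply: leq_trans nbig; rewrite mul2n -addnn -addnA leq_addr.
(* For alpha = 1 the bound on the derivative of r holds on ]0, 1[; the largest argument, (k + L - 1)
   / n, stays below 1 because k + L <= n. *)
have top k : (k < m)%N -> alpha = 1 -> (k%:R + L%:R - 1) * dl < 1.
  move=> km a1; rewrite /dl /mesh a1 powR_inv1 ?(ltW nR)// ltr_pdivrMr// mul1r.
  have : (k + L <= n)%N by move: km; rewrite /m ltn_subRL addnC ltnS.
  by rewrite -(ler_nat R) natrD; lra.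
pose u := dl `^ p.
have u0 : 0 < u by exact: powR_gt0.
have m0 : (0 < m)%N by rewrite subn_gt0.
have mk0 : n%:R <= 2 * (m - k0)%:R :> R.
  have nbig' : (2 * (L + k0) + n <= 2 * n.+1)%N.
    by rewrite (mul2n n.+1) -addnn leq_add ?leqnSn// (leq_trans nbig).
  rewrite -natrM ler_nat /m -subnDA mulnBr leq_subRL//.
  by apply: leq_trans nbig'; exact: leq_addr.
have c20 : 0 <= c2.
  have := le_trans (normr_ge0 _) (upper 0%N (top 0%N m0)).
  by rewrite powR1 mulr1 pmulr_lge0.
pose f k := c2 * (u * k.+1%:R `^ th).
have f0 k : 0 <= f k by rewrite !mulr_ge0 ?powR_ge0// ltW.
have dist_lt (i j : 'I_m) : ((if (i <= j)%N then j - i else i - j) < m)%N.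
  by case: ifP => _; apply: leq_ltn_trans (leq_subr _ _) (ltn_ord _).
pose h (i j : nat) := `|double_difference a (semi_variogram X)
  (if (i <= j)%N then j - i else i - j)%N%:R dl| ^+ 2.
have S2E : cov_frob2 P (Y n) = \sum_(i < m) \sum_(j < m) h i j.
  apply: eq_bigr => i _; apply: eq_bigr => j _.
  by rewrite -real_normK ?num_real// (norm_cov_differences alpha gX cX sX a0).
have S2low : (m - k0)%:R * (c1 * u) ^+ 2 <= cov_frob2 P (Y n).
  rewrite S2E; apply: card_shift_sum_ge => [i j|i]; first exact: sqr_ge0.
  rewrite /h leq_addr addKn; by apply: lerXn2r => //; rewrite nnegrE ?normr_ge0// mulr_ge0 ?(ltW c10) ?(ltW u0).
have S2pos : n%:R * (c1 * u) ^+ 2 <= 2 * cov_frob2 P (Y n).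
  apply: le_trans (ler_wpM2r (sqr_ge0 _) mk0) _.
  by rewrite -mulrA ler_pM2l ?ltr0n.
exists (2 * \sum_(k < m) f k); split.
- have : 0 < n%:R * (c1 * u) ^+ 2 by rewrite !mulr_gt0// exprn_gt0// mulr_gt0.
  by move/lt_le_trans => /(_ _ S2pos); rewrite pmulr_rgt0.
- move=> i; apply: le_trans (sum_dist_le i f0); apply: ler_sum => j _.
  rewrite (norm_cov_differences alpha gX cX sX a0); apply: upper; exact: top.
have sumf : \sum_(k < m) f k <= c2 * (u * (n%:R `^ (1 + th) / (1 + th))).
  rewrite /f -mulr_sumr -mulr_sumr; apply: ler_wpM2l => //; apply: ler_wpM2l; first exact: ltW.
  apply: le_trans (sum_powR_le _ th1 _) _; first lra.
  apply: ler_wpM2r; first by rewrite invr_ge0 ltW.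
  apply: ge0_ler_powR; rewrite ?nnegrE ?(ltW t0)//.
  rewrite ler_nat leq_subLR -add1n leq_add2r lt0n size_eq0.
  by case: pa.
have rho_le : 2 * \sum_(k < m) f k <= c3 * u * n%:R `^ (1 + th).
  have -> : c3 * u * n%:R `^ (1 + th) = 2 * (c2 * (u * (n%:R `^ (1 + th) / (1 + th)))).
    by rewrite /c3; ring.
  exact: ler_wpM2l.
have S0 : 0 <= \sum_(k < m) f k by exact: sumr_ge0.
have rho0 : 0 <= 2 * \sum_(k < m) f k by exact: mulr_ge0.
apply: le_trans (lerXn2r 2 _ _ rho_le) _; rewrite ?nnegrE//.
  exact: le_trans rho_le.
have mk : mesh kappa n < e1 by near: n; exact: mesh_cvg0.
(* n^(2 + 2 th) is n times n^(- kappa); the factor n matches the one in the lower bound for tr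
   S^2. *)
have -> : (c3 * u * n%:R `^ (1 + th)) ^+ 2 = c3 ^+ 2 * u ^+ 2 * (n%:R * mesh kappa n).
  rewrite !exprMn; congr (_ * _); rewrite expr2 -powRD; last by rewrite (gt_eqF nR) implybT.
  rewrite /mesh /kappa opprK (_ : 1 + th + (1 + th) = 1 + (1 + 2 * th)); last by ring.
  by rewrite powRD ?(gt_eqF nR) ?implybT// powRr1// ltW.
have c3e : c3 ^+ 2 * e1 <= e ^+ 2 * (c1 ^+ 2 / 2).
  have -> : c3 ^+ 2 * e1 = e ^+ 2 * (c1 ^+ 2 / 2) * (c3 ^+ 2 / (c3 ^+ 2 + 1)).
    by rewrite /e1; field; rewrite gt_eqF// ltr_wpDl ?sqr_ge0.
  apply: ler_piMr; first by apply: mulr_ge0; rewrite ?divr_ge0 ?sqr_ge0.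
  by rewrite ler_pdivrMr ?ltr_wpDl ?sqr_ge0// mul1r lerDl.
apply: (@le_trans _ _ (e ^+ 2 * (c1 ^+ 2 / 2) * (u ^+ 2 * n%:R))).
  have -> : c3 ^+ 2 * u ^+ 2 * (n%:R * mesh kappa n) = c3 ^+ 2 * mesh kappa n * (u ^+ 2 * n%:R) by ring.
  apply: ler_wpM2r; first by rewrite mulr_ge0 ?sqr_ge0.
  by apply: le_trans c3e; apply: ler_wpM2l; [exact: sqr_ge0|exact: ltW].
rewrite -mulrA; apply: ler_wpM2l; first exact: sqr_ge0.
by move: S2pos; rewrite exprMn; lra.
Unshelve. all: by end_near. Qed.
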